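(* Let $\mathsf L$ be non-degenerate, with the associated data $\Delta$, $A_j^a,B_\ell^a,C_j^a,D_\ell^a$, $\mathcal L_a$, $I_q^\pm$, $J_r^\pm$ of the context. The fibre integral $I^\zeta_{x^{\mathbf i},\gamma}(s,s')$ satisfies the following hypergeometric system of Horn type: $$\Bigl[P_{q,\mathbf i}(\vartheta_s,\vartheta_{s'},\zeta)-s_q^\Delta\,Q_{q,\mathbf i}(\vartheta_s,\vartheta_{s'},\zeta)\Bigr]I^\zeta_{x^{\mathbf i},\gamma}(s,s')=0,\qquad 1\le q\le k,$$ with $$P_{q,\mathbf i}(\vartheta_s,\vartheta_{s'},\zeta)=\prod_{a\in I_q^+}\prod_{j=0}^{B_q^a-1}\bigl(\mathcal L_a(\mathbf i,-\vartheta_s,-\vartheta_{s'},\zeta)+j\bigr),\qquad Q_{q,\mathbf i}(\vartheta_s,\vartheta_{s'},\zeta)=\prod_{\bar a\in I_q^-}\prod_{j=0}^{-B_q^{\bar a}-1}\bigl(\mathcal L_{\bar a}(\mathbf i,-\vartheta_s,-\vartheta_{s'},\zeta)+j\bigr),$$ and $$\Bigl[P'_{r,\mathbf i}(\vartheta_s,\vartheta_{s'},\zeta)-(s'_r)^\Delta\,Q'_{r,\mathbf i}(\vartheta_s,\vartheta_{s'},\zeta)\Bigr]I^\zeta_{x^{\mathbf i},\gamma}(s,s')=0,\qquad 1\le r\le m,$$ with $$P'_{r,\mathbf i}(\vartheta_s,\vartheta_{s'},\zeta)=\prod_{a\in J_r^+}\prod_{j=0}^{C_r^a-1}\bigl(\mathcal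 L_a(\mathbf i,-\vartheta_s,-\vartheta_{s'},\zeta)+j\bigr),\qquad Q'_{r,\mathbf i}(\vartheta_s,\vartheta_{s'},\zeta)=\prod_{\bar a\in J_r^-}\prod_{j=0}^{-C_r^{\bar a}-1}\bigl(\mathcal L_{\bar a}(\mathbf i,-\vartheta_s,-\vartheta_{s'},\zeta)+j\bigr).$$ Moreover the degrees of the two operators in each pair are equal: $$\deg P_{q,\mathbf i}=\sum_{a\in I_q^+}B_q^a=-\sum_{\bar a\in I_q^-}B_q^{\bar a}=\deg Q_{q,\mathbf i},\qquad \deg P'_{r,\mathbf i}=\sum_{a\in J_r^+}C_r^a=-\sum_{\bar a\in J_r^-}C_r^{\bar a}=\deg Q'_{r,\mathbf i}.$$
   Context: Setting. Fix $N,k\ge 1$ and polynomials $f_\ell(x)=x^{\vec\alpha_{1,\ell}}+\cdots+x^{\vec\alpha_{\tau_\ell,\ell}}$, $1\le\ell\le k$, in $x=(x_1,\dots,x_N)$ with $\vec\alpha_{i,\ell}\in(\mathbf Z_{\ge0})^N$, defining a non-degenerate complete intersection in the sense of Danilov–Khovanskii. Put $L=\sum_{q=1}^k(\tau_q+1)$. It is assumed that $N+2k\le L$ and that the $(k+N)\times L$ matrix whose columns are $(e_q,0)$ and $(e_q,\vec\alpha_{i,q})$ ($1\le q\le k$, $1\le i\le\tau_q$, $e_q$ the standard basis of $\mathbf Z^k$) has rank $k+N$. Let $m=L-N-2k\ge0$. Choose $m$ of the monomials $x^{\vec\alpha_{i,\ell}}$ and multiply each of them by its own new variable $s'_1,\dots,s'_m$;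 write $f_\ell(x,s')$ for the resulting polynomials. Let $F(x,s',s,y)=\sum_{\ell=1}^k y_\ell\,(f_\ell(x,s')+s_\ell)$. It is a sum of $L$ monomials $T_1,\dots,T_L$, ordered in $k$ successive blocks, the $q$-th block being the monomials of $y_qf_q(x,s')$ followed by $y_qs_q$. It involves exactly $L=N+m+2k$ variables, ordered as $\Xi=(x_1,\dots,x_N,s'_1,\dots,s'_m,s_1,\dots,s_k,y_1,\dots,y_k)$. Let $\mathsf L$ be the $L\times L$ integer matrix whose $a$-th row is the exponent vector of $T_a$ in the variables $\Xi$, i.e. $\log T=\mathsf L\log\Xi$. The choice of modified monomials is assumed to be such that $\mathsf L$ is non-degenerate ($\det\mathsf L\ne0$). Let $\Delta$ be the least positive integer such that $\Delta\,\mathsf L^{-1}$ has integer entries, and denote the $a$-th column of $\Delta\,\mathsf L^{-1}$ by ${}^t(A_1^a,\dots,A_N^a,C_1^a,\dots,C_m^a,B_1^a,\dots,B_k^a,D_1^a,\dots,D_k^a)$, $a\in I=\{1,\dots,L\}$. For $\mathbf i=(i_1,\dots,i_N)\in\mathbf Z^N$, $\mathbf z=(z_1,\dots,z_k)$, $\mathbf z'=(z'_1,\dots,z'_m)$ and parameters $\zeta=(\zeta_1,\dots,\zeta_k)$ put $$\mathcal L_a(\mathbf i,\mathbf z,\mathbf z',\zeta)=\frac1\Delta\Bigl(\sum_{j=1}^NA_j^a(i_j+1)+\sum_{j=1}^mC_j^az'_j+\sum_{\ell=1}^k\bigl(B_\ell^az_\ell+D_\ell^a(\zeta_\ell+1)\bigr)\Bigr).$$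 Put $I_q^{+}=\{a\in I: B_q^a>0\}$, $I_q^-=\{a\in I:B_q^a<0\}$, $J_r^+=\{a\in I:C_r^a>0\}$, $J_r^-=\{a\in I:C_r^a<0\}$. Euler operators: $\vartheta_s=(s_1\partial_{s_1},\dots,s_k\partial_{s_k})$, $\vartheta_{s'}=(s'_1\partial_{s'_1},\dots,s'_m\partial_{s'_m})$; the degree of an operator polynomial in these is its degree as a polynomial. Fibre integral: let $\gamma$ be a Leray coboundary cycle in $H_N\bigl((\mathbf C^\times)^N\setminus\bigcup_{i=1}^k\{x: f_i(x,s')+s_i=0\}\bigr)$ with $\Re(f_i(x,s')+s_i)|_\gamma<0$, and put $$I^\zeta_{x^{\mathbf i},\gamma}(s,s')=\int_\gamma\prod_{\ell=1}^k(f_\ell(x,s')+s_\ell)^{-\zeta_\ell-1}\;x_1^{i_1}\cdots x_N^{i_N}\,dx_1\wedge\cdots\wedge dx_N,$$ a (multivalued) function of $(s,s')\in(\mathbf C^\times)^{k+m}$. *)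

(* Defs.v *)
From HB Require Import structures.
From mathcomp Require Import all_boot all_order all_algebra.
From mathcomp Require Import all_classical all_reals all_analysis.
From mathcomp Require Import complex.
(* mpoly's notations clash with those of mathcomp-analysis. *)
From mathcomp Require Import -(notations) mpoly.

Set Implicit Arguments.
Unset Strict Implicit.
Unset Printing Implicit Defensive.
Import Order.TTheory GRing.Theory Num.Theory numFieldNormedType.Exports.

Local Open Scope ring_scope.
Local Open Scope classical_set_scope.
Local Open Scope complex_scope.

(* R[i] as a normed module over itself: a limit, 'D_v or differentiable taken
   on R[i] or on 'rV[R[i]]_n is then the complex one. *)
HB.instance Definition _ (R : realType) := NormedModule.copy R[i] (R[i])^o.

Section Smooth.
Variables (K : numFieldType) (n : nat).
Implicit Types (g : 'rV[K]_n -> K) (V : set 'rV[K]_n).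

Definition partial (j : 'I_n) g : 'rV[K]_n -> K :=
  fun p => 'D_(delta_mx 0 j) g p.

(* All iterated partial derivatives exist and are differentiable at every point
   of V (used for V open). For K = R this is C^oo. For K = R[i] it is
   holomorphy, since a complex differentiable function on an open set has
   complex derivatives of all orders. *)
Definition smooth_on V g : Prop :=
  forall (js : seq 'I_n) p, V p -> differentiable (foldr partial g js) p.

End Smooth.

Definition holomorphic_on (R : realType) n (V : set 'rV[R[i]]_n)
  (g : 'rV[R[i]]_n -> R[i]) : Prop := smooth_on V g.

Definition ctorus (R : realType) n : set 'rV[R[i]]_n :=
  [set p | forall j, p 0 j != 0].

(* The branches, over open subsets of the torus, of the multivalued function
   obtained from f : U -> C by iterated analytic continuation. *)
Inductive analytic_branch (R : realType) n (U : set 'rV[R[i]]_n)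
    (f : 'rV[R[i]]_n -> R[i]) :
    set 'rV[R[i]]_n -> ('rV[R[i]]_n -> R[i]) -> Prop :=
| branch_init V : open V -> V `<=` U -> analytic_branch U f V f
| branch_continuation V g V' g' W :
    analytic_branch U f V g ->
    open V' -> connected V' -> V' `<=` @ctorus R n -> holomorphic_on V' g' ->
    open W -> W !=set0 -> W `<=` V `&` V' -> (forall p, W p -> g p = g' p) ->
    analytic_branch U f V' g'.

Definition cexp (R : realType) (z : R[i]) : R[i] :=
  (expR (complex.Re z))%:C *
  (cos (complex.Im z) +i* sin (complex.Im z)).

(* A determination of log on the half plane Re w < 0; two of them differ by a
   constant in 2 pi i Z. *)
Definition log_branch (R : realType) (lam : R[i] -> R[i]) : Prop :=
  forall w, complex.Re w < 0 -> cexp (lam w) = w /\ {for w, continuous lam}.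

(* A singular cube is the restriction to [0,1]^N of a map defined on R^N. *)
Record chain (R : realType) (N : nat) := Chain {
  chain_size : nat;
  chain_coef : 'I_chain_size -> int;
  chain_cube : 'I_chain_size -> 'rV[R]_N -> 'rV[R[i]]_N }.
Arguments chain_coef {R N} c _ : rename.
Arguments chain_cube {R N} c _ _ : rename.

Section Chains.
Variable R : realType.

Definition unit_cube n : set 'rV[R]_n := [set t | forall j, 0 <= t 0 j <= 1].

Definition smooth_cube N (sg : 'rV[R]_N -> 'rV[R[i]]_N) : Prop :=
  forall j, smooth_on setT (fun t => complex.Re (sg t 0 j)) /\
            smooth_on setT (fun t => complex.Im (sg t 0 j)).

(* The inclusion of the face t_i = e of [0,1]^N. *)
Definition face N (i : 'I_N) (e : bool) (t : 'rV[R]_N.-1) : 'rV[R]_N :=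
  \row_j (if unlift i j is Some j' then t 0 j' else e%:R).

Definition eq_cube n T (f g : 'rV[R]_n -> T) : Prop :=
  forall t, @unit_cube n t -> f t = g t.

Definition degenerate_cube n T (f : 'rV[R]_n -> T) : Prop :=
  exists i : 'I_n, forall t u, @unit_cube n t -> @unit_cube n u ->
    (forall j, j != i -> t 0 j = u 0 j) -> f t = f u.

(* Coefficient of the (N-1)-cube f in the boundary of ga. *)
Definition boundary_coef N (ga : chain R N)
    (f : 'rV[R]_N.-1 -> 'rV[R[i]]_N) : int :=
  \sum_c \sum_(i < N) \sum_(e : bool)
    chain_coef ga c * (-1) ^+ (i.+1 + e) *
    `[< eq_cube (chain_cube ga c \o face i e) f >]%:R.

(* Cycles of the cubical singular complex, in which degenerate cubes are 0; its
   homology is the singular homology of X. *)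
Definition cycle_in N (X : set 'rV[R[i]]_N) (ga : chain R N) : Prop :=
  (forall c, smooth_cube (chain_cube ga c) /\
             forall t, unit_cube t -> X (chain_cube ga c t)) /\
  (forall f, ~ degenerate_cube f -> boundary_coef ga f = 0).

Fixpoint cube_Rintegral n : ('rV[R]_n -> R) -> R :=
  if n is n'.+1 return ('rV[R]_n -> R) -> R then
    fun f => \int[lebesgue_measure]_(t in `[0, 1])
               cube_Rintegral (fun u : 'rV[R]_n' =>
                 f (row_mx (t%:M : 'rV[R]_1) u))
  else fun f => f 0.

Definition cube_integral n (f : 'rV[R]_n -> R[i]) : R[i] :=
  cube_Rintegral (fun t => complex.Re (f t)) +i*
  cube_Rintegral (fun t => complex.Im (f t)).

Definition cube_jacobian N (sg : 'rV[R]_N -> 'rV[R[i]]_N) (t : 'rV[R]_N) :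
    'M[R[i]]_N :=
  \matrix_(i, j) (partial i (fun u => complex.Re (sg u 0 j)) t +i*
                  partial i (fun u => complex.Im (sg u 0 j)) t).

(* Integral of h dx_1 /\ ... /\ dx_N over ga. *)
Definition chain_integral N (ga : chain R N) (h : 'rV[R[i]]_N -> R[i]) : R[i] :=
  \sum_c (chain_coef ga c)%:~R *
    cube_integral (fun t =>
      h (chain_cube ga c t) * \det (cube_jacobian (chain_cube ga c) t)).

End Chains.

Section System.
Variables (N k m : nat) (tau : 'I_k -> nat).
(* alpha l i is the exponent vector of the i-th monomial of f_l. *)
Variable alpha : forall l : 'I_k, 'I_(tau l) -> 'I_N -> nat.
(* s'_r multiplies the monomial mu r; Tagged _ i is the i-th monomial of f_l. *)
Variable mu : 'I_m -> {l : 'I_k & 'I_(tau l)}.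

Definition is_modified_by (r : 'I_m) (l : 'I_k) (i : 'I_(tau l)) : bool :=
  mu r == Tagged (fun l => 'I_(tau l)) i.

Section Nondegenerate.
Variable R : realType.

Definition pairing (xi : 'rV[R]_N) (l : 'I_k) (i : 'I_(tau l)) : R :=
  \sum_j xi 0 j * (alpha i j)%:R.

Definition on_face (xi : 'rV[R]_N) (l : 'I_k) (i : 'I_(tau l)) : bool :=
  [forall i' : 'I_(tau l), pairing xi i <= pairing xi i'].

(* Part of f_l supported by the face of its Newton polytope where the linear
   form xi is minimal. *)
Definition face_poly (xi : 'rV[R]_N) (l : 'I_k) (x : 'rV[R[i]]_N) : R[i] :=
  \sum_(i < tau l | on_face xi i) \prod_j x 0 j ^+ alpha i j.

(* Danilov-Khovanskii non-degeneracy with respect to the Newton polytopes; the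
   case xi = 0 concerns the system f_1 = ... = f_k = 0 itself. *)
Definition nondegenerate_complete_intersection : Prop :=
  forall (xi : 'rV[R]_N) (x : 'rV[R[i]]_N), @ctorus R N x ->
    (forall l, face_poly xi l x = 0) ->
    row_free (\matrix_(l < k, j < N) partial j (face_poly xi l) x).

End Nondegenerate.

(* Columns (e_q, alpha_(i,q)), followed by (e_q, 0), in the q-th block. *)
Definition cayley_matrix : 'M[int]_(k + N, \sum_q (tau q).+1) :=
  \mxrow_(q < k) col_mx
    (\matrix_(l < k, i < (tau q).+1) (l == q)%:R)
    (\matrix_(j < N, i < (tau q).+1)
       if unlift ord_max i is Some i' then Posz (alpha i' j) else 0).

(* Exponents in (x, s', s, y) of the monomials of y_q f_q(x, s'), followed by
   that of y_q s_q, in the q-th block. *)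
Definition exponent_matrix : 'M[int]_(\sum_q (tau q).+1, N + (m + (k + k))) :=
  \mxcol_(q < k) \matrix_(i < (tau q).+1)
    if unlift ord_max i is Some i' then
      row_mx (\row_j Posz (alpha i' j))
        (row_mx (\row_r (is_modified_by r i')%:R) (row_mx 0 (delta_mx 0 q)))
    else row_mx 0 (row_mx 0 (row_mx (delta_mx 0 q) (delta_mx 0 q))).

Section FibreIntegral.
Variable R : realType.

Definition deformed_poly (l : 'I_k) (x : 'rV[R[i]]_N) (s' : 'rV[R[i]]_m) :
    R[i] :=
  \sum_(i < tau l)
    (\prod_(r < m | is_modified_by r i) s' 0 r) * \prod_j x 0 j ^+ alpha i j.

(* A point p : 'rV_(k + m) is the parameter (s, s'). *)
Definition fibre_poly (l : 'I_k) (x : 'rV[R[i]]_N) (p : 'rV[R[i]]_(k + m)) :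
    R[i] :=
  deformed_poly l x (rsubmx p) + lsubmx p 0 l.

Definition fibre_complement (p : 'rV[R[i]]_(k + m)) : set 'rV[R[i]]_N :=
  [set x | @ctorus R N x /\ forall l, fibre_poly l x p != 0].

(* ga is any cycle of the complement, not only a Leray coboundary: a tube around
   f_l + s_l = 0 winds around it, which Re (f_l + s_l) < 0 on ga forbids. *)
Definition admissible_parameters (ga : chain R N) : set 'rV[R[i]]_(k + m) :=
  [set p | [/\ @ctorus R (k + m) p, cycle_in (fibre_complement p) ga &
    forall c t l, unit_cube t ->
      complex.Re (fibre_poly l (chain_cube ga c t) p) < 0]].

(* lam l is the determination of log used for the power of f_l + s_l. *)
Definition fibre_integral (lam : 'I_k -> R[i] -> R[i]) (zeta : 'I_k -> R[i])
    (ii : 'I_N -> int) (ga : chain R N) (p : 'rV[R[i]]_(k + m)) : R[i] :=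
  chain_integral ga (fun x =>
    (\prod_l cexp ((- zeta l - 1) * lam l (fibre_poly l x p))) *
    \prod_j x 0 j ^ ii j).

End FibreIntegral.

End System.

(* Dl is the least positive integer clearing the denominators of L^-1, and
   M = Dl L^-1. *)
Definition reduced_inverse n (L : 'M[int]_n) (Dl : nat) (M : 'M[int]_n) :
    Prop :=
  let inv_multiple (d : nat) (M' : 'M[int]_n) :=
    map_mx intr M' = d%:R *: invmx (map_mx intr L) :> 'M[rat]_n in
  [/\ (0 < Dl)%N, inv_multiple Dl M &
      forall d M', (0 < d)%N -> inv_multiple d M' -> (Dl <= d)%N].

Section Coefficients.
Variables (N k m : nat) (M : 'M[int]_(N + (m + (k + k)))).
Implicit Type a : 'I_(N + (m + (k + k))).
Definition entryA (j : 'I_N) a : int := M (lshift _ j) a.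
Definition entryC (r : 'I_m) a : int := M (rshift N (lshift _ r)) a.
Definition entryB (q : 'I_k) a : int := M (rshift N (rshift m (lshift k q))) a.
Definition entryD (q : 'I_k) a : int := M (rshift N (rshift m (rshift k q))) a.
End Coefficients.

Section Horn.
Variables (R : realType) (N k m : nat).
Variables (Dl : nat) (M : 'M[int]_(N + (m + (k + k)))).
Variables (ii : 'I_N -> int) (zeta : 'I_k -> R[i]).

(* Operator polynomials in (theta_s, theta_s'). *)
Local Notation op := (mpoly (k + m) R[i]).

Definition theta_s (q : 'I_k) : op := mpolyX R[i] (mnm1 (lshift m q)).
Definition theta_s' (r : 'I_m) : op := mpolyX R[i] (mnm1 (rshift k r)).

Definition calL (z : 'I_k -> op) (z' : 'I_m -> op) a : op :=
  (Dl%:R^-1 : R[i]) *: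
    (\sum_j ((ii j + 1) *~ entryA M j a)%:~R +
     \sum_r z' r *~ entryC M r a +
     \sum_l (z l *~ entryB M l a +
             mpolyC (k + m) (zeta l + 1) *~ entryD M l a)).

Definition calL_theta a : op :=
  calL (fun q => - theta_s q) (fun r => - theta_s' r) a.

Definition horn_pos (row : 'I_(N + (m + (k + k))) -> int) : op :=
  \prod_(a | 0 < row a) \prod_(j < `|row a|%N) (calL_theta a + j%:R).

Definition horn_neg (row : 'I_(N + (m + (k + k))) -> int) : op :=
  \prod_(a | row a < 0) \prod_(j < `|row a|%N) (calL_theta a + j%:R).

Definition hornP (q : 'I_k) : op := horn_pos (entryB M q).
Definition hornQ (q : 'I_k) : op := horn_neg (entryB M q).
Definition hornP' (r : 'I_m) : op := horn_pos (entryC M r).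
Definition hornQ' (r : 'I_m) : op := horn_neg (entryC M r).

End Horn.

Definition op_degree n (R : realType) (P : mpoly n R[i]) : nat := (msize P).-1.

Section Operators.
Variables (R : realType) (n : nat).
Implicit Type g : 'rV[R[i]]_n -> R[i].

Definition euler (j : 'I_n) g : 'rV[R[i]]_n -> R[i] :=
  fun p => p 0 j * partial j g p.

Definition euler_monomial (e : multinom n) g : 'rV[R[i]]_n -> R[i] :=
  foldr (fun j h => iter (e j) (euler j) h) g (enum 'I_n).

Definition apply_op (P : mpoly n R[i]) g : 'rV[R[i]]_n -> R[i] :=
  fun p => \sum_(e <- msupp P) mcoeff e P * euler_monomial e g p.

End Operators.

(* Main.v *)
(* Write c_a x^(al a) for the a-th monomial of f_(blk a) + s_(blk a), whose
   coefficient c_a is 1 or a parameter, and let E_b be the integral of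
   prod_a (c_a x^(al a) d/df_(blk a))^(b_a) applied to the integrand. Each variable
   gives a linear relation between E_b and the E_(b + e_a) + b_a E_b, with the
   corresponding column of the exponent matrix as coefficients: by differentiation
   under the integral sign for s and s', by Stokes' theorem for x, and by
   f^(- z - 1) = f f^(- z - 2) for y. Inverting the matrix, calL_a + b_a maps E_b
   to - E_(b + e_a). Hence P and Q map the fibre integral to E_(B+) and E_(B-) up
   to sign, B+ and B- being the positive and negative parts of a row B of
   M = Dl L^-1; as the product of the B_a-th powers of the monomials of F is the
   Dl-th power of one variable, s_q say, E_(B+) = s_q^Dl E_(B-). Every monomial
   has degree 1 in y, so the entries of B have sum 0, which gives equal signs and
   equal degrees. The identity theorem carries the equations to all branches. *)

Require Import Defs.
From HB Require Import structures.
From mathcomp Require Import all_boot all_order all_algebra.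
From mathcomp Require Import all_classical all_reals all_analysis.
From mathcomp Require Import complex fingroup perm.
From mathcomp Require Import -(notations) mpoly.
From mathcomp Require Import ring lra.
Set Implicit Arguments.
Unset Strict Implicit.
Unset Printing Implicit Defensive.
Import Order.TTheory GRing.Theory Num.Theory numFieldNormedType.Exports Normc.
Local Open Scope ring_scope.
Local Open Scope classical_set_scope.
Local Open Scope complex_scope.

(** * Complex limits and the exponential *)

(** Each [lam l] is only given as a continuous branch of the logarithm. Powers are therefore
    differentiated through the slope of [cexp] at 0, with error bounds uniform on the compact cube,
    rather than through a derivative of [lam]. A singular cube is a map on the whole of R^N of which
    only the restriction to the unit cube counts: faces cancel as soon as they agree on the cube,
    while Stokes' theorem requires their Jacobians to agree there too; difference quotients taken
    inside the cube bridge this gap. The Jacobian cofactors are divergence free, which reduces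
    Stokes' theorem to the fundamental theorem of calculus in one coordinate at a time. Holomorphy
    means that all iterated complex derivatives exist, and the identity theorem is drawn from it by
    a maximum principle on annuli in complex lines, in place of power series. A product of operators
    is evaluated factor by factor, which rests on the commutation of Euler operators, hence on the
    symmetry of mixed derivatives. *)

Section ComplexBasics.
Variable R : realType.
Local Notation C := R[i].

Lemma normcE (z : C) : `|z| = (normc z)%:C.
Proof. by []. Qed.

Lemma normc_ge0 (z : C) : 0 <= normc z.
Proof. by rewrite -lecR -normcE normr_ge0. Qed.

Lemma ltr0c (x : R) : (0 < x%:C :> C) = (0 < x).
Proof. by rewrite -[0 in LHS]/(0%:C) ltcR. Qed.

Lemma Re_rM (x : R) (z : C) : complex.Re (x%:C * z) = x * complex.Re z.
Proof. by case: z => a b /=; rewrite mul0r subr0. Qed.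

Lemma Im_rM (x : R) (z : C) : complex.Im (x%:C * z) = x * complex.Im z.
Proof. by case: z => a b /=; rewrite mul0r addr0. Qed.

Lemma ReD (z w : C) : complex.Re (z + w) = complex.Re z + complex.Re w.
Proof. by case: z w => a b []. Qed.

Lemma ImD (z w : C) : complex.Im (z + w) = complex.Im z + complex.Im w.
Proof. by case: z w => a b []. Qed.

Lemma ReB (z w : C) : complex.Re (z - w) = complex.Re z - complex.Re w.
Proof. by case: z w => a b []. Qed.

Lemma ImB (z w : C) : complex.Im (z - w) = complex.Im z - complex.Im w.
Proof. by case: z w => a b []. Qed.

Lemma complex_eqP (z w : C) : complex.Re z = complex.Re w ->
  complex.Im z = complex.Im w -> z = w.
Proof. by case: z w => a b [c d] /= -> ->. Qed.

Lemma normc_real (x : R) : normc x%:C = `|x|.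
Proof. by rewrite /normc /= expr0n /= addr0 sqrtr_sqr. Qed.

Lemma normc_Re (z : C) : `|complex.Re z| <= normc z.
Proof. by rewrite -lecR -normcE normc_ge_Re. Qed.

Lemma normc_Im (z : C) : `|complex.Im z| <= normc z.
Proof.
by case: z => a b /=; rewrite -sqrtr_sqr ler_wsqrtr// lerDr sqr_ge0.
Qed.

Lemma normc_le (z : C) : normc z <= `|complex.Re z| + `|complex.Im z|.
Proof.
case: z => a b /=; rewrite -(ler_pXn2r (n:=2)) ?nnegrE ?sqrtr_ge0 ?addr_ge0//.
rewrite sqr_sqrtr ?addr_ge0 ?sqr_ge0// sqrrD !real_normK ?num_real//.
by rewrite lerD2r lerDl mulrn_wge0 ?mulr_ge0.
Qed.

Lemma normc_sum (I : Type) (r : seq I) (P : pred I) (F : I -> C) :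
  normc (\sum_(i <- r | P i) F i) <= \sum_(i <- r | P i) normc (F i).
Proof.
elim/big_ind2: _ => [|x1 x2 y1 y2 h1 h2|//]; first by rewrite normc0.
by apply: le_trans (le_normcD _ _) _; exact: lerD.
Qed.

(** The norm of [R[i]] takes its values in [R[i]]; as a positive element there is real, [e] can be
    taken in [R]. *)
Lemma cvgC_ltP T (F : set_system T) {FF : Filter F} (f : T -> C) (l : C) :
  (f x @[x --> F] --> l) <->
  (forall e : R, 0 < e -> \forall x \near F, normc (l - f x) < e).
Proof.
split=> [/cvgrPdist_lt h e e0|h].
  have := h e%:C; rewrite ltr0c => /(_ e0); apply: filterS => x.
  by rewrite normcE ltcR.
apply/cvgrPdist_lt => e e0.
have eE : (complex.Re e)%:C = e by rewrite RRe_real// realE (ltW e0).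
have : 0 < complex.Re e by rewrite -ltr0c eE.
by move/h; apply: filterS => x; rewrite -ltcR eE.
Qed.

Lemma cvg_Re T (F : set_system T) {FF : Filter F} (f : T -> C) (l : C) :
  f x @[x --> F] --> l -> complex.Re (f x) @[x --> F] --> complex.Re l.
Proof.
move=> /cvgC_ltP h; apply/cvgrPdist_lt => e /h; apply: filterS => x.
by apply: le_lt_trans; rewrite -raddfB normc_Re.
Qed.

Lemma cvg_Im T (F : set_system T) {FF : Filter F} (f : T -> C) (l : C) :
  f x @[x --> F] --> l -> complex.Im (f x) @[x --> F] --> complex.Im l.
Proof.
move=> /cvgC_ltP h; apply/cvgrPdist_lt => e /h; apply: filterS => x.
by apply: le_lt_trans; rewrite -raddfB normc_Im.
Qed.

Lemma cvg_ReIm T (F : set_system T) {FF : Filter F} (f g : T -> R) (a b : R) :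
  f x @[x --> F] --> a -> g x @[x --> F] --> b ->
  (f x +i* g x) @[x --> F] --> (a +i* b).
Proof.
move=> /cvgrPdist_lt hf /cvgrPdist_lt hg; apply/cvgC_ltP => e e0.
have e20 : 0 < e / 2 by rewrite divr_gt0.
near=> x; apply: le_lt_trans (normc_le _) _; rewrite /=.
rewrite (splitr e); apply: ltrD.
  by near: x; exact: hf.
by near: x; exact: hg.
Unshelve. all: by end_near. Qed.

Lemma cvg_real_complex T (F : set_system T) {FF : Filter F} (f : T -> R) (a : R) :
  f x @[x --> F] --> a -> ((f x)%:C : C) @[x --> F] --> (a%:C : C).
Proof. by move=> h; apply: cvg_ReIm => //; exact: cvg_cst. Qed.

Section ComplexLimits.
Variables (T : Type) (F : set_system T).
Context {FF : Filter F}.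
Implicit Types (f g : T -> C) (a b : C).

Lemma cvgC_cst a : (fun _ : T => a) x @[x --> F] --> a.
Proof. exact: cvg_cst. Qed.

Lemma cvgC_add f g a b : f x @[x --> F] --> a -> g x @[x --> F] --> b ->
  (f x + g x) @[x --> F] --> a + b.
Proof. by move=> fa gb; apply: cvgD; [exact: fa|exact: gb]. Qed.

Lemma cvgC_mul f g a b : f x @[x --> F] --> a -> g x @[x --> F] --> b ->
  (f x * g x) @[x --> F] --> a * b.
Proof. by move=> fa gb; apply: cvgM; [exact: fa|exact: gb]. Qed.

Lemma cvgC_opp f a : f x @[x --> F] --> a -> (- f x) @[x --> F] --> - a.
Proof. by move=> fa; apply: cvgN; exact: fa. Qed.

Lemma cvgC_inv f a : a != 0 -> f x @[x --> F] --> a ->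
  (f x)^-1 @[x --> F] --> a^-1.
Proof. by move=> a0 fa; apply: cvgV => //; exact: fa. Qed.

Lemma cvgC_sum (I : Type) (r : seq I) (P : pred I) (f : I -> T -> C) (a : I -> C) :
  (forall i, P i -> f i x @[x --> F] --> a i) ->
  (\sum_(i <- r | P i) f i x) @[x --> F] --> \sum_(i <- r | P i) a i.
Proof.
move=> fa; elim: r => [|i r IH].
  by under eq_fun do rewrite big_nil; rewrite big_nil; exact: cvgC_cst.
under eq_fun do rewrite big_cons; rewrite big_cons.
case: ifP => Pi; last exact: IH.
by apply: cvgC_add; [exact: fa|exact: IH].
Qed.

Lemma cvgC_prod (I : Type) (r : seq I) (P : pred I) (f : I -> T -> C) (a : I -> C) :
  (forall i, P i -> f i x @[x --> F] --> a i) ->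
  (\prod_(i <- r | P i) f i x) @[x --> F] --> \prod_(i <- r | P i) a i.
Proof.
move=> fa; elim: r => [|i r IH].
  by under eq_fun do rewrite big_nil; rewrite big_nil; exact: cvgC_cst.
under eq_fun do rewrite big_cons; rewrite big_cons.
case: ifP => Pi; last exact: IH.
by apply: cvgC_mul; [exact: fa|exact: IH].
Qed.

Lemma cvgC_expn f a n : f x @[x --> F] --> a -> (f x ^+ n) @[x --> F] --> a ^+ n.
Proof.
move=> fa; elim: n => [|n IH]; first by under eq_fun do rewrite expr0; exact: (@cvgC_cst 1).
by under eq_fun do rewrite exprS; rewrite exprS; exact: cvgC_mul.
Qed.

Lemma cvgC_exprz f a (n : int) : a != 0 ->
  f x @[x --> F] --> a -> (f x ^ n) @[x --> F] --> a ^ n.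
Proof.
move=> a0 fa; case: n => n; first exact: cvgC_expn.
by rewrite NegzE /exprz; apply: cvgC_inv; [rewrite expf_neq0|exact: cvgC_expn].
Qed.

End ComplexLimits.
Arguments cvgC_cst {T F FF} a.

Lemma cexp0 : cexp 0 = 1 :> C.
Proof. by rewrite /cexp /= expR0 cos0 sin0 mul1r. Qed.

Lemma cexpD (z w : C) : cexp (z + w) = cexp z * cexp w.
Proof.
case: z w => a b [c d]; rewrite /cexp /= expRD cosD sinD; simpc.
by congr (_ +i* _); ring.
Qed.

Lemma cexp_neq0 (z : C) : cexp z != 0.
Proof.
apply/eqP => h; have := cexp0; rewrite -(subrr z) cexpD h mul0r => /esym/eqP.
by rewrite oner_eq0.
Qed.

Lemma cexpN (z : C) : cexp (- z) = (cexp z)^-1.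
Proof.
apply: (mulfI (cexp_neq0 z)); rewrite -cexpD subrr cexp0 divff//.
exact: cexp_neq0.
Qed.

Lemma cexp_sum (I : Type) (r : seq I) (P : pred I) (F : I -> C) :
  cexp (\sum_(i <- r | P i) F i) = \prod_(i <- r | P i) cexp (F i).
Proof. by apply: big_morph; [exact: cexpD | exact: cexp0]. Qed.

Lemma cvg_cexp T (F : set_system T) {FF : Filter F} (f : T -> C) (l : C) :
  f x @[x --> F] --> l -> cexp (f x) @[x --> F] --> cexp l.
Proof.
move=> h; apply: cvgM.
  apply: cvg_real_complex; apply: continuous_cvg; first exact: continuous_expR.
  exact: cvg_Re.
by apply: cvg_ReIm; (apply: continuous_cvg; [|exact: cvg_Im]);
  [exact: continuous_cos|exact: continuous_sin].
Qed.

(** The value at 0 is the limit of the quotient, so [cexp z - 1 = z * cexp_slope z] holds without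
    exception. *)
Definition cexp_slope (z : C) : C := if z == 0 then 1 else (cexp z - 1) / z.

Lemma cexp_slopeE (z : C) : cexp z - 1 = z * cexp_slope z.
Proof.
rewrite /cexp_slope; case: eqVneq => [->|z0]; first by rewrite cexp0 subrr mul0r.
by rewrite mulrC divfK.
Qed.

End ComplexBasics.
Arguments cvgC_cst {R T F FF} a.

(** * Complex functions of a real variable *)

Section RealLineDerivatives.
Variable R : realType.
Local Notation C := R[i].

Lemma continuous_at0P (K : numFieldType) (T : uniformType) (f : K -> T) (l : T) :
  f 0 = l -> f h @[h --> 0^'] --> l -> f h @[h --> (0 : K)] --> l.
Proof. by move=> <- h; exact: (iffRL (continuous_withinNx _ _) h). Qed.

(* Caratheodory's form of F'(t) = d for a complex valued F. *)
Definition cderiv (F : R -> C) (t : R) (d : C) : Prop :=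
  exists2 phi : R -> C, phi h @[h --> (0 : R)] --> d &
    forall h, F (t + h) - F t = h%:C * phi h.

Lemma cderiv_near (F : R -> C) t d (phi : R -> C) :
  phi h @[h --> (0 : R)] --> d ->
  (\forall h \near (0 : R), F (t + h) - F t = h%:C * phi h) -> cderiv F t d.
Proof.
move=> phid FE.
exists (fun h => if h == 0 then d else h%:C^-1 * (F (t + h) - F t)) => [|h].
  apply: continuous_at0P; first by rewrite eqxx.
  have phid' : phi h @[h --> 0^'] --> d.
    by apply: cvg_trans phid; apply: cvg_app; exact: cvg_within.
  apply: cvg_trans phid'; apply: near_eq_cvg; near=> h.
  have h0 : h != 0 by near: h; exact: nbhs_dnbhs_neq.
  rewrite (negbTE h0) (_ : F (t + h) - F t = h%:C * phi h).
    by rewrite mulKf//; apply: contraNneq h0 => -[->].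
  by near: h; exact: nbhs_dnbhs.
case: eqVneq => [->|h0]; first by rewrite addr0 subrr mul0r.
by rewrite mulVKf//; apply: contraNneq h0 => -[->].
Unshelve. all: by end_near. Qed.

Lemma is_deriveP (f : R -> R) (t d : R) : is_derive t 1 f d <->
  exists2 phi : R -> R, phi h @[h --> (0 : R)] --> d &
    forall h, f (t + h) - f t = h * phi h.
Proof.
split=> [[df <-]|[phi phid fE]].
  pose phi h := if h == 0 then 'D_1 f t else h^-1 * (f (t + h) - f t).
  exists phi => [|h]; last first.
    by rewrite /phi; case: eqVneq => [->|h0]; rewrite ?mul0r ?addr0 ?subrr ?mulVKf.
  apply: continuous_at0P; first by rewrite /phi eqxx.
  apply: cvg_trans df; apply: near_eq_cvg; near=> h.
  have h0 : h != 0 by near: h; exact: nbhs_dnbhs_neq.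
  by rewrite /phi (negbTE h0) /= [_%:A]mulr1 [h + t]addrC.
have cv : h^-1 *: ((f \o shift t) (h *: 1) - f t) @[h --> 0^'] --> d.
  have : phi h @[h --> 0^'] --> d.
    by apply: cvg_trans phid; apply: cvg_app; exact: cvg_within.
  apply: cvg_trans; apply: near_eq_cvg; near=> h.
  have h0 : h != 0 by near: h; exact: nbhs_dnbhs_neq.
  by rewrite /= [_%:A]mulr1 [h + t]addrC fE; exact/esym/mulKf.
by apply: DeriveDef; [apply/cvg_ex; exists d | exact: cvg_lim].
Unshelve. all: by end_near. Qed.

Lemma cderivP (F : R -> C) t d : cderiv F t d <->
  is_derive t 1 (fun x => complex.Re (F x)) (complex.Re d) /\
  is_derive t 1 (fun x => complex.Im (F x)) (complex.Im d).
Proof.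
split=> [[phi phid FE]|[]].
  split; apply/is_deriveP.
    exists (fun h => complex.Re (phi h)); first exact: cvg_Re.
    by move=> h; rewrite -raddfB FE /= Re_rM.
  exists (fun h => complex.Im (phi h)); first exact: cvg_Im.
  by move=> h; rewrite -raddfB FE /= Im_rM.
move=> /is_deriveP[f fd fE] /is_deriveP[g gd gE].
exists (fun h => f h +i* g h); first by case: d fd gd => a b; exact: cvg_ReIm.
move=> h; apply: complex_eqP.
  by rewrite Re_rM /= -fE -raddfB.
by rewrite Im_rM /= -gE -raddfB.
Qed.

Lemma cderiv_continuous F t d : cderiv F t d -> {for t, continuous F}.
Proof.
move=> [phi phid FE].
have H : (F t + (h - t)%:C * phi (h - t)) @[h --> t] --> F t + 0%:C * d.
  apply: cvgC_add; first exact: cvgC_cst.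
  have ht : (h - t : R) @[h --> t] --> (0 : R).
    by rewrite -(subrr t); apply: cvgB; [exact: cvg_id|exact: cvg_cst].
  apply: cvgC_mul; first exact: cvg_real_complex.
  exact: (@cvg_comp _ _ _ (fun h : R => h - t) phi _ _ _ ht phid).
have E0 : F t + 0%:C * d = F t by rewrite mul0r addr0.
have E : (fun h => F t + (h - t)%:C * phi (h - t)) = F.
  by apply/funext => h; rewrite -FE [t + _]addrC subrK addrC subrK.
rewrite E0 E in H; exact: H.
Qed.

Lemma cderiv_cst (c : C) t : cderiv (fun _ => c) t 0.
Proof.
by exists (fun _ => 0) => [|h]; [exact: cvgC_cst | rewrite subrr mulr0].
Qed.

Lemma cderivD F G t a b : cderiv F t a -> cderiv G t b ->
  cderiv (fun x => F x + G x) t (a + b).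
Proof.
move=> [f fa FE] [g gb GE]; exists (fun h => f h + g h); first exact: (cvgC_add fa gb).
by move=> h; rewrite mulrDr -FE -GE opprD addrACA.
Qed.

Lemma cderivM F G t a b : cderiv F t a -> cderiv G t b ->
  cderiv (fun x => F x * G x) t (a * G t + F t * b).
Proof.
move=> dF dG; have GC := cderiv_continuous dG.
case: dF dG => f fa FE [g gb GE].
exists (fun h => f h * G (t + h) + F t * g h) => [|h]; last first.
  have -> : G (t + h) = G t + h%:C * g h by rewrite -GE [RHS]addrC subrK.
  have -> : F (t + h) = F t + h%:C * f h by rewrite -FE [RHS]addrC subrK.
  by ring.
have th : (t + h : R) @[h --> (0 : R)] --> t.
  by rewrite -[X in _ --> X]addr0; apply: cvgD; [exact: cvg_cst|exact: cvg_id].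
have Gh : G (t + h) @[h --> (0 : R)] --> G t.
  exact: (@cvg_comp _ _ _ (fun h : R => t + h) G _ _ _ th GC).
exact: (cvgC_add (cvgC_mul fa Gh) (cvgC_mul (cvgC_cst (F t)) gb)).
Qed.

Lemma cderivZ F t c a : cderiv F t a -> cderiv (fun x => c * F x) t (c * a).
Proof. by move/(cderivM (cderiv_cst c t)); rewrite mul0r add0r. Qed.

Lemma cderiv_sum (I : Type) (r : seq I) (P : pred I) (F : I -> R -> C) t a :
  (forall i, P i -> cderiv (F i) t (a i)) ->
  cderiv (fun x => \sum_(i <- r | P i) F i x) t (\sum_(i <- r | P i) a i).
Proof.
move=> FD; elim: r => [|i r IH].
  by under eq_fun do rewrite big_nil; rewrite big_nil; exact: cderiv_cst.
under eq_fun do rewrite big_cons; rewrite big_cons.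
by case: ifP => // Pi; exact: cderivD (FD _ Pi) IH.
Qed.

Lemma cderiv_prod (I : eqType) (r : seq I) (F : I -> R -> C) t a :
  uniq r -> (forall i, cderiv (F i) t (a i)) ->
  cderiv (fun x => \prod_(i <- r) F i x) t
    (\sum_(i <- r) a i * \prod_(j <- r | j != i) F j t).
Proof.
move=> + FD; elim: r => [_|i r IH /= /andP[ir ur]].
  by under eq_fun do rewrite big_nil; rewrite big_nil; exact: cderiv_cst.
under eq_fun do rewrite big_cons; rewrite !big_cons eqxx /=.
have -> : \prod_(j <- r | j != i) F j t = \prod_(j <- r) F j t.
  rewrite big_seq_cond [RHS]big_seq_cond; apply: eq_bigl => j.
  by case: (boolP (j \in r)) => //= jr; apply: contraNneq ir => <-.
have := cderivM (FD i) (IH ur); congr cderiv; congr (_ + _).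
rewrite big_distrr /= big_seq [RHS]big_seq; apply: eq_bigr => j jr.
rewrite big_cons ifT 1?mulrCA// ?mulrA.
by apply: contraNneq ir => ->.
Qed.

(* F = exp (sum of a_l log f_l) is differentiated through its logarithm, so the
   factors come in logarithmic form. *)
Lemma cderiv_prod_log (I : finType) (F : I -> R -> C) t (l : I -> C) :
  (forall i, cderiv (F i) t (F i t * l i)) ->
  cderiv (fun x => \prod_i F i x) t ((\prod_i F i t) * \sum_i l i).
Proof.
move=> FD; have := cderiv_prod (index_enum_uniq I) FD.
congr cderiv; rewrite big_distrr /=; apply: eq_bigr => i _.
by rewrite [in RHS](bigD1 i)//= mulrAC.
Qed.

Lemma cderivV F t a : F t != 0 -> cderiv F t a ->
  cderiv (fun x => (F x)^-1) t (- a / F t ^+ 2).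
Proof.
move=> Ft0 dF; have FC := cderiv_continuous dF; case: dF => f fa FE.
have th : (t + h : R) @[h --> (0 : R)] --> t.
  by rewrite -[X in _ --> X]addr0; apply: cvgD; [exact: cvg_cst|exact: cvg_id].
have Fh : F (t + h) @[h --> (0 : R)] --> F t.
  exact: (@cvg_comp _ _ _ (fun h : R => t + h) F _ _ _ th FC).
have G0 : (- f h / (F t * F (t + h))) @[h --> (0 : R)] --> - a / (F t * F t).
  apply: (cvgC_mul (cvgC_opp fa)); apply: cvgC_inv; first by rewrite mulf_neq0.
  exact: (cvgC_mul (cvgC_cst (F t)) Fh).
(* Where [F (t + h)] vanishes its inverse is 0 by convention. There [h] is nonzero because [F t] is,
   so the increment [- (F t)^-1] can be divided by [h]; near 0 this case does not occur. *)
pose g h := if F (t + h) == 0 then h%:C^-1 * (- (F t)^-1) else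
  - f h / (F t * F (t + h)).
exists g => [|h]; last first.
  rewrite /g; case: eqVneq => [F0|F0].
    have h0 : h%:C != 0 :> C.
      by apply: contraNneq Ft0 => -[h0]; rewrite -F0 h0 addr0.
    by rewrite F0 invr0 add0r mulVKf.
  have := FE h => E.
  have -> : h%:C * (- f h / (F t * F (t + h))) =
    - (h%:C * f h) / (F t * F (t + h)) by rewrite !mulrA mulrN.
  by rewrite -E; field; rewrite Ft0 F0.
have F0 : \forall h \near (0 : R), F (t + h) != 0.
  exact: (cvgr_neq0 _ Fh).
rewrite expr2; apply: cvg_trans G0; apply: near_eq_cvg; near=> h.
by rewrite /g ifN//; near: h.
Unshelve. all: by end_near. Qed.

End RealLineDerivatives.

(** * Complex powers along a branch of the logarithm *)

Section ComplexPowers.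
Variable R : realType.
Local Notation C := R[i].

(** With the real slopes of exp, cos and sin at 0, [cexp z - 1] becomes [Re z * U z + Im z * W z],
    where [U] tends to 1 and [W] to i. Comparing with z = Re z + i Im z bounds the distance of the
    slope from 1 by |1 - U z| + |i - W z|. *)
Lemma cvg_cexp_slope : cexp_slope z @[z --> (0 : C)] --> (1 : C).
Proof.
have [u uc uE] := (is_deriveP _ _ _).1 (is_derive_expR (0 : R)).
have [w wc wE] := (is_deriveP _ _ _).1 (is_derive_cos (0 : R)).
have [s sc sE] := (is_deriveP _ _ _).1 (is_derive_sin (0 : R)).
rewrite expR0 in uc; rewrite sin0 oppr0 in wc; rewrite cos0 in sc.
pose U (z : C) : C := (u (complex.Re z))%:C * (cos (complex.Im z) +i* sin (complex.Im z)).
pose W (z : C) : C := w (complex.Im z) +i* s (complex.Im z).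
have id0 : (fun z : C => z) z @[z --> (0 : C)] --> (0 : C) by exact: cvg_id.
have Re0 : complex.Re z @[z --> (0 : C)] --> (0 : R).
  exact: (cvg_Re id0).
have Im0 : complex.Im z @[z --> (0 : C)] --> (0 : R).
  exact: (cvg_Im id0).
have cRe (f : R -> R) (l : R) : f h @[h --> (0 : R)] --> l ->
    f (complex.Re z) @[z --> (0 : C)] --> l.
  by move=> fl; exact: (@cvg_comp _ _ _ (fun z : C => complex.Re z) f _ _ _ Re0 fl).
have cIm (f : R -> R) (l : R) : f h @[h --> (0 : R)] --> l ->
    f (complex.Im z) @[z --> (0 : C)] --> l.
  by move=> fl; exact: (@cvg_comp _ _ _ (fun z : C => complex.Im z) f _ _ _ Im0 fl).
have U1 : U z @[z --> (0 : C)] --> 1%:C * (1 +i* 0).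
  apply: (cvgC_mul (cvg_real_complex (cRe _ _ uc))).
  have := cvg_ReIm (cIm _ _ (@continuous_cos R 0)) (cIm _ _ (@continuous_sin R 0)).
  by rewrite cos0 sin0; apply.
have WI : W z @[z --> (0 : C)] --> (0 +i* 1 : C).
  exact: (cvg_ReIm (cIm _ _ wc) (cIm _ _ sc)).
have E z : cexp z - 1 = (complex.Re z)%:C * U z + (complex.Im z)%:C * W z.
  have := uE (complex.Re z); have := wE (complex.Im z); have := sE (complex.Im z).
  rewrite !add0r expR0 cos0 sin0 subr0 => Es Ec Ee.
  apply: complex_eqP.
    rewrite ReB ReD /U /W /cexp !Re_rM /= mulrA -Ee -Ec; ring.
  rewrite ImB ImD /U /W /cexp !Im_rM /= mulrA -Ee -Es; ring.
have {}U1 := iffLR (@cvgC_ltP _ _ (nbhs (0 : C)) _ U _) U1.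
have {}WI := iffLR (@cvgC_ltP _ _ (nbhs (0 : C)) _ W _) WI.
apply: (iffRL (@cvgC_ltP _ _ (nbhs (0 : C)) _ _ _)) => e e0; have e2 : 0 < e / 2 by rewrite divr_gt0.
near=> z.
have [->|z0] := eqVneq z 0.
  by rewrite /cexp_slope eqxx subrr normc0.
have nz0 : 0 < normc z.
  by rewrite lt_neqAle normc_ge0 andbT eq_sym; apply: contra_neq z0 => /eq0_normc.
rewrite -(ltr_pM2l nz0) -normcM mulrBr mulr1 -cexp_slopeE E.
have -> : z - ((complex.Re z)%:C * U z + (complex.Im z)%:C * W z) =
  (complex.Re z)%:C * (1%:C * (1 +i* 0) - U z) + (complex.Im z)%:C * (0 +i* 1 - W z).
  rewrite !mulrBr addrACA -opprD; congr (_ - _).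
  by apply: complex_eqP; rewrite ?ReD ?ImD ?Re_rM ?Im_rM /=; ring.
apply: le_lt_trans (le_normcD _ _) _; rewrite !normcM !normc_real.
apply: (@le_lt_trans _ _ (normc z * (normc (1%:C * (1 +i* 0) - U z) + normc (0 +i* 1 - W z)))).
  by rewrite mulrDr lerD// ler_wpM2r ?normc_ge0 ?normc_Re ?normc_Im.
rewrite ltr_pM2l// (splitr e) ltrD//; near: z; [exact: U1|exact: WI].
Unshelve. all: by end_near. Qed.
End ComplexPowers.

Section ComplexPowers.
Variable R : realType.
Local Notation C := R[i].
Variables (k : nat) (lam : 'I_k -> C -> C) (a : 'I_k -> C).
Hypothesis lam_log : forall l, log_branch (lam l).
Implicit Type w : 'I_k -> C.

Definition cpower w : C := \prod_l cexp (a l * lam l (w l)).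

(** The coefficient of [w' l - w l] in the relative increment of [cpower]. It contains increments of
    [lam] only; as [w'] approaches [w] it tends to [a l / w l], the logarithmic partial
    derivative. *)
Definition cpower_slope w w' (l : 'I_k) : C :=
  a l / (w l * cexp_slope (lam l (w' l) - lam l (w l))) *
  cexp_slope (\sum_i a i * (lam i (w' i) - lam i (w i))).

(* With e_l = log w'_l - log w_l, both w'_l / w_l - 1 = exp e_l - 1 and the
   relative increment exp (sum a_l e_l) - 1 are expressed by cexp_slope. *)
Lemma cpower_slopeE w w' :
  (forall l, complex.Re (w l) < 0) -> (forall l, complex.Re (w' l) < 0) ->
  (forall l, cexp_slope (lam l (w' l) - lam l (w l)) != 0) ->
  cpower w' - cpower w =
  cpower w * \sum_l (w' l - w l) * cpower_slope w w' l.
Proof.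
move=> w0 w'0 s0; have wn0 l : w l != 0.
  by apply: contraTneq (w0 l) => ->; rewrite /= ltxx.
have step l : (w' l - w l) * (a l / (w l * cexp_slope (lam l (w' l) - lam l (w l)))) =
    a l * (lam l (w' l) - lam l (w l)).
  have -> : w' l - w l = w l * (cexp (lam l (w' l) - lam l (w l)) - 1).
    rewrite mulrBr mulr1 cexpD cexpN.
    have [-> _] := lam_log l (w'0 l); have [-> _] := lam_log l (w0 l).
    by rewrite mulrC divfK.
  by rewrite cexp_slopeE; field; rewrite wn0 s0.
under eq_bigr do rewrite /cpower_slope mulrA step.
rewrite -big_distrl /= -cexp_slopeE mulrBr mulr1; congr (_ - _).
rewrite cexp_sum -big_split /=; apply: eq_bigr => l _.
by rewrite -cexpD mulrBr addrC subrK.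
Qed.

Variables (T : Type) (F : set_system T).
Context {FF : Filter F}.
Variables (x y : T -> 'I_k -> C) (w : 'I_k -> C).
Hypothesis w0 : forall l, complex.Re (w l) < 0.
Hypothesis xw : forall l, x t l @[t --> F] --> w l.
Hypothesis yw : forall l, y t l @[t --> F] --> w l.

Lemma cvg_log (z : T -> 'I_k -> C) (l : 'I_k) : z t l @[t --> F] --> w l ->
  lam l (z t l) @[t --> F] --> lam l (w l).
Proof.
move=> zw; have [_ lc] := lam_log l (w0 l).
exact: (@cvg_comp _ _ _ (fun t => z t l) (lam l) _ _ _ zw lc).
Qed.

Lemma cvg_cpower : cpower (x t) @[t --> F] --> cpower w.
Proof.
apply: cvgC_prod => l _; apply: cvg_cexp.
exact: (cvgC_mul (cvgC_cst (a l)) (cvg_log (@xw l))).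
Qed.

Lemma near_Re_lt0 (z : T -> 'I_k -> C) :
  (forall l, z t l @[t --> F] --> w l) ->
  \forall t \near F, forall l, complex.Re (z t l) < 0.
Proof.
move=> zw; apply: filter_forall => l.
exact: (cvgr_lt _ (cvg_Re (@zw l)) 0 (w0 l)).
Qed.

Lemma cvg_log_sub l : (lam l (y t l) - lam l (x t l)) @[t --> F] --> (0 : C).
Proof.
have := cvgC_add (cvg_log (@yw l)) (cvgC_opp (cvg_log (@xw l))).
by rewrite subrr; apply.
Qed.

Lemma cvg_cexp_slope_comp (f : T -> C) : f t @[t --> F] --> (0 : C) ->
  cexp_slope (f t) @[t --> F] --> (1 : C).
Proof.
by move=> f0; exact: (@cvg_comp _ _ _ f _ _ _ _ f0 (@cvg_cexp_slope R)).
Qed.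

(** Both [x] and [y] move with [t]: under the integral sign, the point of the cube varies together
    with the parameter. *)
Lemma near_cpower_slope : \forall t \near F,
  cpower (y t) - cpower (x t) =
  cpower (x t) * \sum_l (y t l - x t l) * cpower_slope (x t) (y t) l.
Proof.
have s0 : \forall t \near F,
    forall l, cexp_slope (lam l (y t l) - lam l (x t l)) != 0.
  apply: filter_forall => l.
  by apply: (cvgr_neq0 _ (cvg_cexp_slope_comp (@cvg_log_sub l))); rewrite oner_neq0.
near=> t; apply: cpower_slopeE => l; first [move: l; near: t; exact: near_Re_lt0|move: l; near: t; exact: s0].
Unshelve. all: by end_near. Qed.

Lemma cvg_cpower_slope l :
  cpower_slope (x t) (y t) l @[t --> F] --> a l / w l.
Proof.
have wn0 : w l != 0.
  by apply: contraTneq (w0 l) => ->; rewrite /= ltxx.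
have H : cpower_slope (x t) (y t) l @[t --> F] --> a l / (w l * 1) * 1.
  apply: cvgC_mul.
    apply: (cvgC_mul (cvgC_cst (a l))); apply: cvgC_inv; first by rewrite mulr1.
    exact: (cvgC_mul (@xw l) (cvg_cexp_slope_comp (@cvg_log_sub l))).
  apply: cvg_cexp_slope_comp.
  have : (\sum_i a i * (lam i (y t i) - lam i (x t i))) @[t --> F] -->
      \sum_i a i * 0.
    by apply: cvgC_sum => i _; exact: (cvgC_mul (cvgC_cst (a i)) (@cvg_log_sub i)).
  by rewrite big1 => [|i _]; [apply|rewrite mulr0].
by move: H; rewrite !mulr1; apply.
Qed.

End ComplexPowers.

Section ComplexPowerDerivative.
Variable R : realType.
Local Notation C := R[i].
Variables (k : nat) (lam : 'I_k -> C -> C) (a : 'I_k -> C).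
Hypothesis lam_log : forall l, log_branch (lam l).

Lemma cderiv_cpower (w : R -> 'I_k -> C) t (d : 'I_k -> C) :
  (forall l, complex.Re (w t l) < 0) ->
  (forall l, cderiv (fun s => w s l) t (d l)) ->
  cderiv (fun s => cpower lam a (w s)) t
    (cpower lam a (w t) * \sum_l a l * d l / w t l).
Proof.
move=> w0 wd.
have th : (t + h : R) @[h --> (0 : R)] --> t.
  by rewrite -[X in _ --> X]addr0; apply: cvgD; [exact: cvg_cst|exact: cvg_id].
have wc l : w (t + h) l @[h --> (0 : R)] --> w t l.
  exact: (@cvg_comp _ _ _ (fun h : R => t + h) (w^~ l) _ _ _ th (cderiv_continuous (wd l))).
have [phi phid] := choice (fun l => let: ex_intro2 p pd pE := wd l in
  ex_intro (fun p => p h @[h --> (0 : R)] --> d l /\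
    forall h, w (t + h) l - w t l = h%:C * p h) p (conj pd pE)).
have cc l : (fun=> w t l) h @[h --> (0 : R)] --> w t l by exact: cvgC_cst.
have sl := @near_cpower_slope _ _ _ a lam_log _ _ _
  (fun=> w t) (fun h => w (t + h)) _ w0 cc wc.
apply: (@cderiv_near _ _ _ _ (fun h => cpower lam a (w t) *
    \sum_l phi l h * cpower_slope lam a (w t) (w (t + h)) l)).
  have -> : \sum_l a l * d l / w t l = \sum_l d l * (a l / w t l).
    by apply: eq_bigr => l _; rewrite mulrAC mulrC.
  apply: (cvgC_mul (cvgC_cst _)); apply: cvgC_sum => l _.
  exact: (cvgC_mul (phid l).1 (@cvg_cpower_slope _ _ _ a lam_log _ _ _
    (fun=> w t) (fun h => w (t + h)) _ w0 cc wc l)).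
near=> h.
have -> : cpower lam a (w (t + h)) - cpower lam a (w t) = cpower lam a (w t) *
    \sum_l (w (t + h) l - w t l) * cpower_slope lam a (w t) (w (t + h)) l.
  by near: h; exact: sl.
rewrite [RHS]mulrCA [X in _ = _ * X]big_distrr /=; congr (_ * _); apply: eq_bigr => l _.
by rewrite (phid l).2 -mulrA.
Unshelve. all: by end_near. Qed.

End ComplexPowerDerivative.

(** * Integration over the unit cube *)

Section CubeIntegral.
Variable R : realType.

Definition rcube n (t : R) (u : 'rV[R]_n) : 'rV[R]_n.+1 :=
  row_mx (t%:M : 'rV_1) u.

Lemma rcube0 n t (u : 'rV[R]_n) : rcube t u 0 ord0 = t.
Proof.
rewrite /rcube mxE; case: splitP => j; last by move=> /eqP.
by rewrite mxE (ord1 j) eqxx mulr1n.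
Qed.

Lemma rcube_lift n t (u : 'rV[R]_n) j : rcube t u 0 (lift ord0 j) = u 0 j.
Proof.
rewrite /rcube mxE; case: splitP => j'; first by rewrite (ord1 j') => /eqP.
by rewrite /= /bump /= !add1n => -[] /ord_inj ->.
Qed.

Lemma rcubeP n t (u : 'rV[R]_n) : unit_cube (rcube t u) <->
  0 <= t <= 1 /\ unit_cube u.
Proof.
split=> [h|[ht hu] j].
  by split=> [|j]; [move: (h ord0); rewrite rcube0|move: (h (lift ord0 j)); rewrite rcube_lift].
by case: (unliftP ord0 j) => [j'|] ->; rewrite ?rcube0 ?rcube_lift.
Qed.

(** Uniform continuity on the closed cube for the distance by coordinates. It says nothing outside
    the cube and passes to slices and faces with the same [d]. *)
Definition ucont n (f : 'rV[R]_n -> R) : Prop :=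
  forall e : R, 0 < e -> exists2 d : R, 0 < d &
    forall t u, unit_cube t -> unit_cube u ->
      (forall j, `|t 0 j - u 0 j| < d) -> `|f t - f u| < e.

Lemma ucontD n (f g : 'rV[R]_n -> R) : ucont f -> ucont g ->
  ucont (fun t => f t + g t).
Proof.
move=> cf cg e e0; have e2 : 0 < e / 2 by rewrite divr_gt0.
have [d1 d10 h1] := cf _ e2; have [d2 d20 h2] := cg _ e2.
exists (Num.min d1 d2) => [|t u tc uc tu]; first by rewrite lt_min d10 d20.
rewrite opprD addrACA (splitr e); apply: le_lt_trans (ler_normD _ _) _.
by apply: ltrD; [apply: h1|apply: h2] => // j;
  move: (tu j); rewrite lt_min => /andP[].
Qed.

Lemma ucontZ n c (f : 'rV[R]_n -> R) : ucont f -> ucont (fun t => c * f t).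
Proof.
move=> cf e e0; have c0 : 0 < `|c| + 1 by rewrite ltr_wpDl.
have [d d0 h] := cf _ (divr_gt0 e0 c0); exists d => // t u tc uc tu.
rewrite -mulrBr normrM; apply: (@le_lt_trans _ _ ((`|c| + 1) * `|f t - f u|)).
  by rewrite ler_wpM2r// lerDl.
by rewrite mulrC -ltr_pdivlMr//; exact: h.
Qed.

Lemma ucontB n (f g : 'rV[R]_n -> R) : ucont f -> ucont g ->
  ucont (fun t => f t - g t).
Proof.
move=> cf /(ucontZ (-1)) /(ucontD cf).
by congr ucont; apply/funext => t; rewrite mulN1r.
Qed.

Lemma ucont_slice n (f : 'rV[R]_n.+1 -> R) t : 0 <= t <= 1 -> ucont f ->
  ucont (fun u => f (rcube t u)).
Proof.
move=> t01 cf e /cf[d d0 h]; exists d => // u u' uc uc' uu'.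
apply: h; [exact/rcubeP|exact/rcubeP|] => j.
case: (unliftP ord0 j) => [j'|] ->; rewrite ?rcube_lift ?rcube0 ?subrr ?normr0//.
Qed.

Lemma face_cube n (i : 'I_n.+1) e (u : 'rV[R]_n) : unit_cube u ->
  unit_cube (face i e u).
Proof.
by move=> uc j; rewrite mxE; case: unlift => [j'|]; [exact: uc|case: e; rewrite ?lexx ?ler01].
Qed.

Lemma ucont_face n (f : 'rV[R]_n.+1 -> R) (i : 'I_n.+1) e : ucont f ->
  ucont (fun u : 'rV[R]_n => f (face i e u)).
Proof.
move=> cf e' /cf[d d0 h]; exists d => // u u' uc uc' uu'.
apply: h; [exact: face_cube|exact: face_cube|] => j.
by rewrite !mxE; case: unlift => [j'|]; rewrite ?subrr ?normr0.
Qed.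

Definition ucont01 (F : R -> R) := forall e : R, 0 < e ->
  exists2 d : R, 0 < d & forall t u, 0 <= t <= 1 -> 0 <= u <= 1 ->
    `|t - u| < d -> `|F t - F u| < e.

Lemma ucont01_within F : ucont01 F -> {within `[0, 1], continuous F}.
Proof.
move=> cF; apply/continuous_within_itvP => //; split.
- move=> x /[!in_itv]/= /andP[x0 x1].
  apply/cvgrPdist_lt => e /cF[d d0 h].
  near=> y; apply: h; first by rewrite !ltW.
    apply/andP; split; apply: ltW; near: y; [exact: lt_nbhsr|exact: lt_nbhsl].
  by near: y; exact: cvgr_dist_lt.
- apply/cvgrPdist_lt => e /cF[d d0 h].
  near=> y; apply: h; first by rewrite lexx ler01.
    by apply/andP; split; apply: ltW; near: y; [exact: nbhs_right_gt|exact: nbhs_right_lt].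
  by near: y; apply: cvgr_dist_lt => //; exact: cvg_at_right_filter.
- apply/cvgrPdist_lt => e /cF[d d0 h].
  near=> y; apply: h; first by rewrite lexx ler01.
    by apply/andP; split; apply: ltW; near: y; [exact: nbhs_left_gt|exact: nbhs_left_lt].
  by near: y; apply: cvgr_dist_lt => //; exact: cvg_at_left_filter.
Unshelve. all: by end_near. Qed.

Local Notation mu := (@lebesgue_measure R).

Lemma ucont01_integrable F : ucont01 F ->
  mu.-integrable `[0, 1] (EFin \o F).
Proof.
by move=> /ucont01_within cF; apply: continuous_compact_integrable => //;
  exact: segment_compact.
Qed.

Lemma Rintegral01_cst (c : R) : \int[mu]_(t in `[0, 1]) c = c.
Proof.
by rewrite Rintegral_cst//= lebesgue_measure_itv/= lte01 sube0 mulr1.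
Qed.

Lemma Rintegral01_bound F M : ucont01 F ->
  (forall t, 0 <= t <= 1 -> `|F t| <= M) ->
  `|\int[mu]_(t in `[0, 1]) F t| <= M.
Proof.
move=> cF FM; have iF := ucont01_integrable cF.
apply: le_trans (le_normr_Rintegral _ iF) _ => //.
rewrite -[leRHS]Rintegral01_cst; apply: le_Rintegral => //.
- by apply: ucont01_integrable => e /cF[d d0 h]; exists d => // t u tc uc tu;
    apply: le_lt_trans (ler_dist_dist _ _) _; exact: h.
- by apply: ucont01_integrable => e e0; exists 1 => // t u _ _ _; rewrite subrr normr0.
Qed.

Lemma eq_cube_Rintegral n (f g : 'rV[R]_n -> R) :
  (forall t, unit_cube t -> f t = g t) -> cube_Rintegral f = cube_Rintegral g.
Proof.
elim: n f g => [|n IH] f g fg /=.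
  by apply: fg => -[].
apply: eq_Rintegral => t; rewrite in_setE /= in_itv /= => t01.
by apply: IH => u uc; apply: fg; exact/rcubeP.
Qed.

(* Proved together: the integrability of the slice integrals, needed for the
   linearity, follows from the bound in the lower dimension. *)
Lemma cube_Rintegral_props n :
  [/\ forall (f g : 'rV[R]_n -> R), ucont f -> ucont g ->
        cube_Rintegral (fun t => f t + g t) = cube_Rintegral f + cube_Rintegral g,
      forall c (f : 'rV[R]_n -> R), ucont f ->
        cube_Rintegral (fun t => c * f t) = c * cube_Rintegral f,
      forall (f : 'rV[R]_n -> R) M, ucont f ->
        (forall t, unit_cube t -> `|f t| <= M) -> `|cube_Rintegral f| <= M &
      forall (f : 'rV[R]_n.+1 -> R), ucont f ->
        ucont01 (fun t => cube_Rintegral (fun u => f (rcube t u)))].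
Proof.
have sl m : (forall (f g : 'rV[R]_m -> R), ucont f -> ucont g ->
        cube_Rintegral (fun t => f t + g t) = cube_Rintegral f + cube_Rintegral g) ->
    (forall c (f : 'rV[R]_m -> R), ucont f ->
        cube_Rintegral (fun t => c * f t) = c * cube_Rintegral f) ->
    (forall (f : 'rV[R]_m -> R) M, ucont f ->
        (forall t, unit_cube t -> `|f t| <= M) -> `|cube_Rintegral f| <= M) ->
    forall (f : 'rV[R]_m.+1 -> R), ucont f ->
        ucont01 (fun t => cube_Rintegral (fun u => f (rcube t u))).
  move=> IHD IHZ IHB f cf e e0; have [|d d0 h] := cf (e / 2); first by rewrite divr_gt0.
  exists d => // t t' t01 t'01 tt'.
  have ct := ucont_slice t01 cf; have ct' := ucont_slice t'01 cf.
  rewrite -mulN1r -IHZ// -IHD//; last exact: ucontZ.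
  apply: (@le_lt_trans _ _ (e / 2)); last by rewrite gtr_pMr// invf_lt1// ltr1n.
  apply: IHB => [|u uc]; first by apply: ucontD => //; exact: ucontZ.
  rewrite mulN1r; apply/ltW/h; [exact/rcubeP|exact/rcubeP|] => j.
  by case: (unliftP ord0 j) => [j'|] ->; rewrite ?rcube_lift ?rcube0// subrr normr0.
elim: n => [|n [IHD IHZ IHB IHS]].
  have B f M : ucont f -> (forall t : 'rV[R]_0, unit_cube t -> `|f t| <= M) ->
      `|cube_Rintegral f| <= M by move=> _ fM; apply: fM => -[].
  by split=> //; apply: sl.
have D (f g : 'rV[R]_n.+1 -> R) : ucont f -> ucont g ->
    cube_Rintegral (fun t => f t + g t) = cube_Rintegral f + cube_Rintegral g.
  move=> cf cg /=; rewrite -RintegralD//; last 2 first.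
  - by apply: ucont01_integrable; exact: IHS.
  - by apply: ucont01_integrable; exact: IHS.
  apply: eq_Rintegral => t; rewrite in_setE /= in_itv /= => t01.
  by apply: IHD; exact: ucont_slice.
have Z c (f : 'rV[R]_n.+1 -> R) : ucont f ->
    cube_Rintegral (fun t => c * f t) = c * cube_Rintegral f.
  move=> cf /=; rewrite -RintegralZl//; last first.
    by apply: ucont01_integrable; exact: IHS.
  apply: eq_Rintegral => t; rewrite in_setE /= in_itv /= => t01.
  by apply: IHZ; exact: ucont_slice.
have B (f : 'rV[R]_n.+1 -> R) M : ucont f ->
    (forall t, unit_cube t -> `|f t| <= M) -> `|cube_Rintegral f| <= M.
  move=> cf fM /=; apply: Rintegral01_bound => [|t t01]; first exact: IHS.
  apply: IHB => [|u uc]; first exact: ucont_slice.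
  by apply: fM; exact/rcubeP.
by split=> //; apply: sl.
Qed.

Lemma cube_RintegralD n (f g : 'rV[R]_n -> R) : ucont f -> ucont g ->
  cube_Rintegral (fun t => f t + g t) = cube_Rintegral f + cube_Rintegral g.
Proof. by have [D _ _ _] := cube_Rintegral_props n; exact: D. Qed.

Lemma cube_RintegralZ n c (f : 'rV[R]_n -> R) : ucont f ->
  cube_Rintegral (fun t => c * f t) = c * cube_Rintegral f.
Proof. by have [_ Z _ _] := cube_Rintegral_props n; exact: Z. Qed.

Lemma cube_RintegralB n (f g : 'rV[R]_n -> R) : ucont f -> ucont g ->
  cube_Rintegral (fun t => f t - g t) = cube_Rintegral f - cube_Rintegral g.
Proof.
move=> cf cg; rewrite -mulN1r -cube_RintegralZ// -cube_RintegralD//.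
  by congr cube_Rintegral; apply/funext => t; rewrite mulN1r.
exact: ucontZ.
Qed.

Lemma cube_Rintegral_bound n (f : 'rV[R]_n -> R) M : ucont f ->
  (forall t, unit_cube t -> `|f t| <= M) -> `|cube_Rintegral f| <= M.
Proof. by have [_ _ B _] := cube_Rintegral_props n; exact: B. Qed.

Lemma ucont01_slice n (f : 'rV[R]_n.+1 -> R) : ucont f ->
  ucont01 (fun t => cube_Rintegral (fun u => f (rcube t u))).
Proof. by have [_ _ _ S] := cube_Rintegral_props n; exact: S. Qed.

Lemma is_derive_dist (f : R -> R) (t d : R) :
  (forall e, 0 < e -> \forall h \near (0 : R),
    `|f (t + h) - f t - h * d| <= e * `|h|) -> is_derive t 1 f d.
Proof.
move=> fd; apply/is_deriveP.
exists (fun h => if h == 0 then d else h^-1 * (f (t + h) - f t)) => [|h]; last first.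
  by case: eqVneq => [->|h0]; rewrite ?mul0r ?addr0 ?subrr ?mulVKf.
apply/cvgrPdist_le => e e0; apply: filterS (fd e e0) => h.
case: eqVneq => [->|h0 H]; first by move=> _; rewrite subrr normr0 ltW.
rewrite distrC -(ler_pM2r (_ : 0 < `|h|)) ?normr_gt0// -normrM mulrBl.
by rewrite mulrAC mulVf// mul1r [d * h]mulrC.
Qed.

Lemma is_derive0_shift (f : R -> R) (t d : R) :
  is_derive (0 : R) 1 (fun h => f (t + h)) d <-> is_derive t 1 f d.
Proof.
by split=> /is_deriveP[p pd pE]; apply/is_deriveP; exists p => // h;
  have := pE h; rewrite ?add0r ?addr0.
Qed.

Lemma face0 n e (u : 'rV[R]_n) : face ord0 e u = rcube e%:R u.
Proof.
apply/rowP => j; rewrite mxE; case: unliftP => [j'|] ->.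
  by rewrite rcube_lift.
by rewrite rcube0.
Qed.

Lemma face_lift n (i : 'I_n.+1) e t (u : 'rV[R]_n) :
  face (lift ord0 i) e (rcube t u) = rcube t (face i e u).
Proof.
apply/rowP => j; rewrite mxE; case: unliftP => [j'|] ->.
  case: (unliftP ord0 j') => [j2|] ->.
    rewrite rcube_lift.
    have -> : lift (lift ord0 i) (lift ord0 j2) = lift ord0 (lift i j2).
      by apply: ord_inj; rewrite /= /bump !leq0n !add1n ltnS addnS.
    by rewrite rcube_lift mxE liftK.
  rewrite rcube0; have -> : lift (lift ord0 i) ord0 = ord0 :> 'I_n.+2.
    exact: ord_inj.
  by rewrite rcube0.
by rewrite rcube_lift mxE unlift_none.
Qed.

Lemma rcubeD n t h (u : 'rV[R]_n) :
  rcube (t + h) u = rcube t u + h *: delta_mx 0 ord0.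
Proof.
apply/rowP => j; rewrite [RHS]mxE [X in _ = _ + X]mxE [X in _ = _ + _ * X]mxE.
case: (unliftP ord0 j) => [j'|] ->.
  by rewrite !rcube_lift [lift _ _ == _]eq_sym (negbTE (neq_lift _ _)) andbF mulr0 addr0.
by rewrite !rcube0 !eqxx mulr1.
Qed.

Lemma rcube_delta n t h (u : 'rV[R]_n) i :
  rcube t (u + h *: delta_mx 0 i) = rcube t u + h *: delta_mx 0 (lift ord0 i).
Proof.
apply/rowP => j; rewrite [RHS]mxE [X in _ = _ + X]mxE [X in _ = _ + _ * X]mxE.
case: (unliftP ord0 j) => [j'|] ->.
  by rewrite !rcube_lift !mxE (inj_eq lift_inj).
by rewrite !rcube0 (negbTE (neq_lift _ _)) andbF mulr0 addr0.
Qed.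

(** By the mean value theorem the increment of [F] between the slices at [t] and [t + h] is [h * D]
    at a point [c] between them, depending on [u]; uniform continuity of [D] bounds its distance
    from [D] at [t] independently of [u]. *)
Lemma is_derive_slice_integral n (F D : 'rV[R]_n.+1 -> R) (t : R) : 0 < t < 1 ->
  ucont F -> ucont D ->
  (forall t, unit_cube t ->
    is_derive (0 : R) 1 (fun h : R => F (t + h *: delta_mx 0 ord0)) (D t)) ->
  is_derive t 1 (fun t => cube_Rintegral (fun u => F (rcube t u)))
    (cube_Rintegral (fun u => D (rcube t u))).
Proof.
move=> /andP[t0 t1] cF cD FD; apply: is_derive_dist => e e0.
have [d d0 h1] := cD e e0.
have t01 : 0 <= t <= 1 by rewrite !ltW.
have m0 : 0 < Num.min t (1 - t) by rewrite lt_min t0 subr_gt0.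
near=> h.
have ht : `|h| < Num.min t (1 - t) by near: h; exact: (@nbhs0_lt R R^o _ m0).
have hd : `|h| < d by near: h; exact: (@nbhs0_lt R R^o _ d0).
have th01 : 0 <= t + h <= 1.
  by move: ht; rewrite lt_min !ltr_norml => /andP[/andP[h3 h4] /andP[h5 h6]]; lra.
have cs := ucont_slice t01 cF; have csh := ucont_slice th01 cF.
have csD := ucont_slice t01 cD.
rewrite -cube_RintegralB// -cube_RintegralZ// -cube_RintegralB//; last 2 first.
- exact: ucontB.
- exact: ucontZ.
apply: cube_Rintegral_bound => [|u uc].
  by apply: ucontB; [exact: ucontB|exact: ucontZ].
have Fd (x : R) : 0 <= x <= 1 -> is_derive x 1 (fun x => F (rcube x u)) (D (rcube x u)).
  move=> x01; apply/is_derive0_shift; under eq_fun do rewrite rcubeD.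
  by apply: FD; exact/rcubeP.
have [c cth ->] : exists2 c, `|c - t| <= `|h| /\ 0 <= c <= 1 &
    F (rcube (t + h) u) - F (rcube t u) = h * D (rcube c u).
  have Fc (x y : R) : 0 <= x -> y <= 1 -> {within `[x, y], continuous (fun x => F (rcube x u))}.
    move=> x0 y1; apply: derivable_within_continuous => z.
    rewrite in_itv /= => /andP[xz zy].
    by have /Fd[] : 0 <= z <= 1 by rewrite (le_trans x0 xz) (le_trans zy y1).
  have [h0|h0] := leP 0 h.
    have [||||c] := @MVT_segment R _ (fun x => D (rcube x u)) t (t + h) _ _ (Fc t (t + h) _ _).
    - by rewrite lerDl.
    - move=> x; rewrite in_itv /= => /andP[x0 x1]; apply: Fd.
      by move/andP: th01 => [_ q]; rewrite (ltW (lt_trans t0 x0)) (le_trans (ltW x1) q).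
    - exact: ltW.
    - by case/andP: th01.
    rewrite in_itv /= => /andP[c1 c2] ->; exists c; last by rewrite addrC addKr mulrC.
    move/andP: th01 => [_ q]; split; last by rewrite (le_trans (ltW t0) c1) (le_trans c2 q).
    by rewrite !ger0_norm ?subr_ge0// lerBlDl.
  have [||||c] := @MVT_segment R _ (fun x => D (rcube x u)) (t + h) t _ _ (Fc (t + h) t _ _).
  - by rewrite gerDl ltW.
  - move=> x; rewrite in_itv /= => /andP[x0 x1]; apply: Fd.
    by move/andP: th01 => [q _]; rewrite (ltW (le_lt_trans q x0)) (ltW (lt_trans x1 t1)).
  - by case/andP: th01.
  - exact: ltW.
  rewrite in_itv /= => /andP[c1 c2] H; exists c.
    move/andP: th01 => [q _]; split; last by rewrite (le_trans q c1) (le_trans c2 (ltW t1)).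
    by rewrite (ltr0_norm h0) ler0_norm ?subr_le0// lerN2 lerBrDl.
  by rewrite -opprB H opprD addrA subrr sub0r mulrN opprK mulrC.
rewrite -mulrBr normrM mulrC ler_wpM2r//.
apply/ltW/h1; [apply/rcubeP; tauto|exact/rcubeP|] => j.
case: (unliftP ord0 j) => [j'|] ->; rewrite ?rcube_lift ?rcube0 ?subrr ?normr0//.
by apply: le_lt_trans hd; exact: cth.1.
Unshelve. all: by end_near. Qed.

(** In the first coordinate this is the one-dimensional theorem for the integral over slices. Any
    other coordinate is handled inside the outer integral by induction on the dimension, so that the
    order of integration is never exchanged. *)
Lemma cube_FTC n (i : 'I_n.+1) (F D : 'rV[R]_n.+1 -> R) : ucont F -> ucont D ->
  (forall t, unit_cube t ->
    is_derive (0 : R) 1 (fun h : R => F (t + h *: delta_mx 0 i)) (D t)) ->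
  cube_Rintegral D =
    cube_Rintegral (fun u : 'rV[R]_n => F (face i true u)) -
    cube_Rintegral (fun u : 'rV[R]_n => F (face i false u)).
Proof.
have base n' (F' D' : 'rV[R]_n'.+1 -> R) : ucont F' -> ucont D' ->
    (forall t, unit_cube t ->
      is_derive (0 : R) 1 (fun h : R => F' (t + h *: delta_mx 0 ord0)) (D' t)) ->
    cube_Rintegral D' =
    cube_Rintegral (fun u : 'rV[R]_n' => F' (face ord0 true u)) -
    cube_Rintegral (fun u : 'rV[R]_n' => F' (face ord0 false u)).
  move=> cF cD FD.
  have E e : (fun u : 'rV[R]_n' => F' (face ord0 e u)) = fun u => F' (rcube e%:R u).
    by apply/funext => u; rewrite face0.
  rewrite !E.
  have c1 := ucont01_within (ucont01_slice cD).
  have /continuous_within_itvP[//|_ c20 c21] := ucont01_within (ucont01_slice cF).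
  have d01 (x : R) : x \in `]0, 1[%R ->
      is_derive x 1 (fun t => cube_Rintegral (fun u => F' (rcube t u)))
        (cube_Rintegral (fun u => D' (rcube x u))).
    by rewrite in_itv => x01; exact: is_derive_slice_integral.
  rewrite /= /Rintegral.
  rewrite (@continuous_FTC2 _ _ (fun t => cube_Rintegral (fun u => F' (rcube t u)))) //.
    by split=> // x /d01 [].
  by move=> x /d01 dx; rewrite derive1E; case: dx.
elim: n i F D => [|n IH] i F D cF cD FD.
  by rewrite (ord1 i) in FD *; exact: base.
case: (unliftP ord0 i) => [i'|] iE; rewrite iE in FD *; last exact: base.
rewrite /= -RintegralB//; last 2 first.
- by apply: ucont01_integrable; exact: (ucont01_slice (ucont_face (lift ord0 i') true cF)).
- by apply: ucont01_integrable; exact: (ucont01_slice (ucont_face (lift ord0 i') false cF)).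
apply: eq_Rintegral => t; rewrite in_setE /= in_itv /= => t01.
apply: etrans (IH i' (fun u => F (rcube t u)) (fun u => D (rcube t u))
  (ucont_slice t01 cF) (ucont_slice t01 cD) _) _.
  move=> u uc; under eq_fun do rewrite rcube_delta.
  by apply: FD; exact/rcubeP.
by congr (_ - _); apply: eq_cube_Rintegral => u _; rewrite -/(rcube t u) face_lift.
Qed.

End CubeIntegral.

(** * Smooth functions and their mixed partial derivatives *)

Lemma near_eq_differentiable (K : numFieldType) (V W : normedModType K)
    (f g : V -> W) (p : V) :
  (\near p, f p = g p) -> differentiable f p -> differentiable g p.
Proof.
move=> fg /diff_locallyP[dfc /eqaddoP df].
have gE : g \o shift p = cst (g p) + 'd f p +o_ 0 id.
  apply/eqaddoP => e e0; have := df e e0.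
  have fg0 : \forall v \near (0 : V), f (v + p) = g (v + p).
    by move: fg; rewrite (near_shift 0) /= subr0.
  apply: filterS2 fg0 => v fgv; rewrite /= !fctE /= fgv.
  by rewrite (nbhs_singleton fg).
by apply/diff_locallyP; rewrite (diff_unique dfc gE).
Qed.

Section SmoothFunctions.
Variables (K : numFieldType) (n : nat).
Implicit Types (f g : 'rV[K]_n -> K) (V : set 'rV[K]_n) (p : 'rV[K]_n).

(** The graded form of [smooth_on]. It peels off the derivative that is taken first, so that closure
    under products and inverses follows by induction on [r] from the Leibniz rule. *)
Fixpoint diff_order r V g : Prop :=
  (forall p, V p -> differentiable g p) /\
  (if r is r'.+1 then forall j, diff_order r' V (partial j g) else True).

Lemma smooth_diff_order V g : smooth_on V g <-> forall r, diff_order r V g.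
Proof.
split=> [sg r|dg].
  elim: r g sg => [|r IH] g sg /=; first by split=> // p; exact: (sg [::]).
  split=> [p|j]; first exact: (sg [::]).
  by apply: IH => js p Vp; rewrite -foldr_rcons; exact: sg.
move=> js p Vp.
have : diff_order (size js) V g by [].
elim/last_ind: js g {dg} => [|js j IH] g; first by move=> [/(_ p Vp)].
by rewrite size_rcons foldr_rcons => -[_ /(_ j)] /IH.
Qed.

Lemma diff_orderW r V g : diff_order r.+1 V g -> diff_order r V g.
Proof. by elim: r g => [|r IH] g [dg pg]; split=> // j; apply: IH. Qed.

Lemma eq_partial V f g : open V -> (forall p, V p -> f p = g p) ->
  forall j p, V p -> partial j f p = partial j g p.
Proof.
move=> oV fg j p Vp; apply: near_eq_derive.
by near=> q; apply: fg; near: q; exact: open_nbhs_nbhs.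
Unshelve. all: by end_near. Qed.

Lemma eq_differentiable V f g p : open V -> V p -> (forall p, V p -> f p = g p) ->
  differentiable f p -> differentiable g p.
Proof.
move=> oV Vp fg; apply: near_eq_differentiable.
by near=> q; apply: fg; near: q; exact: open_nbhs_nbhs.
Unshelve. all: by end_near. Qed.

Lemma eq_diff_order r V f g : open V -> (forall p, V p -> f p = g p) ->
  diff_order r V f -> diff_order r V g.
Proof.
move=> oV; elim: r f g => [|r IH] f g fg [df pf].
  by split=> // p Vp; apply: (eq_differentiable oV Vp fg); exact: df.
split=> [p Vp|j]; first by apply: (eq_differentiable oV Vp fg); exact: df.
by apply: IH (pf j) => p; exact: eq_partial.
Qed.

Lemma eq_smooth V f g : open V -> (forall p, V p -> f p = g p) ->
  smooth_on V f -> smooth_on V g.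
Proof.
move=> oV fg /smooth_diff_order sf; apply/smooth_diff_order => r.
exact: eq_diff_order (sf r).
Qed.

Lemma smooth_partial V g j : smooth_on V g -> smooth_on V (partial j g).
Proof.
move=> sg; apply/smooth_diff_order => r.
by have /smooth_diff_order/(_ r.+1)[_ /(_ j)] := sg.
Qed.

Lemma smooth_differentiable V g p : smooth_on V g -> V p -> differentiable g p.
Proof. by move=> /(_ [::]); apply. Qed.

Lemma subset_smooth V W g : W `<=` V -> smooth_on V g -> smooth_on W g.
Proof. by move=> WV sg js p Wp; apply: sg; exact: WV. Qed.

Lemma partialD f g p j : differentiable f p -> differentiable g p ->
  partial j (fun q => f q + g q) p = partial j f p + partial j g p.
Proof. by move=> df dg; apply: deriveD; exact: diff_derivable. Qed.

Lemma partialM f g p j : differentiable f p -> differentiable g p ->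
  partial j (fun q => f q * g q) p = partial j f p * g p + f p * partial j g p.
Proof.
move=> df dg; rewrite [LHS]deriveM; [|exact: diff_derivable..].
by rewrite addrC [g p *: _]mulrC.
Qed.

Lemma partial_cst (c : K) p j : partial j (fun _ => c) p = 0.
Proof. exact: derive_cst. Qed.

Lemma partialZ f p j c : differentiable f p ->
  partial j (fun q => c * f q) p = c * partial j f p.
Proof. by move=> df; apply: deriveZ; exact: diff_derivable. Qed.

Lemma partial_coord p i j : partial j (fun q => q 0 i) p = (i == j)%:R.
Proof.
rewrite /partial deriveE; last exact: differentiable_coord.
have @f : {linear 'rV[K]_n -> K}.
  by exists (fun N : 'rV[K]_n => N 0 i); do 2![eexists]; do ?[constructor];
     rewrite ?mxE// => ? *; rewrite ?mxE//; move=> ?; rewrite !mxE.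
rewrite (_ : (fun _ => _) = f)// diff_lin; last exact: coord_continuous.
by rewrite /= mxE eqxx.
Qed.

Lemma diff_order_cst r V (c : K) : diff_order r V (fun _ => c).
Proof.
elim: r c => [|r IH] c; split=> //= j.
have -> : partial j (fun _ => c) = fun=> 0.
  by apply/funext => p; exact: partial_cst.
exact: IH.
Qed.

Lemma diff_orderD r V f g : open V -> diff_order r V f -> diff_order r V g ->
  diff_order r V (fun p => f p + g p).
Proof.
move=> oV; elim: r f g => [|r IH] f g [df pf] [dg pg]; split=> //.
- by move=> p Vp; apply: differentiableD; [exact: df|exact: dg].
- by move=> p Vp; apply: differentiableD; [exact: df|exact: dg].
move=> j; apply: eq_diff_order (IH _ _ (pf j) (pg j)) => // p Vp.
by rewrite partialD//; [exact: df|exact: dg].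
Qed.

Lemma diff_orderM r V f g : open V -> diff_order r V f -> diff_order r V g ->
  diff_order r V (fun p => f p * g p).
Proof.
move=> oV; elim: r f g => [|r IH] f g rf rg; have [df pf] := rf; have [dg pg] := rg.
  by split=> // p Vp; apply: differentiableM; [exact: df|exact: dg].
split=> [p Vp|j]; first by apply: differentiableM; [exact: df|exact: dg].
have H := diff_orderD oV (IH _ _ (pf j) (diff_orderW rg)) (IH _ _ (diff_orderW rf) (pg j)).
apply: eq_diff_order H => // p Vp.
by rewrite partialM//; [exact: df|exact: dg].
Qed.

Lemma smooth_cst V (c : K) : smooth_on V (fun _ => c).
Proof. by apply/smooth_diff_order => r; exact: diff_order_cst. Qed.

Lemma smoothD V f g : open V -> smooth_on V f -> smooth_on V g ->
  smooth_on V (fun p => f p + g p).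
Proof.
move=> oV /smooth_diff_order sf /smooth_diff_order sg; apply/smooth_diff_order => r.
exact: diff_orderD.
Qed.

Lemma smoothM V f g : open V -> smooth_on V f -> smooth_on V g ->
  smooth_on V (fun p => f p * g p).
Proof.
move=> oV /smooth_diff_order sf /smooth_diff_order sg; apply/smooth_diff_order => r.
exact: diff_orderM.
Qed.

Lemma smooth_coord V i : smooth_on V (fun p => p 0 i).
Proof.
apply/smooth_diff_order => -[|r]; split=> //.
- by move=> p _; exact: differentiable_coord.
- by move=> p _; exact: differentiable_coord.
move=> j; have -> : partial j (fun p => p 0 i) = fun=> (i == j)%:R.
  by apply/funext => p; exact: partial_coord.
exact: diff_order_cst.
Qed.

Lemma smooth_sum V (I : Type) (r : seq I) (P : pred I) (f : I -> 'rV[K]_n -> K) :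
  open V -> (forall i, P i -> smooth_on V (f i)) ->
  smooth_on V (fun p => \sum_(i <- r | P i) f i p).
Proof.
move=> oV sf; elim: r => [|i r IH].
  have -> : (fun p => \sum_(i <- [::] | P i) f i p) = fun=> 0.
    by apply/funext => p; rewrite big_nil.
  exact: smooth_cst.
have -> : (fun p => \sum_(i <- i :: r | P i) f i p) =
    fun p => if P i then f i p + \sum_(i <- r | P i) f i p
             else \sum_(i <- r | P i) f i p.
  by apply/funext => p; rewrite big_cons.
by case Pi: (P i) => //; apply: smoothD => //; exact: sf.
Qed.

Lemma derive_partial g p (v : 'rV[K]_n) : differentiable g p ->
  'D_v g p = \sum_j v 0 j * partial j g p.
Proof.
move=> dg; rewrite deriveE// [in LHS](row_sum_delta v) linear_sum.
by apply: eq_bigr => j _; rewrite linearZ -deriveE.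
Qed.

Lemma deriveZv g p (v : 'rV[K]_n) (c : K) : differentiable g p ->
  'D_(c *: v) g p = c * 'D_v g p.
Proof. by move=> dg; rewrite !deriveE// linearZ. Qed.

Lemma smooth_derive V g (v : 'rV[K]_n) : open V -> smooth_on V g ->
  smooth_on V (fun p => 'D_v g p).
Proof.
move=> oV sg; apply: (@eq_smooth V (fun p => \sum_j v 0 j * partial j g p)) => //.
  by move=> p Vp; rewrite derive_partial//; exact: smooth_differentiable Vp.
apply: smooth_sum => // j _; apply: smoothM => //; first exact: smooth_cst.
exact: smooth_partial.
Qed.

Lemma partialV f p j : f p != 0 -> differentiable f p ->
  partial j (fun q => (f q)^-1) p = - partial j f p * ((f p)^-1 * (f p)^-1).
Proof.
move=> fp0 df; rewrite [LHS]deriveV//; last exact: diff_derivable.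
by rewrite -[_ *: _]/(_ * _) mulrC mulrN mulNr expr2 invfM.
Qed.

Lemma diff_orderV r V f : open V -> (forall p, V p -> f p != 0) ->
  diff_order r V f -> diff_order r V (fun p => (f p)^-1).
Proof.
move=> oV f0; elim: r => [|r IH] rf; have [df pf] := rf.
  by split=> // p Vp; apply: differentiableV; [exact: df|exact: f0].
split=> [p Vp|j]; first by apply: differentiableV; [exact: df|exact: f0].
have I := IH (diff_orderW rf).
have H := diff_orderM oV (diff_orderM oV (diff_order_cst r V (-1)) (pf j))
  (diff_orderM oV I I).
apply: eq_diff_order H => // p Vp.
by rewrite partialV ?mulN1r//; [exact: f0|exact: df].
Qed.

Lemma smoothV V f : open V -> (forall p, V p -> f p != 0) -> smooth_on V f ->
  smooth_on V (fun p => (f p)^-1).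
Proof.
move=> oV f0 /smooth_diff_order sf; apply/smooth_diff_order => r.
exact: diff_orderV.
Qed.

Lemma smoothX V f m : open V -> smooth_on V f -> smooth_on V (fun p => f p ^+ m).
Proof.
move=> oV sf; elim: m => [|m IH].
  by have -> : (fun p => f p ^+ 0) = fun=> 1; [|exact: smooth_cst].
have -> : (fun p => f p ^+ m.+1) = fun p => f p * f p ^+ m.
  by apply/funext => p; rewrite exprS.
exact: smoothM.
Qed.

End SmoothFunctions.

Lemma is_derive_slope (K : numFieldType) (V : normedModType K) (f : V -> K)
    (q v : V) (d : K) : is_derive q v f d ->
  exists2 phi : K -> K, phi h @[h --> (0 : K)] --> d &
    forall h, f (q + h *: v) - f q = h * phi h.
Proof.
move=> [df <-].
pose phi h := if h == 0 then 'D_v f q else h^-1 * (f (q + h *: v) - f q).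
exists phi => [|h]; last first.
  rewrite /phi; case: eqVneq => [->|h0]; last by rewrite mulVKf.
  by rewrite scale0r addr0 subrr mul0r.
apply: continuous_at0P; first by rewrite /phi eqxx.
apply: cvg_trans df; apply: near_eq_cvg; near=> h.
have h0 : h != 0 by near: h; exact: nbhs_dnbhs_neq.
by rewrite /phi (negbTE h0) /= [h *: v + q]addrC.
Unshelve. all: by end_near. Qed.

Section Schwarz.
Variable R : realType.

(** The second difference of [f] over the square of side [h] is [h * h * fxy] at one point of the
    square and [h * h * fyx] at another, by two mean value theorems in either order; continuity at
    the origin concludes. *)
Lemma symmetric_mixed_derivatives (f fx fy fxy fyx : R -> R -> R) (d : R) :
  0 < d ->
  (forall x y : R, `|x| < d -> `|y| < d ->
    [/\ is_derive x 1 (f^~ y) (fx x y), is_derive y 1 (fx x) (fxy x y),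
        is_derive y 1 (f x) (fy x y) & is_derive x 1 (fy^~ y) (fyx x y)]) ->
  fxy xy.1 xy.2 @[xy --> ((0, 0) : R * R)] --> fxy 0 0 ->
  fyx xy.1 xy.2 @[xy --> ((0, 0) : R * R)] --> fyx 0 0 ->
  fxy 0 0 = fyx 0 0.
Proof.
move=> d0 fd cxy cyx.
have key (g gx gxy : R -> R -> R) (h : R) : 0 < h -> h < d ->
    (forall x y : R, `|x| < d -> `|y| < d ->
      is_derive x 1 (g^~ y) (gx x y) /\ is_derive y 1 (gx x) (gxy x y)) ->
    exists2 c : R * R, `|c.1| <= h /\ `|c.2| <= h &
      g h h - g h 0 - (g 0 h - g 0 0) = h * h * gxy c.1 c.2.
  move=> h0 hd gd; have hn : `|h| < d by rewrite ger0_norm// ltW.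
  have bnd (x : R) : 0 <= x -> x <= h -> `|x| < d.
    by move=> x0 xh; rewrite ger0_norm//; exact: le_lt_trans hd.
  have n0 : `|0 : R| < d by rewrite normr0.
  have gD (x : R) : 0 <= x -> x <= h -> is_derive x 1 (fun x => g x h - g x 0) (gx x h - gx x 0).
    move=> x0 xh; have [g1 _] := gd x h (bnd _ x0 xh) hn.
    by have [g2 _] := gd x 0 (bnd _ x0 xh) n0; exact: is_deriveB.
  have [|||c /[!in_itv]/= /andP[c0 ch] cE] := @MVT_segment R (fun x => g x h - g x 0) (fun x => gx x h - gx x 0) 0 h.
  - exact: ltW.
  - by move=> x /[!in_itv]/= /andP[x0 xh]; apply: gD; exact: ltW.
  - apply: derivable_within_continuous => x /[!in_itv]/= /andP[x0 xh].
    by case: (gD x x0 xh).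
  have gxD (y : R) : 0 <= y -> y <= h -> is_derive y 1 (gx c) (gxy c y).
    by move=> y0 yh; have [_] := gd c y (bnd _ c0 ch) (bnd _ y0 yh).
  have [|||e /[!in_itv]/= /andP[e0 eh] eE] := @MVT_segment R (gx c) (gxy c) 0 h.
  - exact: ltW.
  - by move=> x /[!in_itv]/= /andP[x0 xh]; apply: gxD; exact: ltW.
  - apply: derivable_within_continuous => x /[!in_itv]/= /andP[x0 xh].
    by case: (gxD x x0 xh).
  exists (c, e); first by rewrite /= !ger0_norm.
  by rewrite cE eE !subr0 /= mulrC mulrA mulrAC.
apply/eqP; rewrite -subr_eq0 -normr_le0; apply/ler_addgt0Pl => e e0.
rewrite addr0; have e2 : 0 < e / 2 by rewrite divr_gt0.
have nb (G : R -> R -> R) : G xy.1 xy.2 @[xy --> ((0, 0) : R * R)] --> G 0 0 ->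
    exists2 r : R, 0 < r &
      forall x y, `|x| < r -> `|y| < r -> `|G 0 0 - G x y| < e / 2.
  move=> /cvgrPdist_lt/(_ _ e2) [[A B] /= []].
  move=> /nbhs_ballP[r1 /= r10 h1] /nbhs_ballP[r2 /= r20 h2] hAB.
  exists (Num.min r1 r2) => [|x y]; first by rewrite lt_min r10 r20.
  rewrite !lt_min => /andP[x1 x2] /andP[y1 y2].
  by apply: (hAB (x, y)); split; [apply: h1|apply: h2]; rewrite /ball /= sub0r normrN.
have [r1 r10 h1] := nb _ cxy; have [r2 r20 h2] := nb _ cyx.
pose h := Num.min d (Num.min r1 r2) / 2.
have m0 : 0 < Num.min d (Num.min r1 r2) by rewrite !lt_min d0 r10 r20.
have h0 : 0 < h by rewrite divr_gt0.
have : h < Num.min d (Num.min r1 r2) by rewrite gtr_pMr// invf_lt1// ltr1n.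
rewrite !lt_min => /and3P[hd hr1 hr2].
have [|[c1 c2] /= [c1h c2h] E1] := key f fx fxy h h0 hd.
  by move=> x y xd yd; have [] := fd x y xd yd.
have [|[c3 c4] /= [c3h c4h] E2] := key (fun y x => f x y) (fun y x => fy x y) (fun y x => fyx x y) h h0 hd.
  by move=> x y xd yd; have [] := fd y x yd xd.
have E : fxy c1 c2 = fyx c4 c3.
  have hh : h * h != 0 by rewrite mulf_neq0// gt_eqF.
  by apply: (mulfI hh); rewrite -E1 -E2; ring.
have -> : fxy 0 0 - fyx 0 0 = (fxy 0 0 - fxy c1 c2) - (fyx 0 0 - fyx c4 c3).
  by rewrite E; ring.
apply: le_trans (ler_normB _ _) _; rewrite (splitr e); apply: lerD; apply: ltW.
  by apply: h1; [exact: le_lt_trans c1h hr1|exact: le_lt_trans c2h hr1].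
by apply: h2; [exact: le_lt_trans c4h hr2|exact: le_lt_trans c3h hr2].
Qed.

Lemma is_derive_line n (g : 'rV[R]_n -> R) (p v : 'rV[R]_n) (t : R) :
  differentiable g (p + t *: v) ->
  is_derive t 1 (fun t => g (p + t *: v)) ('D_v g (p + t *: v)).
Proof.
move=> dg; have [phi phid phiE] := is_derive_slope (derivableP (@diff_derivable _ _ _ _ _ v dg)).
apply/is_deriveP; exists phi => // h.
by rewrite scalerDl addrA phiE.
Qed.

Lemma cderiv_line n (g : 'rV[R[i]]_n -> R[i]) (p v : 'rV[R[i]]_n) (t : R) :
  differentiable g (p + t%:C *: v) ->
  cderiv (fun t : R => g (p + t%:C *: v)) t ('D_v g (p + t%:C *: v)).
Proof.
move=> dg; have [phi phid phiE] := is_derive_slope (derivableP (@diff_derivable _ _ _ _ _ v dg)).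
exists (fun h => phi h%:C) => [|h]; last by rewrite rmorphD scalerDl addrA phiE.
have h0 : (h%:C : R[i]) @[h --> (0 : R)] --> (0 : R[i]).
  exact: (cvg_real_complex cvg_id).
exact: (@cvg_comp _ _ _ (fun h : R => h%:C : R[i]) phi _ _ _ h0 phid).
Qed.

(** The plane is mapped into an arbitrary space by [P], so that real functions and the real and
    imaginary parts of complex functions along real increments are treated alike. *)
Lemma symmetric_mixed_derivatives_path (T : topologicalType) (P : R -> R -> T)
    (V : set T) (h hx hy hxy hyx : T -> R) :
  open V -> V (P 0 0) ->
  P xy.1 xy.2 @[xy --> ((0, 0) : R * R)] --> P 0 0 ->
  (forall x y : R, V (P x y) ->
    [/\ is_derive x 1 (fun x => h (P x y)) (hx (P x y)),
        is_derive y 1 (fun y => hx (P x y)) (hxy (P x y)),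
        is_derive y 1 (fun y => h (P x y)) (hy (P x y)) &
        is_derive x 1 (fun x => hy (P x y)) (hyx (P x y))]) ->
  {for P 0 0, continuous hxy} -> {for P 0 0, continuous hyx} ->
  hxy (P 0 0) = hyx (P 0 0).
Proof.
move=> oV VP cP hd cxy cyx.
have [[A B] /= [] ] : \forall xy \near ((0, 0) : R * R), V (P xy.1 xy.2).
  by apply: cP; exact: open_nbhs_nbhs.
move=> /nbhs_ballP[r1 /= r10 h1] /nbhs_ballP[r2 /= r20 h2] hAB.
apply: (@symmetric_mixed_derivatives (fun x y => h (P x y)) (fun x y => hx (P x y))
  (fun x y => hy (P x y)) (fun x y => hxy (P x y)) (fun x y => hyx (P x y))
  (Num.min r1 r2)).
- by rewrite lt_min r10 r20.
- move=> x y; rewrite !lt_min => /andP[x1 x2] /andP[y1 y2]; apply: hd.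
  by apply: (hAB (x, y)); split; [apply: h1|apply: h2]; rewrite /ball /= sub0r normrN.
- exact: (@cvg_comp _ _ _ (fun xy : R * R => P xy.1 xy.2) hxy _ _ _ cP cxy).
- exact: (@cvg_comp _ _ _ (fun xy : R * R => P xy.1 xy.2) hyx _ _ _ cP cyx).
Qed.

Lemma cvg_plane (K : numFieldType) (n : nat) (p u v : 'rV[K]_n)
    (T : Type) (F : set_system T) {FF : Filter F} (a b : T -> K) :
  a t @[t --> F] --> (0 : K) -> b t @[t --> F] --> (0 : K) ->
  (p + a t *: u + b t *: v) @[t --> F] --> p.
Proof.
move=> a0 b0; have E : p = p + 0 *: u + 0 *: v by rewrite !scale0r !addr0.
rewrite [X in _ --> X]E; apply: cvgD; last exact: cvgZr_tmp.
by apply: cvgD; [exact: cvg_cst|exact: cvgZr_tmp].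
Qed.

Lemma partialC_real n (V : set 'rV[R]_n) (g : 'rV[R]_n -> R) i j p :
  open V -> smooth_on V g -> V p ->
  partial i (partial j g) p = partial j (partial i g) p.
Proof.
move=> oV sg Vp.
pose P (x y : R) := p + x *: delta_mx 0 j + y *: delta_mx 0 i.
have P0 : P 0 0 = p by rewrite /P !scale0r !addr0.
have dl h (x y : R) : (forall q, V q -> differentiable h q) -> V (P x y) ->
    is_derive x 1 (fun x => h (P x y)) (partial j h (P x y)) /\
    is_derive y 1 (fun y => h (P x y)) (partial i h (P x y)).
  move=> dh VP; split; last by apply: is_derive_line; exact: dh.
  have PE x' : P x' y = (p + y *: delta_mx 0 i) + x' *: delta_mx 0 j.
    by rewrite /P addrAC.
  under eq_fun do rewrite PE; rewrite PE; apply: is_derive_line.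
  by rewrite -PE; exact: dh.
have sd h : smooth_on V h -> forall q, V q -> differentiable h q.
  by move=> sh q Vq; exact: smooth_differentiable sh Vq.
have sj := smooth_partial j sg; have si := smooth_partial i sg.
have cP : P xy.1 xy.2 @[xy --> ((0, 0) : R * R)] --> P 0 0.
  by rewrite P0; apply: cvg_plane; [exact: cvg_fst|exact: cvg_snd].
have VP : V (P 0 0) by rewrite P0.
have cji : {for P 0 0, continuous (partial i (partial j g))}.
  rewrite P0; apply: differentiable_continuous.
  by apply: smooth_differentiable Vp; exact: smooth_partial.
have cij : {for P 0 0, continuous (partial j (partial i g))}.
  rewrite P0; apply: differentiable_continuous.
  by apply: smooth_differentiable Vp; exact: smooth_partial.
rewrite -P0.
apply: (symmetric_mixed_derivatives_path (hx := partial j g) (hy := partial i g)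
  oV VP cP _ cji cij) => x y VPxy.
have [d1 _] := dl g x y (sd _ sg) VPxy.
have [_ d2] := dl _ x y (sd _ sj) VPxy.
have [_ d3] := dl g x y (sd _ sg) VPxy.
have [d4 _] := dl _ x y (sd _ si) VPxy.
split; [exact: d1|exact: d2|exact: d3|exact: d4].
Qed.

(** Complex partial derivatives are already determined by real increments along the two axes, and
    along these the real and imaginary parts can be treated separately. *)
Lemma partialC_complex n (V : set 'rV[R[i]]_n) (g : 'rV[R[i]]_n -> R[i]) i j p :
  open V -> smooth_on V g -> V p ->
  partial i (partial j g) p = partial j (partial i g) p.
Proof.
move=> oV sg Vp.
pose P (x y : R) := p + x%:C *: delta_mx 0 j + y%:C *: delta_mx 0 i.
have P0 : P 0 0 = p by rewrite /P !scale0r !addr0.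
have dl h (x y : R) : (forall q, V q -> differentiable h q) -> V (P x y) ->
    cderiv (fun x => h (P x y)) x (partial j h (P x y)) /\
    cderiv (fun y => h (P x y)) y (partial i h (P x y)).
  move=> dh VP; split; last by apply: cderiv_line; exact: dh.
  have PE x' : P x' y = (p + y%:C *: delta_mx 0 i) + x'%:C *: delta_mx 0 j.
    by rewrite /P addrAC.
  under eq_fun do rewrite PE; rewrite PE; apply: cderiv_line.
  by rewrite -PE; exact: dh.
have sd h : smooth_on V h -> forall q, V q -> differentiable h q.
  by move=> sh q Vq; exact: smooth_differentiable sh Vq.
have sj := smooth_partial j sg; have si := smooth_partial i sg.
have cP : P xy.1 xy.2 @[xy --> ((0, 0) : R * R)] --> P 0 0.
  rewrite P0; apply: cvg_plane.
    exact: (cvg_real_complex cvg_fst).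
  exact: (cvg_real_complex cvg_snd).
have VP : V (P 0 0) by rewrite P0.
have cji : {for P 0 0, continuous (partial i (partial j g))}.
  rewrite P0; apply: differentiable_continuous.
  by apply: smooth_differentiable Vp; exact: smooth_partial.
have cij : {for P 0 0, continuous (partial j (partial i g))}.
  rewrite P0; apply: differentiable_continuous.
  by apply: smooth_differentiable Vp; exact: smooth_partial.
rewrite -P0.
have dP x y (VPxy : V (P x y)) :=
  (dl g x y (sd _ sg) VPxy, dl _ x y (sd _ sj) VPxy, dl _ x y (sd _ si) VPxy).
apply: complex_eqP.
  apply: (symmetric_mixed_derivatives_path (h := fun q => complex.Re (g q))
    (hx := fun q => complex.Re (partial j g q)) (hy := fun q => complex.Re (partial i g q))
    (hxy := fun q => complex.Re (partial i (partial j g) q))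
    (hyx := fun q => complex.Re (partial j (partial i g) q))
    oV VP cP _ (cvg_Re cji) (cvg_Re cij)) => x y /dP[[[d1 d3] [_ d2]] [d4 _]].
  split; [exact: (proj1 (iffLR (cderivP _ _ _) d1))|exact: (proj1 (iffLR (cderivP _ _ _) d2))|
    exact: (proj1 (iffLR (cderivP _ _ _) d3))|exact: (proj1 (iffLR (cderivP _ _ _) d4))].
apply: (symmetric_mixed_derivatives_path (h := fun q => complex.Im (g q))
    (hx := fun q => complex.Im (partial j g q)) (hy := fun q => complex.Im (partial i g q))
    (hxy := fun q => complex.Im (partial i (partial j g) q))
    (hyx := fun q => complex.Im (partial j (partial i g) q))
    oV VP cP _ (cvg_Im cji) (cvg_Im cij)) => x y /dP[[[d1 d3] [_ d2]] [d4 _]].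
split; [exact: (proj2 (iffLR (cderivP _ _ _) d1))|exact: (proj2 (iffLR (cderivP _ _ _) d2))|
    exact: (proj2 (iffLR (cderivP _ _ _) d3))|exact: (proj2 (iffLR (cderivP _ _ _) d4))].
Qed.

End Schwarz.

(** * Euler operators *)

Section EulerOperators.
Variables (R : realType) (n : nat).
Local Notation C := R[i].
Implicit Types (f g : 'rV[C]_n -> C) (V : set 'rV[C]_n) (P Q : mpoly n C).

Definition eq_on V f g := forall p, V p -> f p = g p.

Lemma euler_eq_on V f g j : open V -> eq_on V f g ->
  eq_on V (euler j f) (euler j g).
Proof. by move=> oV fg p Vp; rewrite /euler (eq_partial oV fg j Vp). Qed.

Lemma smooth_euler V g j : open V -> smooth_on V g -> smooth_on V (euler j g).
Proof.
move=> oV sg; apply: smoothM => //; first exact: smooth_coord.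
exact: smooth_partial.
Qed.

Lemma eulerC V g i j : open V -> smooth_on V g ->
  eq_on V (euler i (euler j g)) (euler j (euler i g)).
Proof.
move=> oV sg p Vp; rewrite /euler !partialM; try exact: differentiable_coord;
  try by apply: smooth_differentiable Vp; exact: smooth_partial.
rewrite !partial_coord (partialC_complex i j oV sg Vp) [i == j]eq_sym.
case: eqVneq => [->|_]; first by [].
move: (p 0 i) (p 0 j) (partial j g p) (partial i g p) (partial j (partial i g) p).
by move=> a b c d e; rewrite /= mulr0n (mul0r c) (mul0r d) !add0r mulrCA.
Qed.

Lemma eulerD V f g j : smooth_on V f -> smooth_on V g ->
  eq_on V (euler j (fun p => f p + g p)) (fun p => euler j f p + euler j g p).
Proof.
move=> sf sg p Vp; rewrite /euler partialD ?mulrDr//.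
  exact: smooth_differentiable Vp.
exact: smooth_differentiable Vp.
Qed.

Lemma eulerZ V f j c : smooth_on V f ->
  eq_on V (euler j (fun p => c * f p)) (fun p => c * euler j f p).
Proof.
move=> sf p Vp; rewrite /euler partialZ 1?mulrCA//.
exact: smooth_differentiable Vp.
Qed.

Definition euler_seq (s : seq 'I_n) (e : 'I_n -> nat) g :=
  foldr (fun j h => iter (e j) (euler j) h) g s.

Lemma euler_monomialE (e : multinom n) g :
  euler_monomial e g = euler_seq (enum 'I_n) e g.
Proof. exact: erefl. Qed.

Lemma iter_euler_eq_on V f g j r : open V -> eq_on V f g ->
  eq_on V (iter r (euler j) f) (iter r (euler j) g).
Proof.
move=> oV fg; elim: r => [|r IH]; first exact: fg.
by rewrite !iterS; exact: (euler_eq_on j oV IH).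
Qed.

Lemma euler_seq_eq_on V s e f g : open V -> eq_on V f g ->
  eq_on V (euler_seq s e f) (euler_seq s e g).
Proof.
move=> oV fg; elim: s => [|j s IH]; first exact: fg.
exact: (iter_euler_eq_on j (e j) oV IH).
Qed.

Lemma smooth_iter_euler V g j r : open V -> smooth_on V g ->
  smooth_on V (iter r (euler j) g).
Proof.
move=> oV sg; elim: r => [|r IH]; first exact: sg.
by rewrite iterS; exact: (smooth_euler j oV IH).
Qed.

Lemma smooth_euler_seq V s e g : open V -> smooth_on V g ->
  smooth_on V (euler_seq s e g).
Proof.
move=> oV sg; elim: s => [|j s IH]; first exact: sg.
exact: (smooth_iter_euler j (e j) oV IH).
Qed.

Lemma eq_on_trans V f g h : eq_on V f g -> eq_on V g h -> eq_on V f h.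
Proof. by move=> fg gh p Vp; rewrite fg// gh. Qed.

Lemma iter_eulerC V g i j r : open V -> smooth_on V g ->
  eq_on V (euler i (iter r (euler j) g)) (iter r (euler j) (euler i g)).
Proof.
move=> oV sg; elim: r => [|r IH]; first by [].
rewrite !iterS; apply: (@eq_on_trans _ _ (euler j (euler i (iter r (euler j) g)))).
  exact: (eulerC i j oV (smooth_iter_euler j r oV sg)).
exact: (euler_eq_on j oV IH).
Qed.

Lemma euler_seqC V s e g i : open V -> smooth_on V g ->
  eq_on V (euler i (euler_seq s e g)) (euler_seq s e (euler i g)).
Proof.
move=> oV sg; elim: s => [|j s IH]; first by [].
apply: (@eq_on_trans _ _ (iter (e j) (euler j) (euler i (euler_seq s e g)))).
  exact: (iter_eulerC i j (e j) oV (smooth_euler_seq s e oV sg)).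
exact: (iter_euler_eq_on j (e j) oV IH).
Qed.

(** The additional [euler i] appears at the place of [i] in the list and is commuted down to the
    innermost position; if [i] is not in [s], the two exponents agree on [s]. *)
Lemma euler_seqS V s (e e' : 'I_n -> nat) g i : open V -> smooth_on V g ->
  (forall j, e' j = ((i == j) + e j)%N) -> uniq s ->
  eq_on V (euler_seq s e' g)
    (if i \in s then euler_seq s e (euler i g) else euler_seq s e g).
Proof.
move=> oV sg e'E; elim: s => [|j s IH /andP[js us]]; first by [].
have -> : euler_seq (j :: s) e' g = iter (e' j) (euler j) (euler_seq s e' g) by [].
rewrite inE e'E; have [ij|ij] := eqVneq i j.
  rewrite ij add1n iterSr /=; apply: (iter_euler_eq_on j (e j) oV).
  apply: (eq_on_trans (euler_eq_on j oV (IH us))).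
  by rewrite ij (negbTE js); exact: (euler_seqC s e j oV sg).
apply: (eq_on_trans (iter_euler_eq_on j (e j) oV (IH us))).
by case: (i \in s).
Qed.

Lemma euler_monomialM V (e : multinom n) g i : open V -> smooth_on V g ->
  eq_on V (euler_monomial (mnm_add e (mnm1 i)) g) (euler_monomial e (euler i g)).
Proof.
move=> oV sg p Vp.
have := @euler_seqS V (enum 'I_n) e (mnm_add e (mnm1 i)) g i oV sg _ (enum_uniq _) p Vp.
by rewrite mem_enum; apply => j; rewrite mnmDE mnm1E addnC.
Qed.

Lemma euler_seq_lin V s e f g c : open V -> smooth_on V f -> smooth_on V g ->
  eq_on V (euler_seq s e (fun p => c * f p + g p))
    (fun p => c * euler_seq s e f p + euler_seq s e g p).
Proof.
move=> oV sf sg; elim: s => [|j s IH]; first by [].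
apply: eq_on_trans (iter_euler_eq_on j (e j) oV IH) _.
have E h : euler_seq (j :: s) e h = iter (e j) (euler j) (euler_seq s e h) by [].
rewrite !E {E IH}.
have sf' := smooth_euler_seq s e oV sf; have sg' := smooth_euler_seq s e oV sg.
move: (euler_seq s e f) (euler_seq s e g) sf' sg' => f' g' sf' sg'.
have sm c' h : smooth_on V h -> smooth_on V (fun p => c' * h p).
  by move=> sh; apply: smoothM => //; exact: smooth_cst.
elim: (e j) => [|r IH']; first by [].
rewrite !iterS; apply: eq_on_trans (euler_eq_on j oV IH') _ => p Vp.
have si h : smooth_on V h -> smooth_on V (iter r (euler j) h) by exact: smooth_iter_euler.
rewrite (eulerD _ (sm c _ (si _ sf')) (si _ sg'))//.
by rewrite (eulerZ _ _ (si _ sf')).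
Qed.

Section LinearForm.
Variable w : multinom n -> C.

(** For fixed [g] and [p], [apply_op] is such a form in the polynomial. The range of summation
    depends on [P], hence linearity is checked over a common superset of the supports. *)
Definition mlin P : C := \sum_(e <- msupp P) mcoeff e P * w e.

Lemma mlin_superset P (s : seq (multinom n)) : uniq s ->
  {subset msupp P <= s} -> mlin P = \sum_(e <- s) mcoeff e P * w e.
Proof.
move=> us sub; rewrite [RHS](bigID (mem (msupp P)))/= [X in _ = _ + X]big1; last first.
  by move=> e eP; rewrite memN_msupp_eq0// mul0r.
rewrite addr0 -[RHS]big_filter; apply: perm_big; apply: uniq_perm.
- exact: msupp_uniq.
- exact: filter_uniq.
- by move=> e; rewrite mem_filter andb_idr//; exact: sub.
Qed.

Lemma mlin_is_linear c P Q : mlin (c *: P + Q) = c * mlin P + mlin Q.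
Proof.
pose s := undup (msupp P ++ msupp Q ++ msupp (c *: P + Q)).
have us : uniq s by exact: undup_uniq.
rewrite !(@mlin_superset _ s)//; first last.
- by move=> e eP; rewrite mem_undup !mem_cat eP ?orbT.
- by move=> e eP; rewrite mem_undup !mem_cat eP ?orbT.
- by move=> e eP; rewrite mem_undup !mem_cat eP ?orbT.
rewrite big_distrr -big_split /=; apply: eq_bigr => e _.
by rewrite mcoeffD mcoeffZ mulrDl mulrA.
Qed.

HB.instance Definition _ :=
  GRing.isLinear.Build C (mpoly n C) C *%R mlin mlin_is_linear.

Lemma mlinX e : mlin (mpolyX C e) = w e.
Proof. by rewrite /mlin msuppX big_seq1 mcoeffX eqxx mul1r. Qed.

End LinearForm.

Lemma apply_opE P g p : apply_op P g p = mlin (fun e => euler_monomial e g p) P.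
Proof. by []. Qed.

Lemma apply_opD P Q g p : apply_op (P + Q) g p = apply_op P g p + apply_op Q g p.
Proof. by rewrite !apply_opE linearD. Qed.

Lemma apply_opZ c P g p : apply_op (c *: P) g p = c * apply_op P g p.
Proof. by rewrite !apply_opE linearZ. Qed.

Lemma apply_op_sum (I : Type) (r : seq I) (F : I -> mpoly n C) g p :
  apply_op (\sum_(i <- r) F i) g p = \sum_(i <- r) apply_op (F i) g p.
Proof. by rewrite !apply_opE linear_sum. Qed.

Lemma apply_op_eq_on V P f g : open V -> eq_on V f g ->
  eq_on V (apply_op P f) (apply_op P g).
Proof.
move=> oV fg p Vp; apply: eq_bigr => e _; congr (_ * _).
exact: (euler_seq_eq_on _ _ oV fg).
Qed.

Lemma smooth_apply_op V P g : open V -> smooth_on V g -> smooth_on V (apply_op P g).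
Proof.
move=> oV sg; apply: smooth_sum => // e _; apply: smoothM => //.
  exact: smooth_cst.
exact: smooth_euler_seq.
Qed.

Lemma apply_op_lin V P f g c : open V -> smooth_on V f -> smooth_on V g ->
  eq_on V (apply_op P (fun p => c * f p + g p))
    (fun p => c * apply_op P f p + apply_op P g p).
Proof.
move=> oV sf sg p Vp; rewrite /apply_op big_distrr -big_split /=.
apply: eq_bigr => e _; rewrite !euler_monomialE (euler_seq_lin _ _ _ oV sf sg Vp).
by rewrite mulrDr mulrCA.
Qed.

(** The right factor acts first: this lets a product of operators be evaluated one factor at a
    time. *)
Lemma apply_op_mulX V P g i : open V -> smooth_on V g ->
  eq_on V (apply_op (P * mpolyX C (mnm1 i)) g) (apply_op P (euler i g)).
Proof.
move=> oV sg p Vp; rewrite [in LHS](mpolyE P) mulr_suml apply_op_sum.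
apply: eq_bigr => e _; rewrite -scalerAl apply_opZ -mpolyXD apply_opE mlinX.
by congr (_ * _); exact: (euler_monomialM e i oV sg Vp).
Qed.

Lemma apply_op1 g p : apply_op 1 g p = g p.
Proof.
rewrite apply_opE -(mpolyX0 n C) mlinX euler_monomialE.
by elim: (enum _) => //= j s IH; rewrite mnm0E.
Qed.

End EulerOperators.

(** * The identity theorem in several variables *)

Section IdentityTheorem.
Variable R : realType.
Local Notation C := R[i].

(** At the maximum [f1 x] is 0. Were [d] positive, [f1] would be positive just to the right of [x],
    and [f] would exceed its maximum there by the mean value theorem. *)
Lemma second_derivative_at_max (f f1 : R -> R) (x d : R) :
  (\forall y \near x, is_derive (y : R) 1 f (f1 y)) -> is_derive x 1 f1 d ->
  (\forall y \near x, f y <= f x) -> d <= 0.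
Proof.
move=> df df1 fmax.
have toh (P : R -> Prop) : (\forall y \near x, P y) -> \forall h \near (0 : R), P (x + h).
  have xh : (x + h : R) @[h --> (0 : R)] --> x.
    by rewrite -[X in _ --> X]addr0; apply: cvgD; [exact: cvg_cst|exact: cvg_id].
  by move=> nP; exact: (xh _ nP).
have {}fmax := toh _ fmax; have df' := toh _ df.
have [p pd pE] := (is_deriveP _ _ _).1 df1.
have [q qd qE] := (is_deriveP _ _ _).1 (nbhs_singleton df).
have f10 : f1 x = 0.
  (* The values 1 and -1 of [s] stand for a step to the right and a step to the left. *)
  have near_sign (s : R) : s * s = 1 -> s * f1 x <= 0.
    move=> ss; rewrite leNgt; apply/negP => f1x.
    have sq : s * q h @[h --> (0 : R)] --> s * f1 x by apply: cvgMr.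
    have [e /= e0 he] : \forall h \near (0 : R), 0 < s * q h /\ f (x + h) <= f x.
      near=> h; split; near: h; [exact: (cvgr_gt _ sq 0 f1x)|exact: fmax].
    have s1 : `|s| = 1.
      by apply/eqP; rewrite -(@eqrXn2 _ 2)// expr1n real_normK ?num_real// expr2 ss.
    have := he (s * (e / 2)); rewrite /= sub0r normrN normrM s1 mul1r.
    rewrite gtr0_norm ?divr_gt0// => /(_ _)[].
      by rewrite gtr_pMr// invf_lt1// ltr1n.
    move=> q0; apply/negP; rewrite -ltNge -subr_gt0 qE.
    have -> : s * (e / 2) * q (s * (e / 2)) = (e / 2) * (s * q (s * (e / 2))) by ring.
    by rewrite mulr_gt0// divr_gt0.
  have := near_sign 1 (mulr1 _); have := near_sign (-1).
  rewrite mulrNN mulr1 mul1r mulN1r => /(_ erefl); lra.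
rewrite leNgt; apply/negP => d0.
have [e /= e0 he] : \forall h \near (0 : R), [/\ 0 < p h, f (x + h) <= f x & is_derive (x + h) 1 f (f1 (x + h))].
  near=> h; split; near: h; [exact: (cvgr_gt _ pd 0 d0)|exact: fmax|exact: df'].
have e2 : 0 < e / 2 by rewrite divr_gt0.
have hb (h : R) : 0 <= h -> h <= e / 2 -> [/\ 0 < p h, f (x + h) <= f x & is_derive (x + h) 1 f (f1 (x + h))].
  move=> h0 h1; apply: he; rewrite /= sub0r normrN ger0_norm//.
  by apply: le_lt_trans h1 _; rewrite gtr_pMr// invf_lt1// ltr1n.
have fD (y : R) : x <= y -> y <= x + e / 2 -> is_derive y 1 f (f1 y).
  move=> xy yx; have [||_ _] := hb (y - x); [by rewrite subr_ge0|by rewrite lerBlDl|].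
  by rewrite addrC subrK.
have [|||c /[!in_itv]/= /andP[c1 c2] cE] := @MVT R f f1 x (x + e / 2).
- by rewrite ltrDl.
- by move=> y /[!in_itv]/= /andP[y1 y2]; apply: fD; exact: ltW.
- apply: derivable_within_continuous => y /[!in_itv]/= /andP[y1 y2].
  by case: (fD y y1 y2).
have [||p0 _ _] := hb (c - x); [by rewrite subr_ge0 ltW|by rewrite lerBlDl ltW|].
have [||_ fm _] := hb (e / 2) => //; first exact: ltW.
have f1c : 0 < f1 c.
  have := pE (c - x); rewrite f10 subr0 [x + _]addrC subrK => ->.
  by rewrite mulr_gt0// subr_gt0.
move: fm; apply/negP; rewrite -ltNge -subr_gt0 cE mulr_gt0//.
by rewrite addrC addKr.
Unshelve. all: by end_near. Qed.

Definition sqnorm (z : C) : R := complex.Re z ^+ 2 + complex.Im z ^+ 2.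

Lemma sqnorm_ge0 z : 0 <= sqnorm z.
Proof. by rewrite addr_ge0 ?sqr_ge0. Qed.

Lemma sqnorm_eq0 z : sqnorm z = 0 -> z = 0.
Proof.
move=> /eqP; rewrite paddr_eq0 ?sqr_ge0// !sqrf_eq0 => /andP[/eqP a /eqP b].
by apply: complex_eqP; rewrite ?a ?b.
Qed.

Lemma sqnormM z w : sqnorm (z * w) = sqnorm z * sqnorm w.
Proof. by case: z w => a b [c d]; rewrite /sqnorm /=; ring. Qed.

Lemma sqnorm_normc z : sqnorm z = normc z ^+ 2.
Proof. by case: z => a b; rewrite /normc sqr_sqrtr// addr_ge0 ?sqr_ge0. Qed.

(** The term [e * (y ^+ 2 + c)] is the strictly convex perturbation of [annulus_max] restricted to a
    coordinate line, [c] being the square of the coordinate held fixed. It contributes the [2 * e]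
    of the conclusion. *)
Lemma sqnorm_second_derivative (F F1 : R -> C) (x : R) (F2 : C) (e c : R) :
  (\forall y \near x, cderiv F y (F1 y)) -> cderiv F1 x F2 ->
  (\forall y \near x, sqnorm (F y) + e * (y ^+ 2 + c) <=
     sqnorm (F x) + e * (x ^+ 2 + c)) ->
  2 * (sqnorm (F1 x) + complex.Re (F x) * complex.Re F2 +
       complex.Im (F x) * complex.Im F2) + 2 * e <= 0.
Proof.
move=> dF dF1 Fmax.
pose f1 y := 2 * (complex.Re (F y) * complex.Re (F1 y) +
                  complex.Im (F y) * complex.Im (F1 y)) + 2 * e * y.
apply: (@second_derivative_at_max _ f1 x _ _ _ Fmax).
  near=> y; have /cderivP[r i] : cderiv F y (F1 y) by near: y.
  apply: is_derive_eq.
  rewrite /f1 /GRing.scale /=; ring.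
have /cderivP[r i] := nbhs_singleton dF; have /cderivP[r1 i1] := dF1.
apply: is_derive_eq; rewrite /GRing.scale /= /sqnorm; ring.
Unshelve. all: by end_near. Qed.

Definition cplane (x y : R) : C := x +i* y.

Lemma cplaneE x y : cplane x y = x%:C + 'i%C * y%:C.
Proof. by rewrite /cplane; simpc. Qed.

Lemma continuous_sqradius : continuous (fun xy : R * R => xy.1 ^+ 2 + xy.2 ^+ 2).
Proof.
by move=> xy; apply: cvgD; apply: cvgM; first [exact: cvg_fst|exact: cvg_snd].
Qed.

(** The case [a = b] is the circle on which a bound for [g] is found in [holomorphic_line_zero]. *)
Lemma compact_annulus (a b : R) : 0 < b ->
  compact [set xy : R * R | a ^+ 2 <= xy.1 ^+ 2 + xy.2 ^+ 2 <= b ^+ 2].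
Proof.
move=> b0; apply: (@subclosed_compact _ _ (`[- b, b] `*` `[- b, b])).
- have -> : [set xy : R * R | a ^+ 2 <= xy.1 ^+ 2 + xy.2 ^+ 2 <= b ^+ 2] =
      (fun xy : R * R => xy.1 ^+ 2 + xy.2 ^+ 2) @^-1` `[a ^+ 2, b ^+ 2].
    by apply/seteqP; split=> xy; rewrite /= in_itv.
  apply: preimage_closed => [xy _|]; last exact: interval_closed.
  exact: continuous_sqradius.
- by apply: compact_setX; exact: segment_compact.
- move=> [x' y'] /andP[_]; rewrite /= => h; split; rewrite /= in_itv /= -ler_norml.
    rewrite -(ler_pXn2r (n:=2)) ?nnegrE ?(ltW b0)// real_normK ?num_real//.
    by apply: le_trans h; rewrite lerDl sqr_ge0.
  rewrite -(ler_pXn2r (n:=2)) ?nnegrE ?(ltW b0)// real_normK ?num_real//.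
  by apply: le_trans h; rewrite lerDr sqr_ge0.
Qed.

Lemma continuous_cline n (q v : 'rV[C]_n) :
  continuous (fun xy : R * R => q + cplane xy.1 xy.2 *: v).
Proof.
move=> xy; apply: cvgD; first exact: cvg_cst.
by apply: cvgZr_tmp; apply: cvg_ReIm; [exact: cvg_fst|exact: cvg_snd].
Qed.

Lemma continuous_sqnorm_cline n (V : set 'rV[C]_n) (G : 'rV[C]_n -> C) (q v : 'rV[C]_n) xy :
  smooth_on V G -> V (q + cplane xy.1 xy.2 *: v) ->
  {for xy, continuous (fun xy : R * R => sqnorm (G (q + cplane xy.1 xy.2 *: v)))}.
Proof.
move=> sG VL; have /differentiable_continuous cGL := smooth_differentiable sG VL.
have cGl := @cvg_comp _ _ _ (fun xy : R * R => q + cplane xy.1 xy.2 *: v) G _ _ _ (@continuous_cline _ q v xy) cGL.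
by apply: cvgD; apply: cvgM; first [exact: (cvg_Re cGl)|exact: (cvg_Im cGl)].
Qed.

(* On the interior of the annulus the Laplacian of |G|^2 + e |z|^2 along the
   complex line is 4 |G'|^2 + 4 e > 0, so the maximum is on the boundary. *)
Lemma annulus_max n (V : set 'rV[C]_n) (G : 'rV[C]_n -> C) (q v : 'rV[C]_n)
    (a b M : R) : open V -> smooth_on V G -> 0 < a -> a < b -> 0 <= M ->
  (forall x y, a ^+ 2 <= x ^+ 2 + y ^+ 2 <= b ^+ 2 -> V (q + cplane x y *: v)) ->
  (forall x y, x ^+ 2 + y ^+ 2 = a ^+ 2 -> G (q + cplane x y *: v) = 0) ->
  (forall x y, x ^+ 2 + y ^+ 2 = b ^+ 2 -> sqnorm (G (q + cplane x y *: v)) <= M) ->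
  forall x y, a ^+ 2 <= x ^+ 2 + y ^+ 2 <= b ^+ 2 ->
    sqnorm (G (q + cplane x y *: v)) <= M.
Proof.
move=> oV sG a0 ab M0 VA Ga Gb x y xyA.
have b0 : 0 < b by exact: lt_trans ab.
(* With this [e] the perturbation [e * r2] is at most [e'] on the annulus. *)
apply/ler_addgt0Pl => e' e'0; pose e := e' / b ^+ 2.
have e0 : 0 < e by rewrite divr_gt0// exprn_gt0.
have -> : e' = e * b ^+ 2 by rewrite divfK// gt_eqF// exprn_gt0.
pose L (xy : R * R) := q + cplane xy.1 xy.2 *: v.
pose r2 (xy : R * R) := xy.1 ^+ 2 + xy.2 ^+ 2.
pose A : set (R * R) := [set xy | a ^+ 2 <= r2 xy <= b ^+ 2].
have cr2 : continuous r2 by exact: continuous_sqradius.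
have cL : continuous L by exact: continuous_cline.
have cA : compact A by exact: compact_annulus.
pose u (xy : R * R) := sqnorm (G (L xy)) + e * r2 xy.
have cu : {within A, continuous u}.
  apply: continuous_in_subspaceT => xy; rewrite in_setE => Axy.
  apply: cvgD; last by apply: cvgM; [exact: cvg_cst|exact: cr2].
  exact: (continuous_sqnorm_cline sG (VA xy.1 xy.2 Axy)).
have [[x0 y0]] := @compact_EVT_max _ _ u A (ex_intro _ (x, y) xyA) cA cu.
rewrite in_setE => A0 umax.
have {umax} umax xy : A xy -> u xy <= u (x0, y0) by move=> Axy; apply: umax; rewrite in_setE.
have u0 : u (x0, y0) <= M + e * b ^+ 2.
  have [ra|ra] := eqVneq (r2 (x0, y0)) (a ^+ 2).
    rewrite /u ra /L /= Ga// /sqnorm /= expr0n /= !add0r.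
    by rewrite ler_wpDl// ler_wpM2l ?(ltW e0)// ler_pXn2r ?nnegrE ?(ltW a0) ?(ltW b0) ?(ltW ab).
  have [rb|rb] := eqVneq (r2 (x0, y0)) (b ^+ 2).
    by rewrite /u rb lerD2r; exact: Gb.
  have {ra rb} /andP[ra rb] : a ^+ 2 < r2 (x0, y0) < b ^+ 2.
    by case/andP: A0 => h1 h2; rewrite !lt_neqAle h1 h2 rb eq_sym ra.
  have nA : \forall xy \near ((x0, y0) : R * R), A xy.
    near=> xy; apply/andP; split; apply: ltW; near: xy.
      exact: (cvgr_gt _ (cr2 (x0, y0)) _ ra).
    exact: (cvgr_lt _ (cr2 (x0, y0)) _ rb).
  have [[P Q] /= [nP nQ] PQ] := nA.
  have nAx : \forall x' \near x0, A (x', y0).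
    by near=> x'; apply: PQ; split=> /=; [near: x'; exact: nP|exact: nbhs_singleton nQ].
  have nAy : \forall y' \near y0, A (x0, y').
    by near=> y'; apply: PQ; split=> /=; [exact: nbhs_singleton nP|near: y'; exact: nQ].
  pose G1 := fun p => 'D_v G p; pose G2 := fun p => 'D_v G1 p.
  have sG1 : smooth_on V G1 by exact: smooth_derive.
  have Lx (x' y' : R) : L (x', y') = (q + ('i%C * y'%:C) *: v) + x'%:C *: v.
    by rewrite /L /= cplaneE scalerDl addrA addrAC.
  have Ly (x' y' : R) : L (x', y') = (q + x'%:C *: v) + y'%:C *: ('i%C *: v).
    by rewrite /L /= cplaneE scalerDl addrA scalerA [y'%:C * _]mulrC.
  have dx H (x' y' : R) : smooth_on V H -> A (x', y') ->
      cderiv (fun x => H (L (x, y'))) x' ('D_v H (L (x', y'))).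
    move=> sH Axy; rewrite Lx; under eq_fun do rewrite Lx.
    by apply: cderiv_line; rewrite -Lx; exact: smooth_differentiable sH (VA _ _ Axy).
  have dy H (x' y' : R) : smooth_on V H -> A (x', y') ->
      cderiv (fun y => H (L (x', y))) y' ('i%C * 'D_v H (L (x', y'))).
    move=> sH Axy; have dH := smooth_differentiable sH (VA _ _ Axy).
    rewrite -deriveZv// Ly; under eq_fun do rewrite Ly.
    by apply: cderiv_line; rewrite -Ly.
  have h1 : 2 * (sqnorm (G1 (L (x0, y0))) + complex.Re (G (L (x0, y0))) * complex.Re (G2 (L (x0, y0))) +
       complex.Im (G (L (x0, y0))) * complex.Im (G2 (L (x0, y0)))) + 2 * e <= 0.
    apply: (@sqnorm_second_derivative (fun x => G (L (x, y0))) (fun x => G1 (L (x, y0))) x0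
      (G2 (L (x0, y0))) e (y0 ^+ 2)).
    - by near=> x'; apply: dx => //; near: x'.
    - exact: dx.
    - by near=> x'; apply: (umax (x', y0)); near: x'.
  have h2 : 2 * (sqnorm ('i%C * G1 (L (x0, y0))) + complex.Re (G (L (x0, y0))) * complex.Re ('i%C * ('i%C * G2 (L (x0, y0)))) +
       complex.Im (G (L (x0, y0))) * complex.Im ('i%C * ('i%C * G2 (L (x0, y0))))) + 2 * e <= 0.
    apply: (@sqnorm_second_derivative (fun y => G (L (x0, y))) (fun y => 'i%C * G1 (L (x0, y))) y0
      ('i%C * ('i%C * G2 (L (x0, y0)))) e (x0 ^+ 2)).
    - by near=> y'; apply: dy => //; near: y'.
    - by apply: cderivZ; exact: dy.
    - near=> y'; rewrite [_ ^+ 2 + x0 ^+ 2]addrC [X in _ <= _ + _ * X]addrC.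
      by apply: (umax (x0, y')); near: y'.
  (* The second derivative in the imaginary direction carries the factor i^2 = -1, so the terms with
     [G2] cancel in the sum of [h1] and [h2], leaving 4 |G1|^2 + 4 e <= 0. *)
  exfalso; move: h1 h2; rewrite sqnormM; have := sqnorm_ge0 (G1 (L (x0, y0))).
  move: (G1 _) (G2 _) (G _) => g1 [r2' i2'] g; rewrite /sqnorm /=.
  by move: e0; lra.
apply: le_trans (_ : u (x, y) <= _); first by rewrite /u lerDl mulr_ge0 ?(ltW e0)// addr_ge0 ?sqr_ge0.
rewrite addrC; apply: le_trans u0; exact: umax.
Unshelve. all: by end_near. Qed.

(** On the line q + z v, [g] vanishes for |z| <= a and |g|^2 is at most M for |z| = 3/2. The
    quotient g / z^m is then 0 on the inner circle and of squared modulus at most M / (9/4)^m on the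
    outer one; by [annulus_max] the latter bounds |g w|^2 at z = 1, for every m. The radius 3/2 only
    has to exceed 1. *)
Lemma holomorphic_line_zero n (V : set 'rV[C]_n) (g : 'rV[C]_n -> C) (q w : 'rV[C]_n) :
  open V -> smooth_on V g -> (\forall p \near q, g p = 0) ->
  (forall x y, x ^+ 2 + y ^+ 2 <= (3 / 2) ^+ 2 -> V (q + cplane x y *: (w - q))) ->
  g w = 0.
Proof.
move=> oV sg g0 VL; have [<-|qw] := eqVneq q w; first exact: nbhs_singleton g0.
set v := w - q in VL *.
have [j vj] : exists j, v 0 j != 0.
  apply/existsP; rewrite -negb_forall; apply: contra qw => /forallP v0.
  rewrite -subr_eq0 -opprB oppr_eq0; apply/eqP/rowP => j.
  by rewrite [RHS]mxE; exact/eqP.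
pose b : R := 3 / 2.
have b0 : 0 < b by rewrite /b; lra.
pose L (p : 'rV[C]_n) := (p 0 j - q 0 j) * (v 0 j)^-1.
have Lv z : L (q + z *: v) = z.
  rewrite /L (_ : (q + z *: v) 0 j = q 0 j + z * v 0 j); last by rewrite mxE [X in _ + X]mxE.
  by rewrite addrC addKr mulfK.
have sL U : open U -> smooth_on U L.
  move=> oU.
  have D := smoothD oU (@smooth_coord C n U j) (@smooth_cst C n U (- q 0 j)).
  exact: smoothM oU D (@smooth_cst C n U (v 0 j)^-1).
have cL : continuous L.
  by move=> p; exact: differentiable_continuous (smooth_differentiable (sL _ openT) I).
pose V' := V `&` [set p | L p != 0].
have oV' : open V'.
  apply: openI => //; rewrite openE => p /= Lp.
  exact: (cvgr_neq0 _ (cL p) Lp).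
have sg' : smooth_on V' g by apply: subset_smooth sg => p [].
pose G m (p : 'rV[C]_n) := g p * (L p)^-1 ^+ m.
have sG m : smooth_on V' (G m).
  have L0 p : V' p -> L p != 0 by case.
  exact: (smoothM oV' sg' (smoothX m oV' (smoothV oV' L0 (sL _ oV')))).
have [a [a0 a1 ga]] : exists a : R, [/\ 0 < a, a < 1 &
    forall x y, x ^+ 2 + y ^+ 2 <= a ^+ 2 -> g (q + cplane x y *: v) = 0].
  have cl0 := @continuous_cline n q v (0, 0).
  have [[A B] /= [/nbhs_ballP[r1 /= r10 h1] /nbhs_ballP[r2 /= r20 h2]] hAB] :
      \forall xy \near ((0, 0) : R * R), g (q + cplane xy.1 xy.2 *: v) = 0.
    have q0 : q + cplane 0 0 *: v = q by rewrite -[cplane 0 0]/(0 : C) scale0r addr0.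
    have g0' : nbhs (q + cplane 0 0 *: v) [set p | g p = 0] by rewrite q0; exact: g0.
    exact: (cl0 _ g0').
  have m0 : 0 < Num.min 1 (Num.min r1 r2) by rewrite !lt_min ltr01 r10 r20.
  exists (Num.min 1 (Num.min r1 r2) / 2); set a := _ / 2.
  have a0 : 0 < a by rewrite divr_gt0.
  have : a < Num.min 1 (Num.min r1 r2) by rewrite gtr_pMr// invf_lt1// ltr1n.
  rewrite !lt_min => /and3P[a1 ar1 ar2]; split=> // x y xya.
  have xa (z : R) : z ^+ 2 <= x ^+ 2 + y ^+ 2 -> `|z| <= a.
    move=> zle; rewrite -(ler_pXn2r (n:=2)) ?nnegrE ?(ltW a0)// real_normK ?num_real//.
    exact: le_trans xya.
  apply: (hAB (x, y)); split; [apply: h1|apply: h2]; rewrite /ball /= sub0r normrN.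
    by apply: le_lt_trans ar1; apply: xa; rewrite lerDl sqr_ge0.
  by apply: le_lt_trans ar2; apply: xa; rewrite lerDr sqr_ge0.
have ab : a < b by apply: lt_trans a1 _; rewrite /b; lra.
have [M M0 gM] : exists2 M : R, 0 <= M & forall x y, x ^+ 2 + y ^+ 2 = b ^+ 2 ->
    sqnorm (g (q + cplane x y *: v)) <= M.
  have cA := @compact_annulus b b b0.
  have ne : [set xy : R * R | b ^+ 2 <= xy.1 ^+ 2 + xy.2 ^+ 2 <= b ^+ 2] !=set0.
    by exists (b, 0); rewrite /= expr0n addr0 lexx.
  have cu : {within [set xy : R * R | b ^+ 2 <= xy.1 ^+ 2 + xy.2 ^+ 2 <= b ^+ 2],
      continuous (fun xy : R * R => sqnorm (g (q + cplane xy.1 xy.2 *: v)))}.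
    apply: continuous_in_subspaceT => xy; rewrite in_setE => /andP[_ xyb].
    exact: (continuous_sqnorm_cline sg (VL xy.1 xy.2 xyb)).
  have [c _ cmax] := compact_EVT_max ne cA cu.
  exists (sqnorm (g (q + cplane c.1 c.2 *: v))); first exact: sqnorm_ge0.
  by move=> x y xyb; apply: (cmax (x, y)); rewrite in_setE /= xyb lexx.
have bound m : sqnorm (g w) * (b ^+ 2) ^+ m <= M.
  have := @annulus_max n V' (G m) q v a b (M / (b ^+ 2) ^+ m) oV' (sG m) a0 ab.
  have sqX z k : sqnorm (z ^+ k) = sqnorm z ^+ k.
    by elim: k => [|k IH]; rewrite ?expr0 ?exprS ?sqnormM ?IH// /sqnorm /= expr0n expr1n addr0.
  have sqV z : sqnorm z^-1 = (sqnorm z)^-1.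
    by rewrite !sqnorm_normc normcV exprVn.
  move=> /(_ _ _ _ _ 1 0) H.
  rewrite -ler_pdivlMr ?exprn_gt0//.
  have -> : sqnorm (g w) = sqnorm (G m (q + cplane 1 0 *: v)).
    rewrite /G Lv (_ : cplane 1 0 = 1)// scale1r /v addrC subrK.
    by rewrite invr1 expr1n mulr1.
  apply: H.
  - by rewrite divr_ge0// exprn_ge0// exprn_ge0// ltW.
  - move=> x y /andP[h1 h2]; split; first exact: VL.
    rewrite /= Lv; apply/eqP => -[x0 y0]; move: h1; rewrite x0 y0 expr0n addr0 leNgt.
    by rewrite exprn_gt0.
  - by move=> x y xya; rewrite /G ga ?xya// mul0r.
  - move=> x y xyb; rewrite /G sqnormM sqX sqV Lv.
    rewrite {2}/sqnorm /= xyb exprVn ler_wpM2r ?invr_ge0 ?exprn_ge0 ?exprn_ge0 ?(ltW b0)//.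
    exact: gM.
  - by rewrite expr1n expr0n /= addr0 /b; apply/andP; split; [rewrite expr_le1// ltW|lra].
apply: sqnorm_eq0; apply/eqP; rewrite eq_le sqnorm_ge0 andbT leNgt; apply/negP => s0.
have := archi_boundP (divr_ge0 M0 (ltW s0)); set m := Num.bound _ => Mm.
have := bound m; apply/negP; rewrite -ltNge mulrC -ltr_pdivrMr//.
apply: lt_le_trans Mm _.
(* [b ^+ 2] is 9/4 and so at least 2, and 2^m exceeds m. *)
apply: (@le_trans _ _ (2 ^+ m)).
  by rewrite -natrX ler_nat ltnW// ltn_expl.
by apply: lerXn2r; rewrite ?nnegrE// /b; lra.
Qed.

(** The interior [Z] of the zero set is open; it is also closed in [V], since a point [q] of [Z]
    close to a limit point is joined to all points of a ball around the latter by complex lines to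
    which [holomorphic_line_zero] applies. *)
Lemma identity_theorem n (V W : set 'rV[C]_n) (g : 'rV[C]_n -> C) :
  open V -> connected V -> holomorphic_on V g ->
  open W -> W !=set0 -> W `<=` V -> (forall p, W p -> g p = 0) ->
  forall p, V p -> g p = 0.
Proof.
move=> oV cV sg oW [w Ww] WV gW.
pose Z : set 'rV[C]_n := [set p | \forall q \near p, g q = 0].
have oZ : open Z.
  by rewrite openE => p /= Zp; rewrite /interior; exact: (near_join Zp).
suff -> : V = V `&` Z by move=> p [_ /nbhs_singleton].
apply/esym/cV.
- exists w; split; first exact: WV.
  by near=> q; apply: gW; near: q; exact: open_nbhs_nbhs.
- by exists Z.
exists (closure Z); first exact: closed_closure.
apply/seteqP; split=> p [Vp Zp]; split=> //; first exact: subset_closure.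
have /nbhs_ballP[r0 /= r00 pV] : nbhs p V by exact: open_nbhs_nbhs.
(* [q] lies within [r] of [p], and [x0 - q] has norm at most 2 r; the disc of radius 3/2 on their
   line therefore stays within r + (3/2) 2 r = r0 of [p]. *)
pose r := r0 / 4.
have rp : 0 < r by rewrite divr_gt0.
have [q [Zq pq]] := Zp _ (nbhsx_ballx p r rp).
have {}pq : `|p - q| < r by move: pq; rewrite -ball_normE.
apply: filterS (nbhsx_ballx p r rp) => x0; rewrite -ball_normE /= => px.
apply: (holomorphic_line_zero oV sg Zq) => x y xy; apply: pV.
rewrite -ball_normE /= opprD addrA.
have -> : r0 = r + (3 / 2) * (r + r) by rewrite /r; field.
apply: le_lt_trans (ler_normB _ _) _; apply: ltr_leD => //.
rewrite normrZ; apply: ler_pM => //.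
  rewrite normcE -[3 / 2](_ : (3 / 2 : R)%:C = _); last by rewrite rmorphM fmorphV !rmorph_nat.
  rewrite lecR -(ler_pXn2r (n:=2)) ?nnegrE ?normc_ge0 ?divr_ge0//.
  by rewrite -sqnorm_normc.
have -> : x0 - q = (p - q) - (p - x0) by rewrite opprB [RHS]addrC addrA subrK.
by apply: le_trans (ler_normB _ _) _; apply: lerD; exact: ltW.
Unshelve. all: by end_near. Qed.

End IdentityTheorem.

(** * Differentiation under the integral sign *)

Lemma coord_norm_le (K : numDomainType) m n (x : 'M[K]_(m, n)) i j :
  `|x i j| <= mx_norm x.
Proof.
rewrite mx_normE.
exact: (@le_bigmax _ _ _ (0%:nng : {nonneg K})
  (fun ij : 'I_m * 'I_n => `|x ij.1 ij.2|%:nng : {nonneg K}) (i, j)).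
Qed.

Lemma differentiable_of_approx (K : numFieldType) (V W : normedModType K)
    (f : V -> W) (p : V) (df : {linear V -> W}) : continuous df ->
  (forall e, 0 < e -> \forall v \near (0 : V),
    `|f (p + v) - f p - df v| <= e * `|v|) ->
  differentiable f p /\ 'd f p = df :> (V -> W).
Proof.
move=> dfc fa.
have fE : f \o shift p = cst (f p) + df +o_ 0 id.
  apply/eqaddoP => e e0; apply: filterS (fa e e0) => v; rewrite /= !fctE /=.
  by rewrite [v + p]addrC opprD addrA.
have df_diff := diff_unique dfc fE.
by split=> //; apply/diff_locallyP; rewrite df_diff.
Qed.

Section CubeContinuity.
Variable R : realType.
Local Notation C := R[i].

Lemma unit_cube_compact n : compact (@unit_cube R n).
Proof.
have cK := @rV_compact R n (fun=> `[0, 1]%classic) (fun=> @segment_compact _ 0 1).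
suff E : [set v : 'rV[R]_n | forall i, `[0, 1]%classic (v ord0 i)] = @unit_cube R n.
  by rewrite E in cK.
by apply/seteqP; split=> v h j; have := h j; rewrite /= in_itv.
Qed.

(** Compactness of the cube: a property that holds for nearby points and eventually in [F], around
    each point, holds eventually in [F] for the whole cube at once. *)
Lemma unit_cube_near_covering n (T : Type) (F : set_system T)
    (P : T -> 'rV[R]_n -> Prop) : Filter F ->
  (forall t, unit_cube t -> \forall t' \near t & i \near F, P i t') ->
  \forall i \near F, forall t, unit_cube t -> P i t.
Proof.
move=> FF h; exact: (iffLR (compact_near_coveringP _) (@unit_cube_compact n) _ _ _ FF h).
Qed.

Lemma continuous_ucont n (f : 'rV[R]_n -> R) :
  (forall t, unit_cube t -> {for t, continuous f}) -> ucont f.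
Proof.
move=> cf e e0.
have e2 : 0 < e / 2 by rewrite divr_gt0.
have : \forall d \near (0 : R)^'+, forall t, unit_cube t ->
    forall u : 'rV[R]_n, (forall j, `|t 0 j - u 0 j| < d) -> `|f t - f u| < e.
  apply: (@unit_cube_near_covering n R (0 : R)^'+ (fun (d : R) (t : 'rV[R]_n) =>
    forall u : 'rV[R]_n, (forall j, `|t 0 j - u 0 j| < d) -> `|f t - f u| < e)) => t tc.
  have /cvgrPdist_lt/(_ _ e2)/nbhs_ballP[r /= r0 hr] := cf t tc.
  have r2 : 0 < r / 2 by rewrite divr_gt0.
  exists (ball t (r / 2), [set d : R | d < r / 2]).
    by split; [exact: nbhsx_ballx|exact: nbhs_right_lt].
  move=> [t' d] /= [tt' dr] u tu.
  rewrite (splitr e) -[f t' - f u](subrKA (f t)) -[f t' - f t]opprB addrC.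
  apply: le_lt_trans (ler_normB _ _) _; apply: ltrD.
    apply: hr; split=> // i j; rewrite (ord1 i) /ball /= (splitr r).
    rewrite -[t 0 j - u 0 j](subrKA (t' 0 j)); apply: le_lt_trans (ler_normD _ _) _.
    apply: ltrD; first by have := tt'.2 0 j.
    exact: lt_trans (tu j) dr.
  apply: hr; split=> // i j; rewrite (ord1 i) /ball /=; have := tt'.2 0 j; rewrite /ball /= => /lt_trans.
  by apply; rewrite gtr_pMr// invf_lt1// ltr1n.
move=> H; near (0 : R)^'+ => d; exists d => [|t u tc _ tu].
  by near: d; exact: nbhs_right_gt.
have Hd : forall t, unit_cube t ->
    forall u : 'rV[R]_n, (forall j, `|t 0 j - u 0 j| < d) -> `|f t - f u| < e by near: d.
exact: Hd tu.
Unshelve. all: by end_near. Qed.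

Definition ucontC n (f : 'rV[R]_n -> C) : Prop :=
  ucont (fun t => complex.Re (f t)) /\ ucont (fun t => complex.Im (f t)).

Lemma continuous_ucontC n (f : 'rV[R]_n -> C) :
  (forall t, unit_cube t -> {for t, continuous f}) -> ucontC f.
Proof.
move=> cf; split; apply: continuous_ucont => t tc; first exact: (cvg_Re (cf t tc)).
exact: (cvg_Im (cf t tc)).
Qed.

Lemma ucontCD n (f g : 'rV[R]_n -> C) : ucontC f -> ucontC g ->
  ucontC (fun t => f t + g t).
Proof.
move=> [f1 f2] [g1 g2]; split.
  by under eq_fun do rewrite ReD; exact: ucontD.
by under eq_fun do rewrite ImD; exact: ucontD.
Qed.

Lemma ReM (z w : C) : complex.Re (z * w) =
  complex.Re z * complex.Re w - complex.Im z * complex.Im w.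
Proof. by case: z w => a b []. Qed.

Lemma ImM (z w : C) : complex.Im (z * w) =
  complex.Re z * complex.Im w + complex.Im z * complex.Re w.
Proof. by case: z w => a b []. Qed.

Lemma ucontCZ n c (f : 'rV[R]_n -> C) : ucontC f -> ucontC (fun t => c * f t).
Proof.
move=> [f1 f2]; split.
  by under eq_fun do rewrite ReM; apply: ucontB; exact: ucontZ.
by under eq_fun do rewrite ImM; apply: ucontD; exact: ucontZ.
Qed.

Lemma ucontC_sum n (I : Type) (r : seq I) (P : pred I) (f : I -> 'rV[R]_n -> C) :
  (forall i, P i -> ucontC (f i)) -> ucontC (fun t => \sum_(i <- r | P i) f i t).
Proof.
move=> cf; elim: r => [|i r IH].
  have -> : (fun t => \sum_(i <- [::] | P i) f i t) = fun=> 0.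
    by apply/funext => t; rewrite big_nil.
  by split=> e e0; exists 1 => // t u _ _ _; rewrite subrr normr0.
have -> : (fun t => \sum_(i <- i :: r | P i) f i t) =
    fun t => if P i then f i t + \sum_(i <- r | P i) f i t
             else \sum_(i <- r | P i) f i t.
  by apply/funext => p; rewrite big_cons.
by case Pi: (P i) => //; apply: ucontCD => //; exact: cf.
Qed.

Lemma eq_cube_integral n (f g : 'rV[R]_n -> C) :
  (forall t, unit_cube t -> f t = g t) -> cube_integral f = cube_integral g.
Proof.
by move=> fg; congr (_ +i* _); apply: eq_cube_Rintegral => t tc; rewrite fg.
Qed.

Lemma cube_integralD n (f g : 'rV[R]_n -> C) : ucontC f -> ucontC g ->
  cube_integral (fun t => f t + g t) = cube_integral f + cube_integral g.
Proof.
move=> [f1 f2] [g1 g2]; apply: complex_eqP; rewrite ?ReD ?ImD /=.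
  by under eq_fun do rewrite ReD; exact: cube_RintegralD.
by under eq_fun do rewrite ImD; exact: cube_RintegralD.
Qed.

Lemma cube_integralZ n c (f : 'rV[R]_n -> C) : ucontC f ->
  cube_integral (fun t => c * f t) = c * cube_integral f.
Proof.
move=> [f1 f2]; apply: complex_eqP; rewrite ?ReM ?ImM /=.
  under eq_fun do rewrite ReM.
  by rewrite cube_RintegralB ?cube_RintegralZ//; exact: ucontZ.
under eq_fun do rewrite ImM.
by rewrite cube_RintegralD ?cube_RintegralZ//; exact: ucontZ.
Qed.

Lemma ucontCB n (f g : 'rV[R]_n -> C) : ucontC f -> ucontC g ->
  ucontC (fun t => f t - g t).
Proof.
move=> cf /(ucontCZ (-1)) /(ucontCD cf).
by congr ucontC; apply/funext => t; rewrite mulN1r.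
Qed.

Lemma cube_integralB n (f g : 'rV[R]_n -> C) : ucontC f -> ucontC g ->
  cube_integral (fun t => f t - g t) = cube_integral f - cube_integral g.
Proof.
move=> cf cg; rewrite -mulN1r -cube_integralZ// -cube_integralD//.
  by congr cube_integral; apply/funext => t; rewrite mulN1r.
exact: ucontCZ.
Qed.

Lemma cube_integral_sum n (I : Type) (r : seq I) (P : pred I) (f : I -> 'rV[R]_n -> C) :
  (forall i, P i -> ucontC (f i)) ->
  cube_integral (fun t => \sum_(i <- r | P i) f i t) =
  \sum_(i <- r | P i) cube_integral (f i).
Proof.
move=> cf; elim: r => [|i r IH].
  rewrite big_nil.
  have -> : (fun t => \sum_(i <- [::] | P i) f i t) = fun t => 0 * (fun=> 0) t.
    by apply/funext => t; rewrite big_nil mul0r.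
  rewrite cube_integralZ ?mul0r//.
  by split=> e e0; exists 1 => // t u _ _ _; rewrite subrr normr0.
rewrite big_cons.
have -> : (fun t => \sum_(i <- i :: r | P i) f i t) =
    fun t => if P i then f i t + \sum_(i <- r | P i) f i t
             else \sum_(i <- r | P i) f i t.
  by apply/funext => p; rewrite big_cons.
case Pi: (P i) => //; rewrite cube_integralD ?IH//; first exact: cf.
exact: ucontC_sum.
Qed.

Lemma cube_integral0 n (f : 'rV[R]_n -> C) :
  (forall t, unit_cube t -> f t = 0) -> cube_integral f = 0.
Proof.
move=> f0; have -> : cube_integral f = cube_integral (fun _ : 'rV[R]_n => 0 * (1 : C)).
  by apply: eq_cube_integral => t tc; rewrite mul0r f0.
rewrite (@cube_integralZ n 0 (fun=> 1)) ?mul0r//.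
by split=> e e0; exists 1 => // t u _ _ _; rewrite subrr normr0.
Qed.

(** The factor 2 comes from bounding the real and the imaginary part separately. *)
Lemma cube_integral_bound n (f : 'rV[R]_n -> C) M : ucontC f ->
  (forall t, unit_cube t -> normc (f t) <= M) -> normc (cube_integral f) <= M + M.
Proof.
move=> [f1 f2] fM; apply: le_trans (normc_le _) _; apply: lerD => /=.
  apply: cube_Rintegral_bound => // t tc.
  by apply: le_trans (normc_Re _) _; exact: fM.
apply: cube_Rintegral_bound => // t tc.
by apply: le_trans (normc_Im _) _; exact: fM.
Qed.

Lemma differentiable_linear_approx n (f : 'rV[C]_n -> C) (p : 'rV[C]_n)
    (a : 'I_n -> C) :
  (forall e : R, 0 < e -> \forall v \near (0 : 'rV[C]_n),
    normc (f (p + v) - f p - \sum_w v 0 w * a w) <= e * \sum_w normc (v 0 w)) ->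
  differentiable f p /\ forall w, partial w f p = a w.
Proof.
move=> fa.
pose df (v : 'rV[C]_n) : C := \sum_w v 0 w * a w.
have df_lin : linear df.
  move=> c u v; rewrite /df scaler_sumr -big_split; apply: eq_bigr => w _ /=.
  by rewrite !mxE mulrDl -mulrA.
pose dfL : {linear 'rV[C]_n -> C} :=
  HB.pack df (GRing.isLinear.Build _ _ _ _ df df_lin).
have dfc : continuous dfL.
  move=> v; apply: (@cvgC_sum _ _ (nbhs v)) => w _.
  have vc : (fun u : 'rV[C]_n => u 0 w) u @[u --> v] --> v 0 w by exact: coord_continuous.
  exact: (cvgC_mul vc (cvgC_cst (a w))).
have [|dfp df_diff] := @differentiable_of_approx C 'rV[C]_n C f p dfL dfc.
  move=> e e0.
  have eE : (complex.Re e)%:C = e by rewrite RRe_real// realE (ltW e0).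
  (* The sum of the moduli of the coordinates is at most [n] times the norm of [v]; [n.+1] keeps the
     denominator nonzero. *)
  have e'0 : 0 < complex.Re e / n.+1%:R by rewrite divr_gt0// -ltr0c eE.
  apply: filterS (fa _ e'0) => v H; rewrite normcE.
  rewrite -eE -[X in _ <= _ * X]RRe_real ?normr_real// -rmorphM lecR.
  apply: le_trans H _.
  have nv w : normc (v 0 w) <= complex.Re `|v|.
    rewrite -lecR -normcE RRe_real ?normr_real//.
    exact: coord_norm_le.
  have vv : 0 <= complex.Re `|v| by rewrite -ler0c RRe_real ?normr_real.
  apply: (@le_trans _ _ (complex.Re e / n.+1%:R * (complex.Re `|v| *+ n))).
    rewrite ler_wpM2l ?(ltW e'0)//; apply: le_trans (ler_sum _ (fun w _ => nv w)) _.
    by rewrite sumr_const card_ord.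
  rewrite -mulrA ler_wpM2l//; first by rewrite -ler0c eE ltW.
  by rewrite -[complex.Re _ *+ n]mulr_natl mulrA ler_piMl// ler_pdivrMl// mulr1 ler_nat.
split=> // w; rewrite /partial deriveE// df_diff /= /df (bigD1 w)//= big1.
  by rewrite mxE !eqxx mul1r addr0.
by move=> j jw; rewrite mxE (negbTE jw) andbF mul0r.
Qed.

End CubeContinuity.

Section SmoothCubes.
Variable R : realType.
Local Notation C := R[i].

Lemma cvgC_det (T : Type) (F : set_system T) {FF : Filter F} n
    (M : T -> 'M[C]_n) (M0 : 'M[C]_n) :
  (forall i j, M t i j @[t --> F] --> M0 i j) ->
  \det (M t) @[t --> F] --> \det M0.
Proof.
move=> cM; apply: cvgC_sum => s _; apply: (cvgC_mul (cvgC_cst _)).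
by apply: cvgC_prod => i _; exact: cM.
Qed.

Lemma complex_ReIm (z : C) : z = complex.Re z +i* complex.Im z.
Proof. by case: z. Qed.

Lemma smooth_continuous n (g : 'rV[R]_n -> R) : smooth_on setT g -> continuous g.
Proof.
move=> sg t; apply: differentiable_continuous; exact: smooth_differentiable sg I.
Qed.

Lemma smooth_cube_cvg n N (sg : 'rV[R]_n -> 'rV[C]_N) :
  (forall j, smooth_on setT (fun t => complex.Re (sg t 0 j)) /\
             smooth_on setT (fun t => complex.Im (sg t 0 j))) ->
  forall t j, sg u 0 j @[u --> t] --> sg t 0 j.
Proof.
move=> ssg t j; have [/smooth_continuous cr /smooth_continuous ci] := ssg j.
have H := cvg_ReIm (cr t) (ci t).
have E : (fun u => complex.Re (sg u 0 j) +i* complex.Im (sg u 0 j)) = fun u => sg u 0 j.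
  by apply/funext => u; rewrite -complex_ReIm.
rewrite E -complex_ReIm in H; exact: H.
Qed.

Lemma cube_jacobian_cvg N (sg : 'rV[R]_N -> 'rV[C]_N) : smooth_cube sg ->
  forall t i j, cube_jacobian sg u i j @[u --> t] --> cube_jacobian sg t i j.
Proof.
move=> ssg t i j; have [sr si] := ssg j.
have cr := smooth_continuous (smooth_partial i sr).
have ci := smooth_continuous (smooth_partial i si).
have H := cvg_ReIm (cr t) (ci t).
have E : (fun u => partial i (fun u => complex.Re (sg u 0 j)) u +i*
    partial i (fun u => complex.Im (sg u 0 j)) u) = fun u => cube_jacobian sg u i j.
  by apply/funext => u; rewrite mxE.
by rewrite E in H; rewrite [cube_jacobian sg t i j]mxE; exact: H.
Qed.

End SmoothCubes.
Arguments smooth_cube_cvg {R n N sg} _ t j.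
Arguments cube_jacobian_cvg {R N sg} _ t i j.

(** * The fibre integral and its derivatives in the parameters *)

Section Fibre.
Variables (R : realType) (N k n : nat) (A : finType).
Local Notation C := R[i].
Variables (blk : A -> 'I_k) (al : A -> 'I_N -> nat) (ind : 'I_n -> A).
Hypothesis ind_inj : injective ind.
Variables (lam : 'I_k -> C -> C) (lam_log : forall l, log_branch (lam l)).
Variable ga : chain R N.
Implicit Types (x : 'rV[C]_N) (p v : 'rV[C]_n) (z : 'I_k -> C) (e : 'I_N -> int).

Definition monomial x (b : 'I_N -> nat) : C := \prod_j x 0 j ^+ b j.

Definition lmonomial x (e : 'I_N -> int) : C := \prod_j x 0 j ^ e j.

(* The variable p_w multiplies the monomial ind w; other monomials have
   coefficient 1. *)
Definition coef p (a : A) : C := \prod_(w | ind w == a) p 0 w.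

(** The constant term s_l is one of the monomials, with exponent 0 and a parameter as coefficient;
    thus s and s' are treated alike. *)
Definition fpoly x p (l : 'I_k) : C :=
  \sum_(a | blk a == l) coef p a * monomial x (al a).

Definition integrand z e x p : C :=
  cpower lam (fun l => - z l - 1) (fpoly x p) * lmonomial x e.

Definition integral z e p : C := chain_integral ga (fun x => integrand z e x p).

(** The part of [admissible_parameters] that involves the points of the chain. The boundary
    condition is independent of [p] and is kept apart for Stokes' theorem. *)
Definition good p : Prop :=
  [/\ forall c, smooth_cube (chain_cube ga c),
      forall c t j, unit_cube t -> chain_cube ga c t 0 j != 0 &
      forall c t l, unit_cube t -> complex.Re (fpoly (chain_cube ga c t) p l) < 0].

Lemma coef_ind p w : coef p (ind w) = p 0 w.
Proof.
rewrite /coef (bigD1 w)//= big1 ?mulr1// => w' /andP[/eqP /ind_inj ->].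
by rewrite eqxx.
Qed.

Lemma coef_notin p a : (forall w, ind w != a) -> coef p a = 1.
Proof. by move=> na; apply: big_pred0 => w; exact: negbTE. Qed.

(** Since [ind] is injective, each coefficient contains at most one parameter; [fpoly] is affine in
    [p] and its increment has no error term. *)
Lemma fpolyD x p v l : fpoly x (p + v) l - fpoly x p l =
  \sum_(w | blk (ind w) == l) v 0 w * monomial x (al (ind w)).
Proof.
rewrite /fpoly -sumrB.
have -> : \sum_(a | blk a == l)
      (coef (p + v) a * monomial x (al a) - coef p a * monomial x (al a)) =
    \sum_(a | (blk a == l) && [exists w, ind w == a])
      (coef (p + v) a - coef p a) * monomial x (al a).
  rewrite [LHS](bigID (fun a => [exists w, ind w == a])) /= [X in _ + X]big1.
    by rewrite addr0; apply: eq_bigr => a _; rewrite mulrBl.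
  by move=> a /andP[_ /existsPn na]; rewrite !coef_notin// subrr.
rewrite (eq_bigl (fun a => a \in [set ind w | w in [set w | blk (ind w) == l]]%SET)).
  rewrite big_imset /=; last by move=> w w' _ _; exact: ind_inj.
  under eq_bigl do rewrite inE.
  by apply: eq_bigr => w _; rewrite !coef_ind mxE [p 0 w + _]addrC addrK.
move=> a; apply/andP/imsetP => [[al0 /existsP[w /eqP wa]]|[w]].
  by exists w => //; rewrite inE wa.
by rewrite inE => wl ->; split=> //; apply/existsP; exists w.
Qed.

Section Limits.
Variables (T : Type) (F : set_system T).
Context {FF : Filter F}.
Variables (x : T -> 'rV[C]_N) (p : T -> 'rV[C]_n) (x0 : 'rV[C]_N) (p0 : 'rV[C]_n).
Hypothesis xc : forall j, x t 0 j @[t --> F] --> x0 0 j.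
Hypothesis pc : forall w, p t 0 w @[t --> F] --> p0 0 w.

Lemma cvg_monomial b : monomial (x t) b @[t --> F] --> monomial x0 b.
Proof. by apply: cvgC_prod => j _; apply: cvgC_expn; exact: xc. Qed.

Lemma cvg_lmonomial e : (forall j, x0 0 j != 0) ->
  lmonomial (x t) e @[t --> F] --> lmonomial x0 e.
Proof. by move=> x00; apply: cvgC_prod => j _; apply: cvgC_exprz; [exact: x00|exact: xc]. Qed.

Lemma cvg_fpoly l : fpoly (x t) (p t) l @[t --> F] --> fpoly x0 p0 l.
Proof.
apply: cvgC_sum => a _; apply: cvgC_mul; last exact: cvg_monomial.
by apply: cvgC_prod => w _; exact: pc.
Qed.

End Limits.

Lemma integrand_ucont z e p c : good p ->
  ucontC (fun t => integrand z e (chain_cube ga c t) p *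
                   \det (cube_jacobian (chain_cube ga c) t)).
Proof.
move=> [sg nz re]; apply: continuous_ucontC => t tc.
have cx := smooth_cube_cvg (sg c) t.
have cp w : (fun _ : 'rV[R]_N => p 0 w) u @[u --> t] --> p 0 w by exact: (@cvgC_cst R _ (nbhs t) _ (p 0 w)).
apply: (@cvgC_mul _ _ (nbhs t)); last first.
  by apply: (@cvgC_det _ _ (nbhs t)) => i j; exact: cube_jacobian_cvg.
apply: (@cvgC_mul _ _ (nbhs t)); last first.
  by apply: (@cvg_lmonomial _ (nbhs t)) => // j; exact: nz.
have rec l : complex.Re (fpoly (chain_cube ga c t) p l) < 0 by exact: re.
apply: (@cvg_cpower _ _ _ _ lam_log _ (nbhs t) _ (fun t => fpoly (chain_cube ga c t) p) _ rec) => l.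
exact: (@cvg_fpoly _ (nbhs t) _ _ (fun=> p)).
Qed.

(** The identity [cexp (lam w) = w] turns the unit shift of the exponent into a division by [fpoly],
    whichever branch [lam] is. *)
Lemma integrand_shift z e x p l0 b :
  (forall l, complex.Re (fpoly x p l) < 0) -> (forall j, x 0 j != 0) ->
  integrand (fun l => z l + (l == l0)%:R) (fun j => e j + Posz (b j)) x p =
  integrand z e x p / fpoly x p l0 * monomial x b.
Proof.
move=> re nz; rewrite /integrand.
have -> : lmonomial x (fun j => e j + Posz (b j)) = lmonomial x e * monomial x b.
  rewrite -big_split /=; apply: eq_bigr => j _.
  by rewrite expfzDr.
suff -> : cpower lam (fun l => - (z l + (l == l0)%:R) - 1) (fpoly x p) =
    cpower lam (fun l => - z l - 1) (fpoly x p) / fpoly x p l0.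
  by rewrite mulrA; congr (_ * _); rewrite mulrAC.
have [E0 _] := lam_log l0 (re l0); rewrite -[X in _ / X]E0.
rewrite -cexpN /cpower -!cexp_sum -cexpD; congr cexp.
rewrite (bigD1 l0)//= [in RHS](bigD1 l0)//= eqxx.
rewrite (_ : (- (z l0 + true%:R) - 1) * lam l0 (fpoly x p l0) =
  (- z l0 - 1) * lam l0 (fpoly x p l0) - lam l0 (fpoly x p l0)); last by rewrite mulr1n; ring.
rewrite [LHS]addrAC; congr (_ + _ - _).
by apply: eq_bigr => l /negbTE ->; rewrite addr0.
Qed.

Definition pullback z e p c t : C :=
  integrand z e (chain_cube ga c t) p * \det (cube_jacobian (chain_cube ga c) t).

Definition pullback_error z e p c v t : C :=
  pullback z e (p + v) c t - pullback z e p c t -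
  \sum_w v 0 w * ((- z (blk (ind w)) - 1) *
    pullback (fun l => z l + (l == blk (ind w))%:R)
      (fun j => e j + Posz (al (ind w) j)) p c t).

(** By compactness it suffices to work near a point [(t0, 0)]. There the increment of the power is
    exactly linear in the increments of [fpoly], with coefficients [cpower_slope] that converge to
    those of the derivative. *)
Lemma cube_integrand_approx z e p c (eps : R) : good p -> 0 < eps ->
  \forall v \near (0 : 'rV[C]_n), forall t, unit_cube t ->
    normc (pullback_error z e p c v t) <= eps * \sum_w normc (v 0 w).
Proof.
move=> [sg nz re] eps0; set sig := chain_cube ga c.
apply: (@unit_cube_near_covering R N _ (nbhs (0 : 'rV[C]_n)) (fun v t =>
  normc (pullback_error z e p c v t) <= eps * \sum_w normc (v 0 w))) => t0 tc.
pose F2 := filter_prod (nbhs t0) (nbhs (0 : 'rV[C]_n)).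
have FF2 : Filter F2 by exact: filter_prod_filter.
pose xx (tv : 'rV[R]_N * 'rV[C]_n) := sig tv.1.
pose py (tv : 'rV[R]_N * 'rV[C]_n) := p + tv.2.
pose x0 := sig t0.
have f1 : fst tv @[tv --> F2] --> t0 by exact: cvg_fst.
have f2 : snd tv @[tv --> F2] --> (0 : 'rV[C]_n) by exact: cvg_snd.
have cx j : xx tv 0 j @[tv --> F2] --> x0 0 j.
  exact: (@cvg_comp _ _ _ fst (fun t => sig t 0 j) _ _ _ f1 (smooth_cube_cvg (sg c) t0 j)).
have cp w : (fun _ : 'rV[R]_N * 'rV[C]_n => p 0 w) tv @[tv --> F2] --> p 0 w by exact: (@cvgC_cst R _ F2 _ (p 0 w)).
have cpy w : py tv 0 w @[tv --> F2] --> p 0 w.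
  have c0 : (fun tv : 'rV[R]_N * 'rV[C]_n => tv.2 0 w) tv @[tv --> F2] --> (0 : C).
    have H := @cvg_comp _ _ _ snd (fun v : 'rV[C]_n => v 0 w) _ _ _ f2 (@coord_continuous C 1 n 0 w 0).
    by rewrite mxE in H; exact: H.
  have H := cvgC_add (cp w) c0; rewrite addr0 in H.
  have E : (fun tv : 'rV[R]_N * 'rV[C]_n => p 0 w + tv.2 0 w) = fun tv => py tv 0 w.
    by apply/funext => tv; rewrite [RHS]mxE.
  by rewrite E in H; exact: H.
have rec l : complex.Re (fpoly x0 p l) < 0 by exact: re.
have xF l := @cvg_fpoly _ F2 FF2 xx (fun _ => p) x0 p cx cp l.
have yF l := @cvg_fpoly _ F2 FF2 xx py x0 p cx cpy l.
pose a l := - z l - 1.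
have eqn := @near_cpower_slope _ _ _ a lam_log _ F2 FF2
  (fun tv => fpoly (xx tv) p) (fun tv => fpoly (xx tv) (py tv)) _ rec xF yF.
have csl l := @cvg_cpower_slope _ _ _ a lam_log _ F2 FF2
  (fun tv => fpoly (xx tv) p) (fun tv => fpoly (xx tv) (py tv)) _ rec xF yF l.
have x0nz j : x0 0 j != 0 by exact: nz.
have cdet : (fun tv : 'rV[R]_N * 'rV[C]_n => \det (cube_jacobian sig tv.1)) tv @[tv --> F2] --> \det (cube_jacobian sig t0).
  apply: (@cvgC_det _ _ F2) => i j.
  exact: (@cvg_comp _ _ _ fst (fun t => cube_jacobian sig t i j) _ _ _ f1
    (cube_jacobian_cvg (sg c) t0 i j)).
have cint : integrand z e (xx tv) p @[tv --> F2] --> integrand z e x0 p.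
  apply: (@cvgC_mul _ _ F2); last exact: (@cvg_lmonomial _ F2 FF2 xx).
  exact: (@cvg_cpower _ _ _ a lam_log _ F2 FF2 (fun tv => fpoly (xx tv) p) _ rec xF).
(* [v 0 w * g w] is the exact contribution of the parameter [w] to the increment and [v 0 w * h w]
   its linear part; [g w] and [h w] have the same limit at [(t0, 0)]. *)
pose g w (tv : 'rV[R]_N * 'rV[C]_n) := integrand z e (xx tv) p *
  cpower_slope lam a (fpoly (xx tv) p) (fpoly (xx tv) (py tv)) (blk (ind w)) *
  monomial (xx tv) (al (ind w)) * \det (cube_jacobian sig tv.1).
pose h w (tv : 'rV[R]_N * 'rV[C]_n) := integrand z e (xx tv) p *
  (a (blk (ind w)) / fpoly (xx tv) p (blk (ind w))) *
  monomial (xx tv) (al (ind w)) * \det (cube_jacobian sig tv.1).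
have fnz l : fpoly x0 p l != 0.
  by apply: contraTneq (rec l) => ->; rewrite /= ltxx.
have gh w : (g w tv - h w tv) @[tv --> F2] --> (0 : C).
  have cm := @cvg_monomial _ F2 FF2 xx x0 cx (al (ind w)).
  have M2 := @cvgC_mul R _ F2 FF2.
  have gl := M2 _ _ _ _ (M2 _ _ _ _ (M2 _ _ _ _ cint (csl (blk (ind w)))) cm) cdet.
  have al0 := M2 _ _ _ _ (@cvgC_cst R _ F2 FF2 (a (blk (ind w))))
    (@cvgC_inv R _ F2 FF2 _ _ (fnz (blk (ind w))) (xF (blk (ind w)))).
  have hl := M2 _ _ _ _ (M2 _ _ _ _ (M2 _ _ _ _ cint al0) cm) cdet.
  have H := @cvgC_add R _ F2 FF2 _ _ _ _ gl (@cvgC_opp R _ F2 FF2 _ _ hl).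
  by rewrite subrr in H; exact: H.
have small : \forall tv \near F2, forall w, normc (g w tv - h w tv) < eps.
  apply: filter_forall => w; have := iffLR (@cvgC_ltP _ _ F2 FF2 _ _) (gh w) eps eps0.
  by apply: filterS => tv; rewrite sub0r normcN.
have nre := @near_Re_lt0 _ _ _ F2 FF2 _ rec _ xF.
have nnz : \forall tv \near F2, forall j, xx tv 0 j != 0.
  by apply: filter_forall => j; exact: (cvgr_neq0 _ (cx j) (x0nz j)).
suff : \forall tv \near F2, normc (pullback_error z e p c tv.2 tv.1) <=
  eps * \sum_w normc (tv.2 0 w) by [].
near=> tv.
have E : cpower lam a (fpoly (xx tv) (py tv)) - cpower lam a (fpoly (xx tv) p) =
    cpower lam a (fpoly (xx tv) p) *
    \sum_l (fpoly (xx tv) (py tv) l - fpoly (xx tv) p l) *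
      cpower_slope lam a (fpoly (xx tv) p) (fpoly (xx tv) (py tv)) l by near: tv.
have sm : forall w, normc (g w tv - h w tv) < eps by near: tv.
have rt : forall l, complex.Re (fpoly (xx tv) p l) < 0 by near: tv.
have xt : forall j, xx tv 0 j != 0 by near: tv.
rewrite /pullback_error /pullback -/sig -mulrBl {1 2}/integrand -mulrBl E.
have -> : \sum_l (fpoly (xx tv) (py tv) l - fpoly (xx tv) p l) *
      cpower_slope lam a (fpoly (xx tv) p) (fpoly (xx tv) (py tv)) l =
    \sum_w tv.2 0 w * (monomial (xx tv) (al (ind w)) *
      cpower_slope lam a (fpoly (xx tv) p) (fpoly (xx tv) (py tv)) (blk (ind w))).
  rewrite [RHS](partition_big (fun w => blk (ind w)) predT)//=.
  apply: eq_bigr => l _; rewrite fpolyD big_distrl /=; apply: eq_bigr => w /eqP ->.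
  by rewrite mulrA.
rewrite mulr_sumr 2!mulr_suml -sumrB.
apply: le_trans (normc_sum _ _ _) _; rewrite big_distrr /=; apply: ler_sum => w _.
have -> : cpower lam a (fpoly (xx tv) p) *
    (tv.2 0 w * (monomial (xx tv) (al (ind w)) *
      cpower_slope lam a (fpoly (xx tv) p) (fpoly (xx tv) (py tv)) (blk (ind w)))) *
    lmonomial (sig tv.1) e * \det (cube_jacobian sig tv.1) = tv.2 0 w * g w tv.
  by rewrite /g /integrand -/a -/(xx tv); ring.
rewrite -/(xx tv) integrand_shift//.
have -> : tv.2 0 w * ((- z (blk (ind w)) - 1) *
    (integrand z e (xx tv) p / fpoly (xx tv) p (blk (ind w)) *
     monomial (xx tv) (al (ind w)) * \det (cube_jacobian sig tv.1))) = tv.2 0 w * h w tv.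
  by rewrite /h /a; ring.
by rewrite -mulrBr normcM mulrC ler_wpM2r ?normc_ge0// ltW.
Unshelve. all: by end_near. Qed.

Lemma integral_approx z e p (eps : R) : good p -> 0 < eps ->
  \forall v \near (0 : 'rV[C]_n), good (p + v) ->
  normc (integral z e (p + v) - integral z e p -
    \sum_w v 0 w * ((- z (blk (ind w)) - 1) * integral (fun l => z l + (l == blk (ind w))%:R)
       (fun j => e j + Posz (al (ind w) j)) p)) <= eps * \sum_w normc (v 0 w).
Proof.
move=> gp eps0.
pose S : R := \sum_c normc (chain_coef ga c)%:~R.
have S0 : 0 <= S by apply: sumr_ge0 => c _; exact: normc_ge0.
(* [S] is the total mass of the coefficients of the chain, the 2 is that of [cube_integral_bound],
   and adding 1 makes the denominator positive. *)
pose ep := eps / (S * 2 + 1).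
have S1 : 0 < S * 2 + 1 by rewrite ltr_wpDl// mulr_ge0.
have ep0 : 0 < ep by rewrite divr_gt0.
have H : \forall v \near (0 : 'rV[C]_n), forall c t, unit_cube t ->
    normc (pullback_error z e p c v t) <= ep * \sum_w normc (v 0 w).
  apply: (@filter_forall _ _ (fun c v => forall t, unit_cube t ->
    normc (pullback_error z e p c v t) <= ep * \sum_w normc (v 0 w))
    (nbhs (0 : 'rV[C]_n)) _) => c.
  exact: cube_integrand_approx.
near=> v => gpv.
have H' : forall c t, unit_cube t ->
    normc (pullback_error z e p c v t) <= ep * \sum_w normc (v 0 w) by near: v.
pose z' w l := z l + (l == blk (ind w))%:R.
pose e' w j := e j + Posz (al (ind w) j).
have uG c q z1 e1 : good q -> ucontC (pullback z1 e1 q c) by move=> gq; exact: integrand_ucont.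
have uS c : ucontC (fun t => \sum_w v 0 w * ((- z (blk (ind w)) - 1) *
    pullback (z' w) (e' w) p c t)).
  by apply: ucontC_sum => w _; apply: ucontCZ; apply: ucontCZ; exact: uG.
have uE c : ucontC (pullback_error z e p c v).
  apply: ucontCB; last exact: uS.
  by apply: ucontCB; exact: uG.
have -> : integral z e (p + v) - integral z e p -
    \sum_w v 0 w * ((- z (blk (ind w)) - 1) * integral (z' w) (e' w) p) =
    \sum_c (chain_coef ga c)%:~R * cube_integral (pullback_error z e p c v).
  have EI z1 e1 q : integral z1 e1 q = \sum_c (chain_coef ga c)%:~R * cube_integral (pullback z1 e1 q c).
    by [].
  under [X in _ - X = _]eq_bigr do rewrite EI !mulr_sumr.
  rewrite !EI -sumrB exchange_big -sumrB /=; apply: eq_bigr => c _.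
  rewrite cube_integralB//; last by apply: ucontCB; exact: uG.
  rewrite cube_integralB; [|exact: uG|exact: uG].
  rewrite !mulrBr cube_integral_sum; last first.
    by move=> w _; apply: ucontCZ; apply: ucontCZ; exact: uG.
  rewrite mulr_sumr; congr (_ - _); apply: eq_bigr => w _.
  rewrite cube_integralZ; last by apply: ucontCZ; exact: uG.
  by rewrite cube_integralZ; [ring|exact: uG].
apply: le_trans (normc_sum _ _ _) _.
apply: (@le_trans _ _ (S * 2 * (ep * \sum_w normc (v 0 w)))).
  rewrite /S -mulrA mulr_suml; apply: ler_sum => c _; rewrite normcM ler_wpM2l ?normc_ge0//.
  rewrite mulr_natl mulr2n; apply: cube_integral_bound => [|t tc]; [exact: uE|exact: H'].
rewrite mulrA ler_wpM2r//; first by apply: sumr_ge0 => w _; exact: normc_ge0.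
by rewrite /ep mulrCA ler_piMr ?(ltW eps0)// ler_pdivrMr// mul1r lerDl.
Unshelve. all: by end_near. Qed.

End Fibre.

Section FibreDerivatives.
Variables (R : realType) (N k n : nat) (A : finType).
Local Notation C := R[i].
Variables (blk : A -> 'I_k) (al : A -> 'I_N -> nat) (ind : 'I_n -> A).
Hypothesis ind_inj : injective ind.
Variables (lam : 'I_k -> C -> C).
Hypothesis lam_log : forall l, log_branch (lam l).
Variable ga : chain R N.
Implicit Types (p v : 'rV[C]_n) (z : 'I_k -> C) (e : 'I_N -> int).
Local Notation J := (integral blk al ind lam ga).
Local Notation good := (good blk al ind ga).

Definition shiftz z (l0 : 'I_k) : 'I_k -> C := fun l => z l + (l == l0)%:R.
Definition shifte e (b : 'I_N -> nat) : 'I_N -> int := fun j => e j + Posz (b j).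

(** The open set [V] provides good parameters [p + v] for all small [v], as [integral_approx]
    requires. *)
Lemma integral_partial (V : set 'rV[C]_n) z e p : open V -> V `<=` good -> V p ->
  differentiable (J z e) p /\
  forall w, partial w (J z e) p =
    (- z (blk (ind w)) - 1) * J (shiftz z (blk (ind w))) (shifte e (al (ind w))) p.
Proof.
move=> oV Vg Vp; apply: differentiable_linear_approx => eps eps0.
have nV : \forall v \near (0 : 'rV[C]_n), V (p + v).
  have pv : (p + v : 'rV[C]_n) @[v --> (0 : 'rV[C]_n)] --> p.
    have H := @cvgD _ _ _ (nbhs (0 : 'rV[C]_n)) _ (fun=> p) id p 0 (cvg_cst p) cvg_id.
    by rewrite addr0 in H; exact: H.
  exact: (pv V (open_nbhs_nbhs (conj oV Vp))).
have H := integral_approx ind_inj lam_log z e (Vg _ Vp) eps0.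
by apply: filterS2 H nV => v H /Vg.
Qed.

(** Each partial derivative is a constant times an integral of the same family with shifted
    exponents, so induction on the order runs over all [z] and [e] at once. *)
Lemma smooth_integral (V : set 'rV[C]_n) z e : open V -> V `<=` good ->
  smooth_on V (J z e).
Proof.
move=> oV Vg; apply/smooth_diff_order => r; elim: r z e => [|r IH] z e.
  by split=> // p Vp; have [] := integral_partial z e oV Vg Vp.
split=> [p Vp|w]; first by have [] := integral_partial z e oV Vg Vp.
have H := diff_orderM oV (diff_order_cst r V (- z (blk (ind w)) - 1))
  (IH (shiftz z (blk (ind w))) (shifte e (al (ind w)))).
apply: eq_diff_order H => // p Vp.
by have [_ ->] := integral_partial z e oV Vg Vp.
Qed.

Lemma chain_integral_sum (I : finType) (P : pred I) (c : I -> C) (zz : I -> 'I_k -> C)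
    (ee : I -> 'I_N -> int) p : good p ->
  chain_integral ga (fun x => \sum_(i | P i) c i * integrand blk al ind lam (zz i) (ee i) x p) =
  \sum_(i | P i) c i * J (zz i) (ee i) p.
Proof.
move=> gp; rewrite /integral /chain_integral.
under [RHS]eq_bigr do rewrite mulr_sumr.
rewrite exchange_big /=; apply: eq_bigr => cc _.
have uG i := integrand_ucont lam_log (zz i) (ee i) cc gp.
under eq_cube_integral => t _.
  rewrite mulr_suml; under eq_bigr do rewrite -mulrA; over.
rewrite cube_integral_sum; last by move=> i _; apply: ucontCZ; exact: uG.
rewrite mulr_sumr; apply: eq_bigr => i _.
by rewrite cube_integralZ; [rewrite mulrCA|exact: uG].
Qed.

Lemma chain_integral_eq (h h' : 'rV[C]_N -> C) :
  (forall c t, unit_cube t -> h (chain_cube ga c t) = h' (chain_cube ga c t)) ->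
  chain_integral ga h = chain_integral ga h'.
Proof.
move=> hh; apply: eq_bigr => c _; congr (_ * _); apply: eq_cube_integral => t tc.
by rewrite hh.
Qed.

(* f_q * f_q^(- z - 2) = f_q^(- z - 1) *)
Lemma integral_block z e p q : good p -> J z e p =
  \sum_(a | blk a == q) coef ind p a * J (shiftz z q) (shifte e (al a)) p.
Proof.
move=> gp; rewrite -(chain_integral_sum _ _ (fun=> shiftz z q) (fun a => shifte e (al a)) gp).
apply: chain_integral_eq => c t tc; have [_ nz re] := gp.
have rt l : complex.Re (fpoly blk al ind (chain_cube ga c t) p l) < 0 by exact: re.
have xt j : chain_cube ga c t 0 j != 0 by exact: nz.
under [RHS]eq_bigr => a _ do rewrite (integrand_shift lam_log z e q (al a) rt xt) mulrCA.
rewrite -mulr_sumr divfK//.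
by apply: contraTneq (rt q) => ->; rewrite /= ltxx.
Qed.

End FibreDerivatives.

(** * Stokes' theorem for cubical chains *)

Section Stokes.
Variable R : realType.
Local Notation C := R[i].

Lemma cube_FTC_complex n (i : 'I_n.+1) (F D : 'rV[R]_n.+1 -> C) :
  ucontC F -> ucontC D ->
  (forall t, unit_cube t -> cderiv (fun h : R => F (t + h *: delta_mx 0 i)) 0 (D t)) ->
  cube_integral D =
    cube_integral (fun u : 'rV[R]_n => F (face i true u)) -
    cube_integral (fun u : 'rV[R]_n => F (face i false u)).
Proof.
move=> [F1 F2] [D1 D2] FD; apply: complex_eqP; rewrite ?ReB ?ImB.
  by apply: (cube_FTC F1 D1) => t /FD /cderivP[].
by apply: (cube_FTC F2 D2) => t /FD /cderivP[].
Qed.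

Section Cube.
Variables (m : nat) (sg : 'rV[R]_m.+1 -> 'rV[C]_m.+1).
Hypothesis ssg : smooth_cube sg.
Let Jac t := cube_jacobian sg t.

Definition hessian (i k l : 'I_m.+1) (t : 'rV[R]_m.+1) : C :=
  partial i (partial k (fun u => complex.Re (sg u 0 l))) t +i*
  partial i (partial k (fun u => complex.Im (sg u 0 l))) t.

Lemma hessianC i k l t : hessian i k l t = hessian k i l t.
Proof.
have [sr si] := ssg l; rewrite /hessian.
by rewrite (partialC_real i k openT sr I) (partialC_real i k openT si I).
Qed.

Lemma hessian_cvg i k l t : hessian i k l u @[u --> t] --> hessian i k l t.
Proof.
have [sr si] := ssg l.
have cr := smooth_continuous (smooth_partial i (smooth_partial k sr)).
have ci := smooth_continuous (smooth_partial i (smooth_partial k si)).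
exact: (cvg_ReIm (cr t) (ci t)).
Qed.

Lemma cderiv_real_line (g1 g2 : 'rV[R]_m.+1 -> R) (t : 'rV[R]_m.+1) i :
  smooth_on setT g1 -> smooth_on setT g2 ->
  cderiv (fun h : R => g1 (t + h *: delta_mx 0 i) +i* g2 (t + h *: delta_mx 0 i)) 0
    (partial i g1 t +i* partial i g2 t).
Proof.
move=> s1 s2; apply/cderivP; split => /=.
  rewrite -[X in partial i g1 X]addr0 -(scale0r (delta_mx 0 i)).
  by apply: is_derive_line; exact: smooth_differentiable s1 I.
rewrite -[X in partial i g2 X]addr0 -(scale0r (delta_mx 0 i)).
by apply: is_derive_line; exact: smooth_differentiable s2 I.
Qed.

Lemma cderiv_jacobian t i k l :
  cderiv (fun h : R => Jac (t + h *: delta_mx 0 i) k l) 0 (hessian i k l t).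
Proof.
have [sr si] := ssg l.
have -> : (fun h : R => Jac (t + h *: delta_mx 0 i) k l) = fun h : R =>
    partial k (fun u => complex.Re (sg u 0 l)) (t + h *: delta_mx 0 i) +i*
    partial k (fun u => complex.Im (sg u 0 l)) (t + h *: delta_mx 0 i).
  by apply/funext => h; rewrite mxE.
by apply: cderiv_real_line; exact: smooth_partial.
Qed.

Lemma cderiv_cube t i l :
  cderiv (fun h : R => sg (t + h *: delta_mx 0 i) 0 l) 0 (Jac t i l).
Proof.
have [sr si] := ssg l; rewrite [Jac t i l]mxE.
have -> : (fun h : R => sg (t + h *: delta_mx 0 i) 0 l) = fun h : R =>
    complex.Re (sg (t + h *: delta_mx 0 i) 0 l) +i* complex.Im (sg (t + h *: delta_mx 0 i) 0 l).
  by apply/funext => h; rewrite -complex_ReIm.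
exact: (@cderiv_real_line (fun u => complex.Re (sg u 0 l)) (fun u => complex.Im (sg u 0 l))).
Qed.

Definition cofactor_term (t : 'rV[R]_m.+1) (i k : 'I_m.+1) (s : 'S_m.+1) : C :=
  (-1) ^+ s * (hessian i k (s k) t *
    \prod_(k' | (k' != i) && (k' != k)) Jac t k' (s k')).

(** The derivative in the direction [i] of the (i, j) cofactor: in its expansion over the
    permutations with [s i = j], the factors of the remaining rows [k] are differentiated in
    turn. *)
Definition dcofactor (t : 'rV[R]_m.+1) (i j : 'I_m.+1) : C :=
  \sum_(s : 'S_m.+1 | s i == j) \sum_(k | k != i) cofactor_term t i k s.

Lemma cderiv_cofactor t i j :
  cderiv (fun h : R => cofactor (Jac (t + h *: delta_mx 0 i)) i j) 0 (dcofactor t i j).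
Proof.
pose F (s : 'S_m.+1) (h : R) : C := (-1) ^+ s *
  \prod_(k <- [seq k <- index_enum 'I_m.+1 | k != i]) Jac (t + h *: delta_mx 0 i) k (s k).
have -> : (fun h : R => cofactor (Jac (t + h *: delta_mx 0 i)) i j) =
    fun h => \sum_(s : 'S_m.+1 | s i == j) F s h.
  apply/funext => h; rewrite expand_cofactor; apply: eq_bigr => s _.
  by rewrite /F big_filter; congr (_ * _); apply: eq_bigl => k; rewrite eq_sym.
apply: (@cderiv_sum R _ _ _ F) => s _.
have := cderivZ ((-1) ^+ s) (cderiv_prod (filter_uniq (fun k => k != i) (index_enum_uniq _))
   (fun k => cderiv_jacobian t i k (s k))).
congr cderiv.
rewrite big_filter mulr_sumr; apply: eq_bigr => k ki; rewrite /cofactor_term.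
rewrite big_filter_cond; congr (_ * (_ * _)).
by apply: eq_bigr => k' _; rewrite scale0r addr0.
Qed.

(* The cofactors of a Jacobian matrix are divergence free: composing with the
   transposition (i k) matches the terms in pairs of opposite signs. *)
Lemma cofactor_divergence t j : \sum_i dcofactor t i j = 0.
Proof.
pose S := \sum_i \sum_(k | k != i) \sum_(s : 'S_m.+1 | s i == j) cofactor_term t i k s.
have -> : \sum_i dcofactor t i j = S.
  by apply: eq_bigr => i _; rewrite exchange_big.
have SN : S = - S.
  rewrite {2}/S -sumrN.
  under [RHS]eq_bigr do rewrite -sumrN.
  rewrite [RHS](exchange_big_dep xpredT)//=; apply: eq_bigr => i _.
  rewrite [RHS](eq_bigl (fun k => k != i)); last by move=> k; rewrite eq_sym.
  apply: eq_bigr => k ki.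
  rewrite -sumrN (reindex_inj (mulgI (tperm i k))) /=.
  apply: eq_big => [s|s _]; first by rewrite permM tpermL.
  rewrite /cofactor_term permM tpermR odd_mul_tperm eq_sym ki addTb signrN mulNr.
  rewrite (hessianC i k); congr (- (_ * (_ * _))).
  apply: eq_big => [k'|k' /andP[k'i k'k]]; first by rewrite andbC.
  by rewrite permM tpermD// eq_sym.
apply/eqP; have : S + S = 0 by rewrite {1}SN addNr.
by move/eqP; rewrite -mulr2n mulrn_eq0.
Qed.

Lemma cofactor_cvg t i j : cofactor (Jac u) i j @[u --> t] --> cofactor (Jac t) i j.
Proof.
apply: (@cvgC_mul _ _ (nbhs t)); first exact: (@cvgC_cst R _ (nbhs t)).
apply: (@cvgC_det _ _ (nbhs t)) => a b.
have E u : row' i (col' j (Jac u)) a b = Jac u (lift i a) (lift j b) by rewrite !mxE.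
rewrite E (_ : (fun u => row' i (col' j (Jac u)) a b) = fun u => Jac u (lift i a) (lift j b)).
  exact: cube_jacobian_cvg.
by apply/funext.
Qed.

Lemma dcofactor_cvg t i j : dcofactor u i j @[u --> t] --> dcofactor t i j.
Proof.
apply: (@cvgC_sum _ _ (nbhs t)) => s _; apply: (@cvgC_sum _ _ (nbhs t)) => k _.
apply: (@cvgC_mul _ _ (nbhs t)); first exact: (@cvgC_cst R _ (nbhs t)).
apply: (@cvgC_mul _ _ (nbhs t)); first exact: hessian_cvg.
by apply: (@cvgC_prod _ _ (nbhs t)) => k' _; exact: cube_jacobian_cvg.
Qed.

(** The divergence of the vector with entries [w] times the (i, j) cofactor is [D j * \det Jac]: the
    cofactors themselves are divergence free, and multiplying the Jacobian by its adjugate leaves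
    the term [l = j] alone. The fundamental theorem then applies in each coordinate [i]. *)
Lemma cube_Stokes (w : 'rV[R]_m.+1 -> C) (D : 'I_m.+1 -> 'rV[R]_m.+1 -> C) (j : 'I_m.+1) :
  (forall t, unit_cube t -> {for t, continuous w}) ->
  (forall l t, unit_cube t -> {for t, continuous (D l)}) ->
  (forall t i, unit_cube t -> cderiv (fun h : R => w (t + h *: delta_mx 0 i)) 0
     (\sum_l D l t * Jac t i l)) ->
  cube_integral (fun t => D j t * \det (Jac t)) =
  \sum_(i < m.+1) (cube_integral (fun u : 'rV[R]_m => w (face i true u) * cofactor (Jac (face i true u)) i j) -
          cube_integral (fun u : 'rV[R]_m => w (face i false u) * cofactor (Jac (face i false u)) i j)).
Proof.
move=> cw cD wD.
pose DF i t := (\sum_l D l t * Jac t i l) * cofactor (Jac t) i j + w t * dcofactor t i j.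
have uDF i : ucontC (DF i).
  apply: continuous_ucontC => t tc; apply: (@cvgC_add _ _ (nbhs t)).
    apply: (@cvgC_mul _ _ (nbhs t)); last exact: cofactor_cvg.
    apply: (@cvgC_sum _ _ (nbhs t)) => l _.
    by apply: (@cvgC_mul _ _ (nbhs t)); [exact: cD|exact: cube_jacobian_cvg].
  by apply: (@cvgC_mul _ _ (nbhs t)); [exact: cw|exact: dcofactor_cvg].
have uF i : ucontC (fun t => w t * cofactor (Jac t) i j).
  apply: continuous_ucontC => t tc.
  by apply: (@cvgC_mul _ _ (nbhs t)); [exact: cw|exact: cofactor_cvg].
have -> : cube_integral (fun t => D j t * \det (Jac t)) =
    cube_integral (fun t => \sum_i DF i t).
  apply: eq_cube_integral => t _; rewrite big_split /= -mulr_sumr cofactor_divergence mulr0 addr0.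
  under eq_bigr do rewrite mulr_suml.
  rewrite exchange_big (bigD1 j)//= [X in _ + X]big1 ?addr0 => [|l lj].
    rewrite (expand_det_col _ j) mulr_sumr; apply: eq_bigr => i _; by rewrite mulrA.
  under eq_bigr do rewrite -mulrA.
  rewrite -mulr_sumr.
  have := congr1 (fun B : 'M[C]_m.+1 => B j l) (mul_adj_mx (Jac t)); rewrite !mxE.
  rewrite (eq_sym j) (negbTE lj) mulr0n => E.
  rewrite [X in _ * X](_ : _ = 0) ?mulr0// -[RHS]E; apply: eq_bigr => i _.
  by rewrite [in RHS]mxE mulrC.
rewrite cube_integral_sum; last by move=> i _; exact: uDF.
apply: eq_bigr => i _; apply: (cube_FTC_complex (uF i) (uDF i)) => t tc.
have := cderivM (wD t i tc) (cderiv_cofactor t i j).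
by rewrite scale0r addr0.
Qed.

End Cube.
End Stokes.

(** * Cancellation of the faces of a cycle *)

Section ChainStokes.
Variables (R : realType) (m : nat).
Local Notation C := R[i].

Lemma unit_cube_line n (u : 'rV[R]_n) i h : unit_cube u -> 0 <= u 0 i + h <= 1 ->
  unit_cube (u + h *: delta_mx 0 i).
Proof.
move=> uc hi j; rewrite !mxE /=; case: eqVneq => [->|_]; first by rewrite mulr1.
by rewrite mulr0 addr0.
Qed.

(* One-sided difference quotients inside the cube determine the derivative. *)
Lemma derive_cst_on_cube n (f : 'rV[R]_n -> R) (u : 'rV[R]_n) i :
  derivable f u (delta_mx 0 i) -> unit_cube u ->
  (forall t, unit_cube t -> (forall j, j != i -> t 0 j = u 0 j) -> f t = f u) ->
  partial i f u = 0.
Proof.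
move=> df uc fc; have [phi phid phiE] := is_derive_slope (derivableP df).
rewrite -/(partial i f u) in phid; set d := partial i f u in phid *.
apply/eqP; rewrite -normr_le0; apply/ler_addgt0Pl => e e0; rewrite addr0.
have /cvgrPdist_lt/(_ _ e0)/nbhs_ballP[r /= r0 hr] := phid.
pose h := Num.min r 1 / 2.
have m0 : 0 < Num.min r 1 by rewrite lt_min r0 ltr01.
have h0 : 0 < h by rewrite divr_gt0.
have : h < Num.min r 1 by rewrite gtr_pMr// invf_lt1// ltr1n.
rewrite lt_min => /andP[hr' h1].
have h2 : h <= 1 / 2 by rewrite ler_pM2r// ge_min lexx orbT.
(* As [h] is at most 1/2, from either half of the unit interval one of the two directions stays
   inside. *)
have [s sn sc] : exists2 s : R, `|s| = h & 0 <= u 0 i + s <= 1.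
  have /andP[u0 u1] := uc i; have [ui|ui] := leP (u 0 i) (1 / 2).
    by exists h; [rewrite gtr0_norm|lra].
  by exists (- h); [rewrite normrN gtr0_norm|lra].
have : phi s = 0.
  have := phiE s; rewrite fc ?subrr; last 2 first.
  - exact: unit_cube_line.
  - by move=> j ji; rewrite !mxE /= (negbTE ji) mulr0 addr0.
  move/esym/eqP; rewrite mulf_eq0 => /orP[/eqP s0|/eqP//].
  by move: h0; rewrite -sn s0 normr0 ltxx.
move=> phis; have := hr s; rewrite /ball /= sub0r normrN sn => /(_ hr').
by rewrite phis subr0 => /ltW.
Qed.

Definition partially_derivable n (f : 'rV[R]_n -> 'rV[C]_m.+1) : Prop :=
  forall l u i, derivable (fun u => complex.Re (f u 0 l)) u (delta_mx 0 i) /\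
                derivable (fun u => complex.Im (f u 0 l)) u (delta_mx 0 i).

Definition subjacobian (j : 'I_m.+1) (f : 'rV[R]_m -> 'rV[C]_m.+1) (u : 'rV[R]_m) :
    'M[C]_m :=
  \matrix_(i, l) (partial i (fun u => complex.Re (f u 0 (lift j l))) u +i*
                  partial i (fun u => complex.Im (f u 0 (lift j l))) u).

(* The integral over f of g dx_0 /\ ... /\ dx_m with dx_j omitted. *)
Definition face_integral (g : 'rV[C]_m.+1 -> C) j (f : 'rV[R]_m -> 'rV[C]_m.+1) : C :=
  cube_integral (fun u => g (f u) * \det (subjacobian j f u)).

(** The faces agree on the cube only, whereas the Jacobian uses their extensions; the difference of
    the extensions is 0 on the cube, and so are its partial derivatives there by
    [derive_cst_on_cube]. *)
Lemma eq_face_integral g j f f' : partially_derivable f -> partially_derivable f' ->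
  eq_cube f f' -> face_integral g j f = face_integral g j f'.
Proof.
move=> df df' ff; apply: eq_cube_integral => u uc; rewrite (ff u uc).
congr (_ * \det _); apply/matrixP => i l; rewrite !mxE.
have [r1 i1] := df (lift j l) u i; have [r2 i2] := df' (lift j l) u i.
have aux (h h' : 'rV[R]_m -> R) : derivable h u (delta_mx 0 i) ->
    derivable h' u (delta_mx 0 i) -> (forall t, unit_cube t -> h t = h' t) ->
    partial i h u = partial i h' u.
  move=> dh dh' hh; apply/eqP; rewrite -subr_eq0 -[X in X == _]deriveB//; apply/eqP.
  have E v : unit_cube v -> (h - h') v = 0.
    by move=> vc; rewrite -[LHS]/(h v - h' v) (hh v vc) subrr.
  apply: (derive_cst_on_cube (derivableB dh dh') uc) => t tc _.
  by rewrite (E t tc) (E u uc).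
congr (_ +i* _).
  by apply: (aux _ _ r1 r2) => t tc; rewrite ff.
by apply: (aux _ _ i1 i2) => t tc; rewrite ff.
Qed.

(** The coordinate on which the cube does not depend gives a zero row of the Jacobian. *)
Lemma degenerate_face_integral g j f : partially_derivable f ->
  degenerate_cube f -> face_integral g j f = 0.
Proof.
move=> df [i fi]; apply: cube_integral0 => u uc.
rewrite (expand_det_row _ i) big1 ?mulr0// => l _.
have [r1 i1] := df (lift j l) u i.
rewrite mxE (derive_cst_on_cube r1 uc); last by move=> t tc tu; rewrite (fi t u).
rewrite (derive_cst_on_cube i1 uc); last by move=> t tc tu; rewrite (fi t u).
by rewrite mul0r.
Qed.

Lemma face_line (i : 'I_m.+1) e (u : 'rV[R]_m) i' h :
  face i e (h *: delta_mx 0 i' + u) = h *: delta_mx 0 (lift i i') + face i e u :> 'rV[R]_m.+1.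
Proof.
apply/rowP => j; rewrite !mxE; case: unliftP => [j'|] -> /=.
  by rewrite !mxE /= (inj_eq lift_inj).
by rewrite (negbTE (neq_lift _ _)) mulr0 add0r.
Qed.

Lemma face_slope (h : 'rV[R]_m.+1 -> R) (i : 'I_m.+1) e (u : 'rV[R]_m) i' :
  (fun s : R => s^-1 *: (((fun u : 'rV[R]_m => h (face i e u)) \o shift u)
     (s *: delta_mx 0 i') - h (face i e u))) =
  (fun s : R => s^-1 *: ((h \o shift (face i e u)) (s *: delta_mx 0 (lift i i')) -
     h (face i e u))).
Proof. by apply/funext => s; rewrite /= face_line. Qed.

Lemma derive_face (h : 'rV[R]_m.+1 -> R) (i : 'I_m.+1) e (u : 'rV[R]_m) i' :
  partial i' (fun u : 'rV[R]_m => h (face i e u)) u = partial (lift i i') h (face i e u).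
Proof. by have := face_slope h i e u i'; rewrite /partial /derive => ->. Qed.

Lemma derivable_face (h : 'rV[R]_m.+1 -> R) (i : 'I_m.+1) e (u : 'rV[R]_m) i' :
  derivable h (face i e u) (delta_mx 0 (lift i i')) ->
  derivable (fun u : 'rV[R]_m => h (face i e u)) u (delta_mx 0 i').
Proof. by have := face_slope h i e u i'; rewrite /derivable => ->. Qed.

Variable ga : chain R m.+1.
Hypothesis sga : forall c, smooth_cube (chain_cube ga c).
Hypothesis bga : forall f : 'rV[R]_m -> 'rV[C]_m.+1, ~ degenerate_cube f -> boundary_coef ga f = 0.

Let I3 : finType := ('I_(chain_size ga) * 'I_m.+1 * bool)%type.
Let fc (x : I3) (u : 'rV[R]_m) : 'rV[C]_m.+1 := chain_cube ga x.1.1 (face x.1.2 x.2 u).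
Let wt (x : I3) : int := chain_coef ga x.1.1 * (-1) ^+ (x.1.2.+1 + x.2).

Lemma face_partially_derivable x : partially_derivable (fc x).
Proof.
move=> l u i; have [sr si] := sga x.1.1 l.
split.
  apply: (@derivable_face (fun t => complex.Re (chain_cube ga x.1.1 t 0 l))).
  by apply: diff_derivable; exact: smooth_differentiable sr I.
apply: (@derivable_face (fun t => complex.Im (chain_cube ga x.1.1 t 0 l))).
by apply: diff_derivable; exact: smooth_differentiable si I.
Qed.

Lemma boundary_coef_pairs (f : 'rV[R]_m -> 'rV[C]_m.+1) :
  boundary_coef ga f = \sum_x wt x * `[< eq_cube (fc x) f >]%:R.
Proof.
rewrite /boundary_coef pair_bigA pair_bigA /=.
by apply: eq_bigr => -[[c i] e] _.
Qed.

(* L is averaged over the classes of equal faces, whose total weights are the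
   boundary coefficients. *)
Lemma boundary_sum_eq0 (L : ('rV[R]_m -> 'rV[C]_m.+1) -> C) :
  (forall x y, eq_cube (fc x) (fc y) -> L (fc x) = L (fc y)) ->
  (forall x, degenerate_cube (fc x) -> L (fc x) = 0) ->
  \sum_x (wt x)%:~R * L (fc x) = 0.
Proof.
move=> Leq Ldeg.
pose E x y := `[< eq_cube (fc x) (fc y) >].
have Exx x : E x x by apply/asboolP.
have Esym x y : E x y = E y x.
  by apply/idP/idP => /asboolP h; apply/asboolP => t tc; rewrite h.
have Etr x y z : E x y -> E x z = E y z.
  move=> /asboolP xy; apply/idP/idP => /asboolP h; apply/asboolP => t tc.
    by rewrite -xy// h.
  by rewrite xy// h.
pose nn y : C := \sum_z (E z y)%:R.
have nn0 y : nn y != 0.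
  rewrite /nn -natr_sum pnatr_eq0 -lt0n (bigD1 y)//= Exx.
  by rewrite add1n.
have avg x : L (fc x) = \sum_y (E x y)%:R * (L (fc y) / nn y).
  rewrite (eq_bigr (fun y => (E y x)%:R * (L (fc x) / nn x))); last first.
    move=> y _; rewrite Esym; case: (boolP (E y x)) => [yx|_]; last by rewrite !mul0r.
    have -> : L (fc y) = L (fc x) by apply: Leq; exact/asboolP.
    have -> // : nn y = nn x.
    by apply: eq_bigr => z _; rewrite Esym (Etr _ _ _ yx) Esym.
  by rewrite -mulr_suml -/(nn x) mulrCA divff// mulr1.
under eq_bigr do rewrite avg mulr_sumr.
rewrite exchange_big /= big1// => y _.
rewrite (eq_bigr (fun x => (wt x)%:~R * (E x y)%:R * (L (fc y) / nn y))) => [|x _]; last first.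
  exact: mulrA.
rewrite -mulr_suml.
have -> : \sum_x (wt x)%:~R * (E x y)%:R = (boundary_coef ga (fc y))%:~R :> C.
  rewrite boundary_coef_pairs rmorph_sum; apply: eq_bigr => x _.
  by rewrite rmorphM /=; congr (_ * _); rewrite /E; case: `[< _ >].
have [dy|ndy] := pselect (degenerate_cube (fc y)); first by rewrite Ldeg// mul0r mulr0.
by rewrite bga// mul0r.
Qed.

Lemma chain_Stokes (g : 'rV[C]_m.+1 -> C) (Dg : 'I_m.+1 -> 'rV[C]_m.+1 -> C) (j : 'I_m.+1) :
  (forall c t, unit_cube t -> {for t, continuous (fun t => g (chain_cube ga c t))}) ->
  (forall c l t, unit_cube t -> {for t, continuous (fun t => Dg l (chain_cube ga c t))}) ->
  (forall c t i, unit_cube t ->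
    cderiv (fun h : R => g (chain_cube ga c (t + h *: delta_mx 0 i))) 0
     (\sum_l Dg l (chain_cube ga c t) * cube_jacobian (chain_cube ga c) t i l)) ->
  chain_integral ga (Dg j) = 0.
Proof.
move=> cg cD gD.
have fE c (i : 'I_m.+1) (e : bool) : cube_integral (fun u : 'rV[R]_m => g (chain_cube ga c (face i e u)) *
      cofactor (cube_jacobian (chain_cube ga c) (face i e u)) i j) =
    (-1) ^+ (i + j) * face_integral g j (fc (c, i, e)).
  have dE u : g (chain_cube ga c (face i e u)) *
      cofactor (cube_jacobian (chain_cube ga c) (face i e u)) i j =
      (-1) ^+ (i + j) * (g (fc (c, i, e) u) * \det (subjacobian j (fc (c, i, e)) u)).
    rewrite /cofactor mulrCA; congr (_ * (_ * \det _)); apply/matrixP => i' l.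
    rewrite !mxE.
    rewrite (derive_face (fun t => complex.Re (chain_cube ga c t 0 (lift j l)))).
    by rewrite (derive_face (fun t => complex.Im (chain_cube ga c t 0 (lift j l)))).
  under eq_cube_integral do rewrite dE.
  rewrite cube_integralZ//.
  have uc : ucontC (fun t => g (chain_cube ga c t) *
      cofactor (cube_jacobian (chain_cube ga c) t) i j).
    apply: continuous_ucontC => t tc.
    by apply: (@cvgC_mul _ _ (nbhs t)); [exact: cg|exact: (cofactor_cvg (sga c))].
  (* The integrand of [face_integral] is the cofactor integrand times the sign, because the sign
     squares to 1; so the two are uniformly continuous together. *)
  have [u1 u2] : ucontC (fun u : 'rV[R]_m => (-1) ^+ (i + j) * (g (chain_cube ga c (face i e u)) *
      cofactor (cube_jacobian (chain_cube ga c) (face i e u)) i j)).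
    by apply: ucontCZ; split; [exact: (ucont_face i e uc.1)|exact: (ucont_face i e uc.2)].
  have E : (fun u : 'rV[R]_m => (-1) ^+ (i + j) * (g (chain_cube ga c (face i e u)) *
      cofactor (cube_jacobian (chain_cube ga c) (face i e u)) i j)) =
      fun u => g (fc (c, i, e) u) * \det (subjacobian j (fc (c, i, e)) u).
    by apply/funext => u; rewrite dE mulrA -exprD addnn -mul2n exprM sqrrN !expr1n mul1r.
  by rewrite -E; split.
rewrite /chain_integral.
have -> : \sum_c (chain_coef ga c)%:~R * cube_integral (fun t =>
      Dg j (chain_cube ga c t) * \det (cube_jacobian (chain_cube ga c) t)) =
    (-1) ^+ j * \sum_x (wt x)%:~R * face_integral g j (fc x).
  rewrite -(pair_bigA _ (fun ci e => (wt (ci, e))%:~R * face_integral g j (fc (ci, e)))) /=.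
  rewrite -(pair_bigA _ (fun c i => \sum_e (wt (c, i, e))%:~R * face_integral g j (fc (c, i, e)))) /=.
  rewrite mulr_sumr; apply: eq_bigr => c _.
  rewrite (@cube_Stokes _ _ _ (sga c) (fun t => g (chain_cube ga c t))
     (fun l t => Dg l (chain_cube ga c t)) j (cg c) (cD c) (gD c)).
  rewrite !mulr_sumr; apply: eq_bigr => i _.
  have E1 := congr2 (fun X Y : C => (chain_coef ga c)%:~R * (X - Y)) (fE c i true) (fE c i false).
  apply: (eq_trans E1); rewrite big_bool.
  (* The boundary sign is (-1)^i for [e = true] and its opposite for [e = false], in accordance with
     the difference of the two faces; (-1)^j stays in front of the sum. *)
  have wtE e : (wt (c, i, e))%:~R = (chain_coef ga c)%:~R * (-1) ^+ (i.+1 + e) :> C.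
    by rewrite /wt rmorphM rmorphXn rmorphN1.
  rewrite (wtE true) (wtE false) /= !exprD exprS expr1 expr0.
  move: (face_integral _ _ _) (face_integral _ _ _) => X Y.
  ring.
have -> : \sum_x (wt x)%:~R * face_integral g j (fc x) = 0; last exact: mulr0.
apply: (boundary_sum_eq0 (L := face_integral g j)).
  by move=> x y xy; apply: eq_face_integral xy; exact: face_partially_derivable.
by move=> x; apply: degenerate_face_integral; exact: face_partially_derivable.
Qed.

End ChainStokes.

(** * Logarithmic derivatives along curves, and the Stokes relations of the fibre integral *)

Section LogarithmicDerivatives.
Variable R : realType.
Local Notation C := R[i].
Implicit Types (F : R -> C).

Lemma cderiv_exprn F t d n : F t != 0 -> cderiv F t d ->
  cderiv (fun s => F s ^+ n) t (F t ^+ n * (n%:R * d / F t)).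
Proof.
move=> F0 dF; elim: n => [|n IH].
  by rewrite !mul0r mulr0; exact: cderiv_cst.
have -> : F t ^+ n.+1 * (n.+1%:R * d / F t) =
    d * F t ^+ n + F t * (F t ^+ n * (n%:R * d / F t)).
  by rewrite exprS -natr1; field.
have -> : (fun s => F s ^+ n.+1) = fun s => F s * F s ^+ n.
  by apply/funext => s; rewrite exprS.
exact: cderivM dF IH.
Qed.

Lemma cderiv_exprz F t d (n : int) : F t != 0 -> cderiv F t d ->
  cderiv (fun s => F s ^ n) t (F t ^ n * (n%:~R * d / F t)).
Proof.
move=> F0 dF; case: n => n; first exact: cderiv_exprn.
have Fn0 : F t ^+ n.+1 != 0 by rewrite expf_neq0.
have H := cderivV Fn0 (cderiv_exprn n.+1 F0 dF).
rewrite [X in cderiv _ _ X](_ : _ = - (F t ^+ n.+1 * (n.+1%:R * d / F t)) / (F t ^+ n.+1) ^+ 2)//.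
rewrite NegzE mulrNz /= -exprnN.
rewrite -[n.+1%:~R]/(n.+1%:R : C).
by move: (F t ^+ n.+1) Fn0 => y y0; field; rewrite y0 F0.
Qed.

End LogarithmicDerivatives.

Section FibreStokes.
Variables (R : realType) (m k n : nat) (A : finType).
Local Notation C := R[i].
Local Notation N := m.+1.
Variables (blk : A -> 'I_k) (al : A -> 'I_N -> nat) (ind : 'I_n -> A).
Hypothesis ind_inj : injective ind.
Variables (lam : 'I_k -> C -> C).
Hypothesis lam_log : forall l, log_branch (lam l).
Variable ga : chain R N.
Implicit Types (p v : 'rV[C]_n) (z : 'I_k -> C) (e : 'I_N -> int) (x : 'rV[C]_N).
Local Notation J := (integral blk al ind lam ga).
Local Notation good := (good blk al ind ga).
Local Notation fpoly := (fpoly blk al ind).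
Local Notation integrand := (integrand blk al ind lam).

Definition integrand_partial z e p (l : 'I_N) x : C :=
  integrand z e x p * ((e l)%:~R / x 0 l +
    \sum_q (- z q - 1) * ((\sum_(a | blk a == q)
      coef ind p a * (monomial x (al a) * ((al a l)%:R / x 0 l))) / fpoly x p q)).

Section Line.
Variables (x : R -> 'rV[C]_N) (t : R) (d : 'I_N -> C).
Hypothesis dx : forall l, cderiv (fun s => x s 0 l) t (d l).
Hypothesis x0 : forall l, x t 0 l != 0.

Lemma cderiv_lmonomial e : cderiv (fun s => lmonomial (x s) e) t
  (lmonomial (x t) e * \sum_l (e l)%:~R * d l / x t 0 l).
Proof. by apply: cderiv_prod_log => l; exact: cderiv_exprz. Qed.

Lemma cderiv_monomial b : cderiv (fun s => monomial (x s) b) t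
  (monomial (x t) b * \sum_l (b l)%:R * d l / x t 0 l).
Proof. by apply: cderiv_prod_log => l; exact: cderiv_exprn. Qed.

Lemma cderiv_integrand z e p : (forall q, complex.Re (fpoly (x t) p q) < 0) ->
  cderiv (fun s => integrand z e (x s) p) t
    (\sum_l integrand_partial z e p l (x t) * d l).
Proof.
move=> re.
have dF q : cderiv (fun s => fpoly (x s) p q) t (\sum_(a | blk a == q)
    coef ind p a * (monomial (x t) (al a) * \sum_l (al a l)%:R * d l / x t 0 l)).
  by apply: cderiv_sum => a _; apply: cderivZ; exact: cderiv_monomial.
have H := cderivM (@cderiv_cpower _ _ _ (fun q => - z q - 1) lam_log (fun s => fpoly (x s) p) _ _ re dF) (cderiv_lmonomial e).
have eqD a b : a = b -> cderiv (fun s => integrand z e (x s) p) t a ->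
  cderiv (fun s => integrand z e (x s) p) t b by move=> ->.
apply: eqD H.
rewrite /integrand_partial; under [RHS]eq_bigr do rewrite -mulrA mulrDl.
rewrite -[RHS]mulr_sumr big_split addrC mulrDr; congr (_ + _).
  by rewrite mulrA; congr (_ * _); apply: eq_bigr => l _; rewrite mulrAC.
rewrite [RHS]mulrAC; congr (_ * _ * _).
under [RHS]eq_bigr do rewrite mulr_suml.
rewrite [RHS]exchange_big /=; apply: eq_bigr => q _.
under [RHS]eq_bigr do rewrite -mulrA.
rewrite -[RHS]mulr_sumr -mulrA; congr (_ * _).
under [RHS]eq_bigr do rewrite mulrAC.
rewrite -[RHS]mulr_suml; congr (_ / _).
under [RHS]eq_bigr do rewrite mulr_suml.
rewrite [RHS]exchange_big /=; apply: eq_bigr => a _.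
rewrite !mulr_sumr; apply: eq_bigr => l _.
by ring.
Qed.

End Line.

Lemma cvg_integrand_partial z e p c t l : good p -> unit_cube t ->
  {for t, continuous (fun t => integrand_partial z e p l (chain_cube ga c t))}.
Proof.
move=> [sg nz re] tc.
have cx := smooth_cube_cvg (sg c) t.
have cp w : (fun _ : 'rV[R]_N => p 0 w) u @[u --> t] --> p 0 w by exact: (@cvgC_cst R _ (nbhs t) _ (p 0 w)).
have rec q : complex.Re (fpoly (chain_cube ga c t) p q) < 0 by exact: re.
have F0 q : fpoly (chain_cube ga c t) p q != 0.
  by apply: contraTneq (rec q) => ->; rewrite /= ltxx.
have cF q : fpoly (chain_cube ga c u) p q @[u --> t] --> fpoly (chain_cube ga c t) p q.
  exact: (@cvg_fpoly _ _ _ _ _ _ _ _ _ (nbhs t) _ _ (fun=> p)).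
have cV : (chain_cube ga c u 0 l)^-1 @[u --> t] --> (chain_cube ga c t 0 l)^-1.
  by apply: (@cvgC_inv _ _ (nbhs t)); [exact: nz|exact: cx].
have ccst (b : C) : (fun _ : 'rV[R]_N => b) u @[u --> t] --> b by exact: (@cvgC_cst R _ (nbhs t) _ b).
apply: (@cvgC_mul _ _ (nbhs t)).
  apply: (@cvgC_mul _ _ (nbhs t)).
    exact: (@cvg_cpower _ _ _ _ lam_log _ (nbhs t) _ (fun t => fpoly (chain_cube ga c t) p) _ rec cF).
  by apply: (@cvg_lmonomial _ _ _ (nbhs t)) => // j; exact: nz.
apply: (@cvgC_add _ _ (nbhs t)).
  by apply: (@cvgC_mul _ _ (nbhs t)); [exact: ccst|exact: cV].
apply: (@cvgC_sum _ _ (nbhs t)) => q _.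
apply: (@cvgC_mul _ _ (nbhs t)); first exact: ccst.
apply: (@cvgC_mul _ _ (nbhs t)); last first.
  by apply: (@cvgC_inv _ _ (nbhs t)); [exact: F0|exact: cF].
apply: (@cvgC_sum _ _ (nbhs t)) => a _.
apply: (@cvgC_mul _ _ (nbhs t)); first exact: ccst.
apply: (@cvgC_mul _ _ (nbhs t)).
  exact: (@cvg_monomial _ _ _ (nbhs t)).
by apply: (@cvgC_mul _ _ (nbhs t)); [exact: ccst|exact: cV].
Qed.

(** Stokes' theorem is applied to x_j times the integrand. Its derivative in x_j has the factor e_j
    + 1, and the extra x_j absorbs the 1 / x_j of every logarithmic derivative. *)
Lemma integral_Stokes z e p j : good p ->
  (forall f : 'rV[R]_m -> 'rV[C]_N, ~ degenerate_cube f -> boundary_coef ga f = 0) ->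
  (e j + 1)%:~R * J z e p + \sum_a (al a j)%:R * coef ind p a *
    ((- z (blk a) - 1) * J (shiftz z (blk a)) (shifte e (al a)) p) = 0.
Proof.
move=> gp bga; have [sg nz re] := gp.
pose e' := shifte e (fun l => (l == j)%:R).
have H : chain_integral ga (integrand_partial z e' p j) = 0.
  apply: (chain_Stokes sg bga (g := fun x => integrand z e' x p)
    (Dg := integrand_partial z e' p)).
  - move=> c t tc.
    have cx := smooth_cube_cvg (sg c) t.
    have rec q : complex.Re (fpoly (chain_cube ga c t) p q) < 0 by exact: re.
    have cp w : (fun _ : 'rV[R]_N => p 0 w) u @[u --> t] --> p 0 w by exact: (@cvgC_cst R _ (nbhs t) _ (p 0 w)).
    apply: (@cvgC_mul _ _ (nbhs t)).
      apply: (@cvg_cpower _ _ _ _ lam_log _ (nbhs t) _ (fun t => fpoly (chain_cube ga c t) p) _ rec) => q.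
      exact: (@cvg_fpoly _ _ _ _ _ _ _ _ _ (nbhs t) _ _ (fun=> p)).
    by apply: (@cvg_lmonomial _ _ _ (nbhs t)) => // l; exact: nz.
  - by move=> c l t; exact: cvg_integrand_partial.
  - move=> c t i tc.
    have := @cderiv_integrand (fun h : R => chain_cube ga c (t + h *: delta_mx 0 i)) 0
      (fun l => cube_jacobian (chain_cube ga c) t i l).
    rewrite scale0r addr0; apply.
    + by move=> l; exact: cderiv_cube.
    + by move=> l; exact: nz.
    + by move=> q; exact: re.
(* The index type [unit + A] gathers the leading term and the terms of the monomials into one finite
   sum, as in [chain_integral_sum]. *)
pose cc (o : unit + A) : C := if o is inr a then (al a j)%:R * coef ind p a * (- z (blk a) - 1)
  else (e j + 1)%:~R.
pose zz (o : unit + A) := if o is inr a then shiftz z (blk a) else z.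
pose ee (o : unit + A) := if o is inr a then shifte e (al a) else e.
have := chain_integral_sum lam_log predT cc zz ee gp.
rewrite big_sumType /= (big_pred1 tt); last by case.
move=> E; under eq_bigr do rewrite mulrA.
rewrite -[LHS]E -[RHS]H; apply: chain_integral_eq => c t tc.
rewrite big_sumType /= (big_pred1 tt); last by case.
set x := chain_cube ga c t.
have rt q : complex.Re (fpoly x p q) < 0 by exact: re.
have xt l : x 0 l != 0 by exact: nz.
rewrite /integrand_partial.
have -> : integrand z e' x p = integrand z e x p * x 0 j.
  rewrite /integrand -mulrA; congr (_ * _).
  rewrite /lmonomial (bigD1 j)//= [in RHS](bigD1 j)//= mulrAC /e' /shifte eqxx.
  rewrite expfzDr// expr1z; congr (_ * _); apply: eq_bigr => l /negbTE ->.
  by rewrite addr0.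
rewrite -mulrA mulrDr mulrDr; congr (_ + _).
  rewrite /e' /shifte eqxx mulrC; congr (_ * _).
  by rewrite mulrC divfK.
rewrite (partition_big blk predT)//= mulr_sumr mulr_sumr; apply: eq_bigr => q _.
rewrite mulr_suml !mulr_sumr; apply: eq_bigr => a /eqP <-.
rewrite (integrand_shift lam_log z e (blk a) (al a) rt xt).
have F0 : fpoly x p (blk a) != 0.
  by apply: contraTneq (rt (blk a)) => ->; rewrite /= ltxx.
move: F0 (xt j); move: (fpoly x p _) (x 0 j) => F y F0 y0.
by field; rewrite F0 y0.
Qed.

End FibreStokes.

(** * The Horn system *)

Section AffineOperators.
Variables (R : realType) (n : nat).
Local Notation C := R[i].
Implicit Types (g : 'rV[C]_n -> C) (V : set 'rV[C]_n) (P : mpoly n C).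

Lemma apply_op_lin_sum V P (I : Type) (r : seq I) (d : I -> C) (f : I -> 'rV[C]_n -> C) g :
  open V -> smooth_on V g -> (forall i, smooth_on V (f i)) ->
  eq_on V (apply_op P (fun p => g p + \sum_(i <- r) d i * f i p))
    (fun p => apply_op P g p + \sum_(i <- r) d i * apply_op P (f i) p).
Proof.
move=> oV sg sf; elim: r => [|i r IH] p Vp.
  rewrite big_nil addr0; apply: apply_op_eq_on Vp => // q _.
  by rewrite big_nil addr0.
have sr : smooth_on V (fun p => g p + \sum_(i <- r) d i * f i p).
  apply: smoothD => //; apply: smooth_sum => // i' _; apply: smoothM => //.
  exact: smooth_cst.
rewrite big_cons addrCA -(IH p Vp) -(apply_op_lin P (d i) oV (sf i) sr Vp).
by apply: apply_op_eq_on Vp => // q _; rewrite big_cons addrCA.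
Qed.

Lemma apply_op0 P p : apply_op P (fun=> 0) p = 0.
Proof.
have s0 : smooth_on setT (fun _ : 'rV[C]_n => 0 : C) by exact: smooth_cst.
have /(_ p I) := apply_op_lin P (-1) openT s0 s0.
have -> : (fun _ : 'rV[C]_n => -1 * (0 : C) + 0) = fun=> 0.
  by apply/funext => q; rewrite mulr0 addr0.
by rewrite mulN1r addNr.
Qed.

Lemma apply_op_scale V P g c : open V -> smooth_on V g ->
  eq_on V (apply_op P (fun p => c * g p)) (fun p => c * apply_op P g p).
Proof.
move=> oV sg p Vp; have s0 : smooth_on V (fun=> 0 : C) by exact: smooth_cst.
have := apply_op_lin P c oV sg s0 Vp; rewrite apply_op0 addr0 => <-.
by apply: apply_op_eq_on Vp => // q _; rewrite addr0.
Qed.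

Lemma apply_op_affine V P g (c : C) (d : 'I_n -> C) : open V -> smooth_on V g ->
  eq_on V (apply_op (P * (mpolyC n c + \sum_w d w *: mpolyX C (mnm1 w))) g)
    (apply_op P (fun p => c * g p + \sum_w d w * euler w g p)).
Proof.
move=> oV sg p Vp.
have sc : smooth_on V (fun p => c * g p) by apply: smoothM => //; exact: smooth_cst.
have se w : smooth_on V (euler w g) by exact: smooth_euler.
rewrite (apply_op_lin_sum P _ d oV sc se Vp) mulrDr apply_opD; congr (_ + _).
  by rewrite mulrC mul_mpolyC apply_opZ (apply_op_scale P c oV sg Vp).
rewrite mulr_sumr apply_op_sum; apply: eq_bigr => w _.
by rewrite -scalerAr apply_opZ (apply_op_mulX P w oV sg Vp).
Qed.

End AffineOperators.

Section EulerMonomials.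
Variables (R : realType) (n : nat).
Local Notation C := R[i].
Implicit Types (f g : 'rV[C]_n -> C).

Lemma eulerM f g w p : differentiable f p -> differentiable g p ->
  euler w (fun q => f q * g q) p = euler w f p * g p + f p * euler w g p.
Proof. by move=> df dg; rewrite /euler partialM// mulrDr; congr (_ + _); [exact: mulrA|exact: mulrCA]. Qed.

Lemma euler_coordX w w' c (p : 'rV[C]_n) :
  euler w (fun q : 'rV[C]_n => q 0 w' ^+ c) p = (w' == w)%:R * c%:R * p 0 w' ^+ c.
Proof.
have dX r : differentiable (fun q : 'rV[C]_n => q 0 w' ^+ r) p.
  have sm : smooth_on setT (fun q : 'rV[C]_n => q 0 w' ^+ r).
    by apply: smoothX; [exact: openT|exact: smooth_coord].
  exact: smooth_differentiable sm I.
elim: c => [|c IH]; first by rewrite mulr0 mul0r /euler partial_cst mulr0.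
have -> : (fun q : 'rV[C]_n => q 0 w' ^+ c.+1) = fun q => q 0 w' * q 0 w' ^+ c.
  by apply/funext => q; rewrite exprS.
rewrite eulerM ?IH//; last exact: differentiable_coord.
rewrite /euler partial_coord exprS -natr1.
case: eqVneq => [->|_]; last by rewrite mulr0 !mul0r mulr0 addr0.
by rewrite !mulr1n; move: (p 0 w) (p 0 w ^+ c) => X Y; ring.
Qed.

Lemma euler_coord_prod w (c : 'I_n -> nat) (p : 'rV[C]_n) :
  euler w (fun q : 'rV[C]_n => \prod_w' q 0 w' ^+ c w') p =
  (\sum_w' (w' == w)%:R * (c w')%:R) * \prod_w' p 0 w' ^+ c w'.
Proof.
have smX w' : smooth_on setT (fun q : 'rV[C]_n => q 0 w' ^+ c w').
  by apply: smoothX; [exact: openT|exact: smooth_coord].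
have H (s : seq 'I_n) : smooth_on setT (fun q : 'rV[C]_n => \prod_(w' <- s) q 0 w' ^+ c w') /\
    euler w (fun q : 'rV[C]_n => \prod_(w' <- s) q 0 w' ^+ c w') p =
    (\sum_(w' <- s) (w' == w)%:R * (c w')%:R) * \prod_(w' <- s) p 0 w' ^+ c w'.
  elim: s => [|w' s [sm IH]].
    have -> : (fun q : 'rV[C]_n => \prod_(w' <- [::]) q 0 w' ^+ c w') = fun=> 1.
      by apply/funext => q; rewrite big_nil.
    by split; [exact: smooth_cst|rewrite /euler partial_cst mulr0 !big_nil mul0r].
  have -> : (fun q : 'rV[C]_n => \prod_(w' <- w' :: s) q 0 w' ^+ c w') =
      fun q => q 0 w' ^+ c w' * \prod_(w' <- s) q 0 w' ^+ c w'.
    by apply/funext => q; rewrite big_cons.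
  split; first exact: (smoothM openT (smX w') sm).
  have d1 := smooth_differentiable (smX w') (I : setT p).
  have d2 := smooth_differentiable sm (I : setT p).
  rewrite (eulerM w d1 d2) IH euler_coordX !big_cons.
  by move: (p 0 w' ^+ c w') (\prod_(_ <- s) _) => X Y; ring.
exact: (H _).2.
Qed.

End EulerMonomials.

Section HornSystem.
Variables (R : realType) (m k d : nat).
Local Notation C := R[i].
Local Notation N := m.+1.
Local Notation A := 'I_(N + (d + (k + k))).
Variables (blk : A -> 'I_k) (al : A -> 'I_N -> nat) (ind : 'I_(k + d) -> A).
Hypothesis ind_inj : injective ind.
Variables (lam : 'I_k -> C -> C).
Hypothesis lam_log : forall l, log_branch (lam l).
Variable ga : chain R N.
Hypothesis bga : forall f : 'rV[R]_m -> 'rV[C]_N, ~ degenerate_cube f -> boundary_coef ga f = 0.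
Variables (Dl : nat) (L M : 'M[int]_(N + (d + (k + k)))).
Variables (ii : 'I_N -> int) (zeta : 'I_k -> C).
Local Notation J := (integral blk al ind lam ga).
Local Notation good := (good blk al ind ga).

(* The row of M belonging to the parameter w. *)
Definition param_index (w : 'I_(k + d)) : A :=
  match fintype.split w with
  | inl q => rshift N (rshift d (lshift k q))
  | inr r => rshift N (lshift _ r)
  end.

Hypothesis Dl_gt0 : (0 < Dl)%N.
Hypothesis ML : M *m L = Dl%:R%:M.
Hypothesis LM : L *m M = Dl%:R%:M.
Hypothesis Lx : forall a j, L a (lshift _ j) = al a j.
Hypothesis Lp : forall a w, L a (param_index w) = (a == ind w)%:R.
Hypothesis Ly : forall a q, L a (rshift N (rshift d (rshift k q))) = (blk a == q)%:R.

Variable V : set 'rV[C]_(k + d).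
Hypothesis oV : open V.
Hypothesis V_good : V `<=` good.

Implicit Types (b : A -> nat) (a : A) (p : 'rV[C]_(k + d)) (l : 'I_k) (w : 'I_(k + d)).

Definition block_size b l : nat := \sum_(a | blk a == l) b a.
Definition zeta_shift b l : C := zeta l + (block_size b l)%:R.
Definition ii_shift b j : int := ii j + Posz (\sum_a b a * al a j).
Definition incr b a n : A -> nat := fun a' => (b a' + (a' == a) * n)%N.

(** The falling factorials of - zeta_l - 1 produced by differentiating the powers of f_l. They may
    vanish for special [zeta], so they remain a factor of the integral and are never divided by. *)
Definition pochhammer b : C :=
  \prod_l \prod_(i < block_size b l) (- (zeta l + i%:R) - 1).

Definition monomial_integral b p : C :=
  pochhammer b * J (zeta_shift b) (ii_shift b) p.

(* The integral of prod_a (c_a x^(al a) d / d f_(blk a))^(b a) applied to the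
   integrand, c_a being the coefficient of the a-th monomial. *)
Definition term_integral b p : C :=
  \prod_w p 0 w ^+ b (ind w) * monomial_integral b p.
Local Notation E := term_integral.

Lemma block_size_incr b a l : block_size (incr b a 1) l = (block_size b l + (blk a == l))%N.
Proof.
rewrite /block_size /incr big_split /=; congr addn.
rewrite big_mkcond /= (bigD1 a)//= eqxx muln1 big1 ?addn0 => [|a' /negbTE ->]; last by case: ifP.
by case: ifP.
Qed.

Lemma monomial_integral_incr b a p : monomial_integral (incr b a 1) p =
  pochhammer b * (- zeta_shift b (blk a) - 1) *
  J (shiftz (zeta_shift b) (blk a)) (shifte (ii_shift b) (al a)) p.
Proof.
rewrite /monomial_integral.
have -> : zeta_shift (incr b a 1) = shiftz (zeta_shift b) (blk a).
  apply/funext => l; rewrite /zeta_shift /shiftz block_size_incr natrD addrA.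
  by rewrite [l == _]eq_sym.
have -> : ii_shift (incr b a 1) = shifte (ii_shift b) (al a).
  apply/funext => j; rewrite /ii_shift /shifte -addrA -PoszD; congr (_ + Posz _).
  rewrite /incr; under eq_bigr do rewrite mulnDl.
  rewrite big_split /=; congr addn.
  rewrite (bigD1 a)//= eqxx !mul1n big1 ?addn0 => [//|a' /negbTE ->].
  by rewrite mul0n.
congr (_ * _); rewrite /pochhammer (bigD1 (blk a))//= [in RHS](bigD1 (blk a))//=.
rewrite block_size_incr eqxx addn1 big_ord_recr /= [RHS]mulrAC; congr (_ * _).
apply: eq_bigr => l; rewrite block_size_incr eq_sym => /negbTE ->.
by rewrite addn0.
Qed.

Lemma coef_prod b p : \prod_w p 0 w ^+ b (ind w) = \prod_a coef ind p a ^+ b a.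
Proof.
rewrite [RHS](bigID (fun a => [exists w, ind w == a])) /= [X in _ * X]big1 ?mulr1.
  rewrite [RHS](eq_bigl (fun a => a \in [set ind w | w in [set: 'I_(k + d)]]%SET)).
    rewrite big_imset /=; last by move=> w w' _ _; exact: ind_inj.
    by rewrite [RHS](eq_bigl predT) => [|w]; [apply: eq_bigr => w _; rewrite coef_ind|rewrite inE].
  move=> a; apply/existsP/imsetP => [[w /eqP wa]|[w _ ->]].
    by exists w => //; rewrite inE.
  by exists w.
by move=> a /existsPn na; rewrite coef_notin ?expr1n.
Qed.

Lemma term_integral_incr b a p : E (incr b a 1) p =
  \prod_w p 0 w ^+ b (ind w) * (pochhammer b * ((- zeta_shift b (blk a) - 1) *
  (coef ind p a * J (shiftz (zeta_shift b) (blk a)) (shifte (ii_shift b) (al a)) p))).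
Proof.
rewrite /E monomial_integral_incr !coef_prod.
have -> : \prod_a' coef ind p a' ^+ incr b a 1 a' =
    (\prod_a' coef ind p a' ^+ b a') * coef ind p a.
  rewrite (bigD1 a)//= [in RHS](bigD1 a)//= mulrAC /incr eqxx exprD; congr (_ * _).
  by apply: eq_bigr => a' /negbTE ->; rewrite mul0n addn0.
by rewrite -!mulrA; congr (_ * _); rewrite mulrCA; congr (_ * _); rewrite mulrCA.
Qed.

Lemma smooth_monomial_integral b : smooth_on V (monomial_integral b).
Proof.
apply: smoothM => //; first exact: smooth_cst.
exact: (smooth_integral ind_inj lam_log).
Qed.

Lemma smooth_coord_prod b (P : pred 'I_(k + d)) :
  smooth_on V (fun p => \prod_(w | P w) p 0 w ^+ b (ind w)).
Proof.
have H (s : seq 'I_(k + d)) : smooth_on V (fun p => \prod_(w <- s | P w) p 0 w ^+ b (ind w)).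
  elim: s => [|w s IH].
    have -> : (fun p : 'rV[C]_(k + d) => \prod_(w <- [::] | P w) p 0 w ^+ b (ind w)) = fun=> 1.
      by apply/funext => p; rewrite big_nil.
    exact: smooth_cst.
  have -> : (fun p : 'rV[C]_(k + d) => \prod_(w <- w :: s | P w) p 0 w ^+ b (ind w)) =
    fun p => (if P w then p 0 w ^+ b (ind w) else 1) * \prod_(w <- s | P w) p 0 w ^+ b (ind w).
    by apply/funext => p; rewrite big_cons; case: ifP => // _; rewrite mul1r.
  apply: (smoothM oV _ IH); case Pw: (P w); last exact: smooth_cst.
  by apply: smoothX => //; exact: smooth_coord.
exact: H.
Qed.

Lemma smooth_term_integral b : smooth_on V (E b).
Proof. exact: (smoothM oV (smooth_coord_prod b predT) (smooth_monomial_integral b)). Qed.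

Lemma euler_term_integral b w p : V p ->
  euler w (E b) p = (b (ind w))%:R * E b p + E (incr b (ind w) 1) p.
Proof.
move=> Vp; have [dJ pJ] := integral_partial ind_inj lam_log (zeta_shift b) (ii_shift b) oV V_good Vp.
have d1 := smooth_differentiable (smooth_coord_prod b predT) Vp.
have d2 := smooth_differentiable (smooth_monomial_integral b) Vp.
rewrite /E (eulerM w d1 d2) euler_coord_prod.
have -> : \sum_w' (w' == w)%:R * (b (ind w'))%:R = (b (ind w))%:R :> C.
  by rewrite (bigD1 w)//= eqxx mul1r big1 ?addr0// => w' /negbTE ->; rewrite mul0r.
rewrite -mulrA; congr (_ + _).
transitivity (E (incr b (ind w) 1) p); last exact: erefl.
rewrite term_integral_incr (coef_ind ind_inj); congr (_ * _).
rewrite /euler /monomial_integral partialZ// pJ.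
by move: (J _ _ _) (pochhammer b) (p 0 w) (zeta_shift _ _) => X Y Z T; ring.
Qed.

(** [integral_block] involves the shifted exponent [zeta_shift b q]; its shift [block_size b q] is
    moved to the right and spread as one [(b a)%:R] over each monomial of the block.
    [term_integral_Stokes] treats [ii_shift] in the same way. *)
Lemma term_integral_block b q p : V p -> (zeta q + 1) * E b p =
  - \sum_(a | blk a == q) (E (incr b a 1) p + (b a)%:R * E b p).
Proof.
move=> Vp; rewrite big_split /= -mulr_suml opprD.
under eq_bigr => a _ do rewrite term_integral_incr.
rewrite -mulr_sumr -mulr_sumr.
have -> : \sum_(a | blk a == q) (- zeta_shift b (blk a) - 1) * (coef ind p a *
     J (shiftz (zeta_shift b) (blk a)) (shifte (ii_shift b) (al a)) p) =
   (- zeta_shift b q - 1) * J (zeta_shift b) (ii_shift b) p.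
  rewrite (integral_block lam_log (zeta_shift b) (ii_shift b) q (V_good Vp)) mulr_sumr.
  by apply: eq_bigr => a /eqP ->.
rewrite -natr_sum -/(block_size b q) /E /monomial_integral /zeta_shift.
by move: (\prod_w _) (pochhammer b) (J _ _ _) (block_size b q)%:R => X Y Z T; ring.
Qed.

Lemma term_integral_Stokes b j p : V p -> (ii j + 1)%:~R * E b p =
  - \sum_a (al a j)%:R * (E (incr b a 1) p + (b a)%:R * E b p).
Proof.
move=> Vp; under eq_bigr do rewrite mulrDr.
rewrite big_split /= opprD.
under [X in _ = - X - _]eq_bigr => a _ do rewrite term_integral_incr mulrCA [_%:R * (_ * _)]mulrCA.
rewrite -mulr_sumr -mulr_sumr.
have H := integral_Stokes lam_log (zeta_shift b) (ii_shift b) j (V_good Vp) bga.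
rewrite (eq_bigr (fun a => (al a j)%:R * coef ind p a * ((- zeta_shift b (blk a) - 1) *
  J (shiftz (zeta_shift b) (blk a)) (shifte (ii_shift b) (al a)) p))) => [|a _]; last first.
  by rewrite -!mulrA; congr (_ * _); rewrite mulrCA.
have -> : \sum_a (al a j)%:R * ((b a)%:R * E b p) = (\sum_a b a * al a j)%:R * E b p.
  rewrite natr_sum mulr_suml; apply: eq_bigr => a _.
  by rewrite natrM mulrA [_ * (b a)%:R]mulrC.
move/eqP: H; rewrite addrC addr_eq0 => /eqP ->.
rewrite /E /monomial_integral /ii_shift.
rewrite !rmorphD /= -!pmulrn.
by move: (\prod_w _) (pochhammer b) (J _ _ _) (_ *+ _) => X Y Z T; ring.
Qed.

Definition weight a w : C := - (Dl%:R^-1 * (M (param_index w) a)%:~R).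

Definition offset a : C := Dl%:R^-1 *
  (\sum_j (ii j + 1)%:~R * (M (lshift _ j) a)%:~R +
   \sum_l (zeta l + 1) * (M (rshift N (rshift d (rshift k l))) a)%:~R).

Lemma param_indexl q : param_index (lshift d q) = rshift N (rshift d (lshift k q)).
Proof. by rewrite /param_index (unsplitK (inl q : 'I_k + 'I_d)%type). Qed.

Lemma param_indexr r : param_index (rshift k r) = rshift N (lshift (k + k) r).
Proof. by rewrite /param_index (unsplitK (inr r : 'I_k + 'I_d)%type). Qed.

Lemma param_index_inj : injective param_index.
Proof.
move=> w w'; case: (split_ordP w) => q ->; case: (split_ordP w') => q' ->;
  rewrite ?param_indexl ?param_indexr => /eqP; rewrite !eq_shift => /eqP.
- by move=> ->.
- by [].
- by [].
- by move=> ->.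
Qed.

Lemma param_index_x w j : (param_index w == lshift _ j) = false.
Proof.
by case: (split_ordP w) => q ->; rewrite ?param_indexl ?param_indexr !eq_shift.
Qed.

Lemma param_index_y w l :
  (param_index w == rshift N (rshift d (rshift k l))) = false.
Proof.
by case: (split_ordP w) => q ->; rewrite ?param_indexl ?param_indexr !eq_shift.
Qed.

Lemma calL_affine a : calL_theta Dl M ii zeta a =
  mpolyC (k + d) (offset a) + \sum_w weight a w *: mpolyX C (mnm1 w).
Proof.
have -> : \sum_w weight a w *: mpolyX C (mnm1 w) =
    (Dl%:R^-1 : C) *: \sum_w - ((M (param_index w) a)%:~R : C) *: mpolyX C (mnm1 w).
  by rewrite scaler_sumr; apply: eq_bigr => w _; rewrite scalerA /weight mulrN.
rewrite /offset mpolyCM mul_mpolyC -scalerDr.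
rewrite /calL_theta /calL; congr (_ *: _).
rewrite big_split_ord /= rmorphD !rmorph_sum /= big_split /=.
rewrite -!addrA; congr (_ + _).
  apply: eq_bigr => j _.
  by rewrite rmorphM !rmorph_int mulrzz intrM.
rewrite addrCA [RHS]addrCA; congr (_ + _).
  by apply: eq_bigr => l _; rewrite param_indexl scaleNr scaler_int mulNrz.
rewrite addrC; congr (_ + _).
  by apply: eq_bigr => l _; rewrite rmorphM rmorph_int mulrzr.
by apply: eq_bigr => r _; rewrite param_indexr scaleNr scaler_int mulNrz.
Qed.

Lemma sum_over_variables (F : A -> C) : \sum_v F v =
  \sum_j F (lshift _ j) + \sum_w F (param_index w) +
  \sum_l F (rshift N (rshift d (rshift k l))).
Proof.
rewrite !big_split_ord /= [X in _ + X + _]addrC -!addrA; congr (_ + (_ + _)).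
  by apply: eq_bigr => r _; rewrite param_indexr.
by congr (_ + _); apply: eq_bigr => q _; rewrite param_indexl.
Qed.

Lemma term_integral_calL b a p : V p ->
  (offset a + (b a)%:R) * E b p + \sum_w weight a w * euler w (E b) p = - E (incr b a 1) p.
Proof.
move=> Vp; pose T a := E (incr b a 1) p + (b a)%:R * E b p.
have ET w : euler w (E b) p = \sum_a' (L a' (param_index w))%:~R * T a'.
  rewrite euler_term_integral// (bigD1 (ind w))//= Lp eqxx mul1r big1 ?addr0 1?addrC//.
  by move=> a' /negbTE a'w; rewrite Lp a'w mul0r.
have Ex j : (ii j + 1)%:~R * E b p = - \sum_a' (L a' (lshift _ j))%:~R * T a'.
  by rewrite term_integral_Stokes//; congr (- _); apply: eq_bigr => a' _; rewrite Lx.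
have Ey l : (zeta l + 1) * E b p =
    - \sum_a' (L a' (rshift N (rshift d (rshift k l))))%:~R * T a'.
  rewrite term_integral_block// big_mkcond /=; congr (- _); apply: eq_bigr => a' _.
  by rewrite Ly; case: eqP => _; rewrite ?mul1r ?mul0r.
(* All relations read: column [v] of [L] paired with [T] is a known multiple of [E b p] or an Euler
   derivative. Weighting them by column [a] of [M] isolates [Dl%:R * T a], by [LM]. *)
have LMT : \sum_v (M v a)%:~R * \sum_a' (L a' v)%:~R * T a' = Dl%:R * T a.
  under eq_bigr do rewrite mulr_sumr.
  rewrite exchange_big /= (eq_bigr (fun a' => ((L *m M) a' a)%:~R * T a')) => [|a' _].
    rewrite LM (bigD1 a)//= mxE eqxx mulr1n rmorph_nat big1 ?addr0// => a' /negbTE a'a.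
    by rewrite mxE a'a mul0r.
  rewrite mxE rmorph_sum mulr_suml; apply: eq_bigr => v _.
  by rewrite rmorphM mulrA [X in X * _]mulrC.
have D0 : Dl%:R != 0 :> C by rewrite pnatr_eq0 -lt0n.
rewrite sum_over_variables in LMT.
rewrite mulrDl -addrA [X in _ + X]addrC addrA.
have -> : offset a * E b p + \sum_w weight a w * euler w (E b) p = - T a.
  apply: (mulfI D0); rewrite mulrN -LMT.
  rewrite /offset mulrDr -mulrA mulVKf// mulrDl !mulr_suml mulr_sumr.
  rewrite !opprD addrAC -!sumrN; congr (_ + _ + _); apply: eq_bigr.
  - by move=> j _; rewrite mulrAC Ex mulNr mulrC.
  - by move=> w _; rewrite ET /weight mulNr mulrN mulrA mulVKf.
  - by move=> l _; rewrite mulrAC Ey mulNr mulrC.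
by rewrite /T opprD -addrA addNr addr0.
Qed.

Local Notation calL a := (calL_theta Dl M ii zeta a).

Lemma apply_op_calL P b a p : V p ->
  apply_op (P * (calL a + (b a)%:R)) (E b) p = - apply_op P (E (incr b a 1)) p.
Proof.
move=> Vp; have -> : calL a + (b a)%:R = mpolyC (k + d) (offset a + (b a)%:R) +
    \sum_w weight a w *: mpolyX C (mnm1 w).
  by rewrite calL_affine addrAC mpolyCD [mpolyC _ _%:R]rmorph_nat.
rewrite (apply_op_affine _ _ _ oV (smooth_term_integral b) Vp).
rewrite -mulN1r -(apply_op_scale P (-1) oV (smooth_term_integral (incr b a 1)) Vp).
by apply: apply_op_eq_on Vp => // q Vq; rewrite term_integral_calL// mulN1r.
Qed.

(** From [b a = 0], the count of [a] is [j] once the factors 0, ..., j - 1 have acted, which is the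
    constant that [apply_op_calL] asks for in the next factor. *)
Lemma apply_op_rising P b a n p : V p -> b a = 0%N ->
  apply_op (P * \prod_(j < n) (calL a + j%:R)) (E b) p =
  (-1) ^+ n * apply_op P (E (incr b a n)) p.
Proof.
move=> Vp ba; elim: n P => [|n IH] P.
  rewrite big_ord0 mulr1 mul1r; congr (apply_op P (E _) p).
  by apply/funext => a'; rewrite /incr muln0 addn0.
(* Operators commute, so the factor with the largest constant is moved to the left and acts last. *)
rewrite big_ord_recr /= [X in P * X]mulrC mulrA IH.
have {2}-> : n = incr b a n a by rewrite /incr ba eqxx mul1n.
rewrite apply_op_calL// mulrN -mulNr exprS mulN1r; congr (_ * apply_op P (E _) p).
by apply/funext => a'; rewrite /incr muln1 mulnS -addnA; congr addn; exact: addnC.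
Qed.

(** As [s] has no repetition, the factors of one [a] leave the counts of the later ones at 0, the
    starting value for [apply_op_rising]. *)
Lemma apply_op_rising_prod P (s : seq A) (Q : pred A) (c : A -> nat) b p : V p -> uniq s ->
  (forall a, a \in s -> Q a -> b a = 0%N) ->
  apply_op (P * \prod_(a <- s | Q a) \prod_(j < c a) (calL a + j%:R)) (E b) p =
  (-1) ^+ (\sum_(a <- s | Q a) c a) *
    apply_op P (E (fun a => b a + ((a \in s) && Q a) * c a)%N) p.
Proof.
move=> Vp; elim: s b P => [|a s IH] b P /= us bs.
  rewrite !big_nil mulr1 mul1r; congr (apply_op P (E _) p).
  by apply/funext => a; rewrite addn0.
have /andP[as' us'] := us.
have bs' a' : a' \in s -> Q a' -> b a' = 0%N by move=> a's; apply: bs; rewrite inE a's orbT.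
rewrite !big_cons; case Qa: (Q a); last first.
  rewrite (IH b P us' bs'); congr (_ * apply_op P (E _) p); apply/funext => a'.
  by rewrite inE; case: (eqVneq a' a) => [->|_]; rewrite ?Qa ?andbF.
have ba : b a = 0%N by apply: bs; rewrite ?mem_head.
have bs2 a' : a' \in s -> Q a' -> incr b a (c a) a' = 0%N.
  move=> a's Qa'; rewrite /incr (bs' _ a's Qa'); case: (eqVneq a' a) => [a'a|_].
    by move: as'; rewrite -a'a a's.
  by rewrite mul0n.
rewrite [X in P * X]mulrC mulrA (apply_op_rising _ _ Vp ba) (IH _ _ us' bs2).
rewrite mulrA -exprD; congr (_ * apply_op P (E _) p); apply/funext => a'.
rewrite /incr inE; case: (eqVneq a' a) => [->|_]; last by rewrite addn0.
by rewrite (negbTE as') Qa mul0n addn0.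
Qed.

Section Row.
Variable w : 'I_(k + d).
Let row a : int := M (param_index w) a.
Let pos a : nat := ((0 < row a)%R * `|row a|)%N.
Let neg a : nat := ((row a < 0)%R * `|row a|)%N.

Lemma row_pos_neg a : row a = Posz (pos a) - Posz (neg a).
Proof.
rewrite /pos /neg; case: (ltgtP (row a) 0) => [r0|r0|->]; last by rewrite !mul0n.
  by rewrite mul0n mul1n sub0r ltz0_abs// opprK.
by rewrite mul0n mul1n subr0 gtz0_abs.
Qed.

Lemma row_sum (c : A -> int) v : (forall a, L a v = c a) ->
  \sum_a row a * c a = (param_index w == v)%:R * Dl%:R.
Proof.
move=> Lc; have := congr1 (fun B : 'M[int]__ => B (param_index w) v) ML.
rewrite !mxE mulr_natl => <-; apply: eq_bigr => a _.
by rewrite Lc.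
Qed.

(** An entry of [ML] with the negative terms moved across: the monomials with exponents [pos] and
    [neg] in the terms of F have the same degree in the variable [v], except that the former has
    [Dl] more when [v] belongs to [w]. *)
Lemma row_pos_neg_sum (c : A -> nat) v : (forall a, L a v = Posz (c a)) ->
  (\sum_a pos a * c a = (param_index w == v) * Dl + \sum_a neg a * c a)%N.
Proof.
move=> Lc; have := row_sum Lc.
have -> : \sum_a row a * c a =
    Posz (\sum_a pos a * c a)%N - Posz (\sum_a neg a * c a)%N.
  rewrite !(big_morph Posz PoszD (erefl (Posz 0))) -sumrB; apply: eq_bigr => a _.
  by rewrite row_pos_neg mulrBl !PoszM.
move/eqP; rewrite subr_eq => /eqP H; apply/eqP; rewrite -eqz_nat H PoszD PoszM.
by rewrite !natz.
Qed.

Lemma block_size_pos_neg l : block_size pos l = block_size neg l.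
Proof.
have := row_pos_neg_sum (c := fun a => (blk a == l : nat)) (v := rshift N (rshift d (rshift k l))).
have S (f : A -> nat) : (\sum_a f a * (blk a == l) = block_size f l)%N.
  rewrite /block_size [RHS]big_mkcond; apply: eq_bigr => a _.
  by case: eqP => _; rewrite ?muln1 ?muln0.
by rewrite !S param_index_y; apply => a; rewrite Ly; case: (_ == _).
Qed.

Lemma term_integral_pos_neg p : E pos p = p 0 w ^+ Dl * E neg p.
Proof.
have Hw w' : pos (ind w') = ((w' == w) * Dl + neg (ind w'))%N.
  have := row_pos_neg_sum (c := fun a => (a == ind w' : nat)) (v := param_index w').
  rewrite (inj_eq param_index_inj) eq_sym.
  have S (f : A -> nat) : (\sum_a f a * (a == ind w') = f (ind w'))%N.
    by rewrite (bigD1 (ind w'))//= eqxx muln1 big1 ?addn0// => a /negbTE ->; rewrite muln0.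
  by rewrite !S; apply => a; rewrite Lp; case: (_ == _).
have Hj j : (\sum_a pos a * al a j = \sum_a neg a * al a j)%N.
  have := row_pos_neg_sum (c := fun a => al a j) (v := lshift _ j).
  by rewrite param_index_x; apply => a; rewrite Lx.
rewrite /term_integral mulrA; congr (_ * _).
  rewrite (bigD1 w)//= [in RHS](bigD1 w)//= Hw eqxx mul1n exprD -!mulrA; congr (_ * (_ * _)).
  by apply: eq_bigr => w' /negbTE w'w; rewrite Hw w'w.
rewrite /monomial_integral.
have -> : zeta_shift pos = zeta_shift neg by apply/funext => l; rewrite /zeta_shift block_size_pos_neg.
have -> : ii_shift pos = ii_shift neg by apply/funext => j; rewrite /ii_shift Hj.
by congr (_ * _); apply: eq_bigr => l _; rewrite block_size_pos_neg.
Qed.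

Lemma sum_pos_neg : (\sum_a pos a = \sum_a neg a)%N.
Proof.
rewrite (partition_big blk predT)//= [RHS](partition_big blk predT)//=.
by apply: eq_bigr => l _; exact: block_size_pos_neg.
Qed.

Lemma sum_row_pos : \sum_(a | 0 < row a) row a = Posz (\sum_a pos a)%N.
Proof.
rewrite (big_morph Posz PoszD (erefl (Posz 0))) big_mkcond; apply: eq_bigr => a _.
by rewrite /pos; case: ltrP => r0; rewrite ?mul0n// mul1n gtz0_abs.
Qed.

Lemma sum_row_neg : - \sum_(a | row a < 0) row a = Posz (\sum_a neg a)%N.
Proof.
rewrite (big_morph Posz PoszD (erefl (Posz 0))) -sumrN big_mkcond; apply: eq_bigr => a _.
by rewrite /neg; case: ltrP => r0; rewrite ?mul0n// mul1n ltz0_abs.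
Qed.

Lemma term_integral0 p : E (fun=> 0%N) p = J zeta ii p.
Proof.
rewrite /term_integral /monomial_integral big1 ?mul1r//.
have Z l : block_size (fun=> 0%N) l = 0%N by rewrite /block_size big1.
rewrite /pochhammer big1 ?mul1r => [|l _]; last by rewrite Z big_ord0.
have -> : zeta_shift (fun=> 0%N) = zeta.
  by apply/funext => l; rewrite /zeta_shift Z mulr0n addr0.
have -> // : ii_shift (fun=> 0%N) = ii.
by apply/funext => j; rewrite /ii_shift big1 ?addr0.
Qed.

Lemma horn_pos_integral p : V p ->
  apply_op (horn_pos Dl M ii zeta row) (J zeta ii) p =
  (-1) ^+ (\sum_a pos a) * E pos p.
Proof.
move=> Vp.
have -> : J zeta ii = E (fun=> 0%N) by apply/funext => q; rewrite term_integral0.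
rewrite -[horn_pos _ _ _ _ _]mul1r /horn_pos.
rewrite (apply_op_rising_prod 1 (Q := fun a => 0 < row a) (fun a => `|row a|%N)
  Vp (index_enum_uniq A) (fun a _ _ => erefl (0%N))).
rewrite apply_op1; congr (_ ^+ _ * E _ p).
  by rewrite big_mkcond; apply: eq_bigr => a _; rewrite /pos; case: (0 < row a); rewrite ?mul1n.
by apply/funext => a; rewrite mem_index_enum.
Qed.

Lemma horn_neg_integral p : V p ->
  apply_op (horn_neg Dl M ii zeta row) (J zeta ii) p =
  (-1) ^+ (\sum_a neg a) * E neg p.
Proof.
move=> Vp.
have -> : J zeta ii = E (fun=> 0%N) by apply/funext => q; rewrite term_integral0.
rewrite -[horn_neg _ _ _ _ _]mul1r /horn_neg.
rewrite (apply_op_rising_prod 1 (Q := fun a => row a < 0) (fun a => `|row a|%N)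
  Vp (index_enum_uniq A) (fun a _ _ => erefl (0%N))).
rewrite apply_op1; congr (_ ^+ _ * E _ p).
  by rewrite big_mkcond; apply: eq_bigr => a _; rewrite /neg; case: (row a < 0); rewrite ?mul1n.
by apply/funext => a; rewrite mem_index_enum.
Qed.

Lemma horn_equation p : V p ->
  apply_op (horn_pos Dl M ii zeta row) (J zeta ii) p -
  p 0 w ^+ Dl * apply_op (horn_neg Dl M ii zeta row) (J zeta ii) p = 0.
Proof.
move=> Vp; rewrite horn_pos_integral// horn_neg_integral// term_integral_pos_neg.
by rewrite sum_pos_neg mulrCA subrr.
Qed.

End Row.
End HornSystem.
Arguments param_index {m k d} w.

(** * Degrees of the operators *)

Section Degrees.
Variables (R : realType) (n : nat).
Local Notation C := R[i].
Implicit Types P Q : mpoly n C.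

Lemma msize_affine (c : C) (d : 'I_n -> C) w : d w != 0 ->
  msize (mpolyC n c + \sum_i d i *: mpolyX C (mnm1 i)) = 2%N.
Proof.
move=> dw; apply/eqP; rewrite eqn_leq; apply/andP; split.
  apply: leq_trans (mmeasureD_le _ _ _) _; rewrite geq_max; apply/andP; split.
    by rewrite mmeasureC; case: (c == 0).
  apply: leq_trans (mmeasure_sum _ _ _ _) _; apply/bigmax_leqP => i _.
  by apply: leq_trans (msizeZ_le _ _) _; rewrite msizeX mdeg1.
have := @msize_mdeg_lt n C (mpolyC n c + \sum_i d i *: mpolyX C (mnm1 i)) (mnm1 w).
rewrite mdeg1; apply; rewrite mcoeff_msupp mcoeffD mcoeffC mnm1_eq0 mulr0 add0r.
rewrite raddf_sum (bigD1 w)//= mcoeffZ mcoeffX eqxx mulr1 big1 ?addr0// => i iw.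
by rewrite mcoeffZ mcoeffX eq_mnm1 (negbTE iw) mulr0.
Qed.

(** [op_degree] sends 0 to 0 through the truncated predecessor, hence additivity requires nonzero
    factors, and the induction carries the nonvanishing of the product along. *)
Lemma op_degree_prod (I : Type) (s : seq I) (Q : pred I) (F : I -> mpoly n C) :
  (forall i, Q i -> F i != 0) ->
  op_degree (\prod_(i <- s | Q i) F i) = (\sum_(i <- s | Q i) op_degree (F i))%N.
Proof.
move=> F0; pose T P e := P != 0 /\ op_degree P = e.
suff : T (\prod_(i <- s | Q i) F i) (\sum_(i <- s | Q i) op_degree (F i))%N by case.
apply: (big_rec2 (fun P e => T P e)); first by rewrite /T oner_neq0 /op_degree msize1.
move=> i P e Qi [P0 Pe]; split; first by rewrite mulf_neq0// F0.
rewrite /op_degree msizeM ?F0// -Pe /op_degree.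
have : (0 < msize P)%N by rewrite lt0n msize_poly_eq0.
have : (0 < msize (F i))%N by rewrite lt0n msize_poly_eq0 F0.
by case: (msize (F i)) => // u _; case: (msize P) => // v _; rewrite addSn addnS.
Qed.

End Degrees.

Section HornDegrees.
Variables (R : realType) (m k d : nat).
Local Notation C := R[i].
Local Notation N := m.+1.
Local Notation A := 'I_(N + (d + (k + k))).
Variables (Dl : nat) (M : 'M[int]_(N + (d + (k + k)))).
Variables (ii : 'I_N -> int) (zeta : 'I_k -> C).
Hypothesis Dl_gt0 : (0 < Dl)%N.
Variable w : 'I_(k + d).

(** Up to the factor - 1 / Dl, the entry of [M] is the coefficient of theta_w in [calL_theta]. It is
    nonzero for every [a] that occurs in the operators of [w], so none of their factors is
    constant. *)
Lemma op_degree_calL a (j : C) : M (param_index w) a != 0 ->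
  op_degree (calL_theta Dl M ii zeta a + mpolyC _ j) = 1%N.
Proof.
move=> Mwa; rewrite calL_affine addrAC -mpolyCD /op_degree (msize_affine _ (w := w))//.
rewrite /weight oppr_eq0 mulf_neq0 ?invr_neq0 ?intr_eq0//.
by rewrite pnatr_eq0 -lt0n.
Qed.

Lemma op_degree_rising (Q : pred A) (c : A -> nat) :
  (forall a, Q a -> M (param_index w) a != 0) ->
  op_degree (\prod_(a | Q a) \prod_(j < c a) (calL_theta Dl M ii zeta a + j%:R)) =
  (\sum_(a | Q a) c a)%N.
Proof.
move=> MQ.
have dL a (j : nat) : Q a -> op_degree (calL_theta Dl M ii zeta a + j%:R) = 1%N.
  by move=> Qa; rewrite -(op_degree_calL j%:R (MQ a Qa)) [mpolyC _ _%:R]rmorph_nat.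
have L0 a (j : nat) : Q a -> calL_theta Dl M ii zeta a + j%:R != 0.
  by move=> Qa; apply: contra_eq_neq (dL a j Qa) => ->; rewrite /op_degree msize0.
rewrite op_degree_prod => [|a Qa]; last by apply/prodf_neq0 => j _; exact: L0.
apply: eq_bigr => a Qa; rewrite op_degree_prod => [|j _]; last exact: L0.
by under eq_bigr do rewrite dL//; rewrite sum_nat_const card_ord muln1.
Qed.

Variables (blk : A -> 'I_k) (L : 'M[int]_(N + (d + (k + k)))).
Hypothesis ML : M *m L = Dl%:R%:M.
Hypothesis Ly : forall a q, L a (rshift N (rshift d (rshift k q))) = (blk a == q)%:R.

Lemma horn_degrees (row := fun a => M (param_index w) a) :
  [/\ Posz (op_degree (horn_pos Dl M ii zeta row)) = \sum_(a | 0 < row a) row a,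
      \sum_(a | 0 < row a) row a = - \sum_(a | row a < 0) row a &
      - \sum_(a | row a < 0) row a = Posz (op_degree (horn_neg Dl M ii zeta row))].
Proof.
rewrite /horn_pos /horn_neg.
rewrite (op_degree_rising (Q := fun a => 0 < row a)) => [|a /lt0r_neq0//].
rewrite (op_degree_rising (Q := fun a => row a < 0)) => [|a /ltr0_neq0//].
rewrite (sum_row_pos M w) (sum_row_neg M w) (sum_pos_neg ML Ly w).
have E (b : bool) (c : nat) : (b * c = if b then c else 0)%N by case: b; rewrite ?mul1n ?mul0n.
split=> //; last by congr Posz; rewrite [RHS]big_mkcond; apply: eq_bigr => a _; rewrite E.
rewrite -(sum_pos_neg ML Ly w).
by congr Posz; rewrite [LHS]big_mkcond; apply: eq_bigr => a _; rewrite E.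
Qed.

End HornDegrees.

(** * The rows of the exponent matrix *)

Section ExponentMatrix.
Variables (R : realType) (m k d : nat).
Local Notation C := R[i].
Local Notation N := m.+1.
Local Notation A := 'I_(N + (d + (k + k))).
Variables (tau : 'I_k -> nat) (alpha : forall l : 'I_k, 'I_(tau l) -> 'I_N -> nat).
Variable mu : 'I_d -> {l : 'I_k & 'I_(tau l)}.
Hypothesis mu_inj : injective mu.
Hypothesis sizeL : (\sum_(q < k) (tau q).+1 = N + (d + (k + k)))%N.

Local Notation term := {q : 'I_k & 'I_(tau q).+1}.
Local Notation L := (castmx (sizeL, erefl) (exponent_matrix alpha mu)).

Definition term_of_row (a : A) : term := tagnat.sig (cast_ord (esym sizeL) a).
Definition row_of_term (t : term) : A := cast_ord sizeL (tagnat.rank t).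

Lemma term_of_rowK : cancel term_of_row row_of_term.
Proof. by move=> a; rewrite /row_of_term tagnat.sigK cast_ordKV. Qed.

Lemma row_of_termK : cancel row_of_term term_of_row.
Proof. by move=> t; rewrite /term_of_row cast_ordK tagnat.rankK. Qed.

(** The last index [ord_max] of a block belongs to y_q s_q, so the monomials of f_q are its
    lifts. *)
Definition monomial_term (t : {l : 'I_k & 'I_(tau l)}) : term :=
  Tagged (fun q => 'I_(tau q).+1) (lift ord_max (tagged t)).
Definition constant_term (q : 'I_k) : term :=
  Tagged (fun q => 'I_(tau q).+1) (ord_max : 'I_(tau q).+1).

Definition monomial_of_term (t : term) : option {l : 'I_k & 'I_(tau l)} :=
  omap (fun i => Tagged (fun l => 'I_(tau l)) i) (unlift ord_max (tagged t)).

Lemma monomial_termK : pcancel monomial_term monomial_of_term.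
Proof. by case=> l i; rewrite /monomial_of_term /monomial_term /= liftK. Qed.

Variant term_spec : term -> Type :=
| MonomialTerm t : term_spec (monomial_term t)
| ConstantTerm q : term_spec (constant_term q).

Lemma termP t : term_spec t.
Proof.
case: t => q i; case: (unliftP ord_max i) => [i'|] ->.
  exact: (MonomialTerm (Tagged (fun l => 'I_(tau l)) i')).
exact: (ConstantTerm q).
Qed.

Lemma monomial_constant_term t q : (monomial_term t == constant_term q) = false.
Proof.
apply/negP => /eqP /(congr1 monomial_of_term).
by rewrite monomial_termK /monomial_of_term /constant_term /= unlift_none.
Qed.

Definition row_block (a : A) : 'I_k := tag (term_of_row a).

Definition row_exponent (a : A) (j : 'I_N) : nat :=
  if monomial_of_term (term_of_row a) is Some t then alpha (tagged t) j else 0%N.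

(* The row in which the parameter w is a factor of the monomial. *)
Definition param_row (w : 'I_(k + d)) : A :=
  row_of_term match fintype.split w with
  | inl q => constant_term q
  | inr r => monomial_term (mu r)
  end.

Lemma param_rowl q : param_row (lshift d q) = row_of_term (constant_term q).
Proof. by rewrite /param_row (unsplitK (inl q : 'I_k + 'I_d)%type). Qed.

Lemma param_rowr r : param_row (rshift k r) = row_of_term (monomial_term (mu r)).
Proof. by rewrite /param_row (unsplitK (inr r : 'I_k + 'I_d)%type). Qed.

Lemma param_row_inj : injective param_row.
Proof.
move=> w w'; case: (split_ordP w) => q ->; case: (split_ordP w') => q' ->;
  rewrite ?param_rowl ?param_rowr => /(can_inj row_of_termK).
- by move=> /(congr1 tag) /= ->.
- by move/eqP; rewrite eq_sym monomial_constant_term.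
- by move/eqP; rewrite monomial_constant_term.
- by move=> /(pcan_inj monomial_termK) /mu_inj ->.
Qed.

Lemma row_of_term_row t v : L (row_of_term t) v =
  (if unlift ord_max (tagged t) is Some i' then
      row_mx (\row_j Posz (alpha i' j))
        (row_mx (\row_r (is_modified_by mu r i')%:R) (row_mx 0 (delta_mx 0 (tag t))))
    else row_mx 0 (row_mx 0 (row_mx (delta_mx 0 (tag t)) (delta_mx 0 (tag t)))) :
    'rV[int]_(N + (d + (k + k)))) 0 v.
Proof.
rewrite castmxE /= cast_ord_id mxE.
have -> : cast_ord (esym sizeL) (row_of_term t) = tagnat.rank t by rewrite cast_ordK.
rewrite mxE /tagnat.sig1 /tagnat.sig2 tagnat.rankK.
by case: unlift => [i'|]; rewrite !mxE.
Qed.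

Lemma exponent_x a j : L a (lshift _ j) = row_exponent a j.
Proof.
rewrite -[a]term_of_rowK row_of_term_row /row_exponent row_of_termK /monomial_of_term.
by case: unlift => [i'|] /=; rewrite row_mxEl mxE.
Qed.

Lemma exponent_y a q : L a (rshift N (rshift d (rshift k q))) = (row_block a == q)%:R.
Proof.
rewrite -[a]term_of_rowK row_of_term_row /row_block row_of_termK.
by case: unlift => [i'|] /=; rewrite !row_mxEr mxE eqxx [q == _]eq_sym.
Qed.

Lemma exponent_param a w : L a (param_index w) = (a == param_row w)%:R.
Proof.
rewrite -[a]term_of_rowK row_of_term_row.
case: (termP (term_of_row a)) => [[l i]|q]; case: (split_ordP w) => q' ->;
  rewrite ?param_rowl ?param_rowr (can_eq row_of_termK) ?param_indexl ?param_indexr /=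
    ?liftK ?unlift_none ?row_mxEr ?row_mxEl ?mxE.
- by rewrite monomial_constant_term.
- by rewrite (inj_eq (pcan_inj monomial_termK)) /is_modified_by eq_sym.
- rewrite eqxx [q' == _]eq_sym; congr (nat_of_bool _)%:R.
  by apply/eqP/eqP => [->|/(congr1 tag)].
- by rewrite eq_sym monomial_constant_term.
Qed.

Lemma coef_monomial_term (p : 'rV[C]_(k + d)) l (i : 'I_(tau l)) :
  coef param_row p (row_of_term (monomial_term (Tagged (fun l => 'I_(tau l)) i))) =
  \prod_(r < d | is_modified_by mu r i) rsubmx p 0 r.
Proof.
rewrite /coef big_split_ord big1 /= ?mul1r => [|q]; last first.
  by rewrite param_rowl (can_eq row_of_termK) eq_sym monomial_constant_term.
apply: eq_big => [r|r _]; last by rewrite mxE.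
by rewrite param_rowr (can_eq row_of_termK) (inj_eq (pcan_inj monomial_termK)).
Qed.

Lemma sum_block_terms l (F : term -> C) : \sum_(t | tag t == l) F t =
  \sum_(i < (tau l).+1) F (Tagged (fun q => 'I_(tau q).+1) i).
Proof.
have := sig_big_dep (J := fun q => 'I_(tau q).+1 : finType) (fun q => q == l)
  (fun q i => true) (fun q i => F (Tagged (fun q => 'I_(tau q).+1) i)) (op := +%R) (idx := 0).
rewrite big_pred1_eq => ->; apply: eq_big => [t|[q i] //].
by rewrite andbT.
Qed.

(** It links the concrete data to the indexing by rows: s_l becomes the coefficient of the last row
    of block l, whose exponent is 0. *)
Lemma fibre_polyE l (x : 'rV[C]_N) (p : 'rV[C]_(k + d)) :
  fibre_poly alpha mu l x p = fpoly row_block row_exponent param_row x p l.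
Proof.
rewrite /fibre_poly /deformed_poly /fpoly.
rewrite (reindex row_of_term) /=; last first.
  by exists term_of_row => [t _|a _]; [exact: row_of_termK|exact: term_of_rowK].
rewrite (eq_bigl (fun t : term => tag t == l)) => [|t]; last by rewrite /row_block row_of_termK.
rewrite (sum_block_terms l (fun t => coef param_row p (row_of_term t) *
  monomial x (row_exponent (row_of_term t)))).
rewrite big_ord_recr /=; congr (_ + _).
  apply: eq_bigr => i _.
  have -> : widen_ord (leqnSn (tau l)) i = lift ord_max i by apply: ord_inj; rewrite lift_max.
  rewrite -(coef_monomial_term p i); congr (_ * _).
  by apply: eq_bigr => j _; rewrite /row_exponent row_of_termK /monomial_of_term /= liftK.
rewrite -/(constant_term l) -param_rowl (coef_ind param_row_inj) mxE.
rewrite /monomial big1 ?mulr1// => j _.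
by rewrite /row_exponent param_rowl row_of_termK /monomial_of_term /= unlift_none expr0.
Qed.

End ExponentMatrix.

(** * Branches of the fibre integral *)

Lemma reduced_inverse_mul n (L M : 'M[int]_n) (Dl : nat) :
  \det L != 0 -> reduced_inverse L Dl M ->
  [/\ (0 < Dl)%N, M *m L = Dl%:R%:M & L *m M = Dl%:R%:M].
Proof.
move=> detL [Dl0 ME _].
have uL : map_mx (intr : int -> rat) L \in unitmx.
  by rewrite unitmxE det_map_mx unitfE intr_eq0.
have inj (B B' : 'M[int]_n) : map_mx (intr : int -> rat) B = map_mx intr B' -> B = B'.
  by move/matrixP => BB; apply/matrixP => i j; have := BB i j; rewrite !mxE => /intr_inj.
split=> //; apply: inj; rewrite map_mxM ME map_scalar_mx rmorph_nat /=.
  by rewrite -scalemxAl mulVmx// scale_scalar_mx mulr1.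
by rewrite -scalemxAr mulmxV// scale_scalar_mx mulr1.
Qed.

(** The left-hand side of the equation is itself holomorphic on [V] and depends on the function only
    near the point; it vanishes on [W], and the identity theorem extends this to [V]. *)
Lemma apply_op_equation_eq_on (R : realType) n (V W : set 'rV[R[i]]_n) P Q
    (c : nat) w (g g' : 'rV[R[i]]_n -> R[i]) :
  open V -> connected V -> holomorphic_on V g' -> open W -> W !=set0 -> W `<=` V ->
  (forall p, W p -> g p = g' p) ->
  (forall p, W p -> apply_op P g p - p 0 w ^+ c * apply_op Q g p = 0) ->
  forall p, V p -> apply_op P g' p - p 0 w ^+ c * apply_op Q g' p = 0.
Proof.
move=> oV cV hg' oW W0 WV gg' Wg.
pose G p := apply_op P g' p + (-1) * (p 0 w ^+ c * apply_op Q g' p).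
have sG : smooth_on V G.
  have sX : smooth_on V (fun p : 'rV[R[i]]_n => p 0 w ^+ c).
    by apply: smoothX; [exact: oV|exact: smooth_coord].
  have s1 : smooth_on V (fun _ : 'rV[R[i]]_n => -1 : R[i]) by exact: smooth_cst.
  have s2 := smoothM oV s1 (smoothM oV sX (smooth_apply_op Q oV hg')).
  exact: (smoothD oV (smooth_apply_op P oV hg') s2).
have W_G p : W p -> G p = 0.
  move=> Wp; rewrite /G mulN1r -(apply_op_eq_on P oW gg' Wp).
  by rewrite -(apply_op_eq_on Q oW gg' Wp); exact: Wg.
by move=> p Vp; rewrite -(identity_theorem oV cV sG oW W0 WV W_G Vp) /G mulN1r.
Qed.

Section Admissible.
Variables (R : realType) (m k d : nat).
Local Notation C := R[i].
Local Notation N := m.+1.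
Variables (tau : 'I_k -> nat) (alpha : forall l : 'I_k, 'I_(tau l) -> 'I_N -> nat).
Variable mu : 'I_d -> {l : 'I_k & 'I_(tau l)}.
Hypothesis mu_inj : injective mu.
Hypothesis sizeL : (\sum_(q < k) (tau q).+1 = N + (d + (k + k)))%N.
Variables (Dl : nat) (M : 'M[int]_(N + (d + (k + k)))).
Variables (ii : 'I_N -> int) (zeta : 'I_k -> C).
Variables (lam : 'I_k -> C -> C) (ga : chain R N).
Hypothesis lam_log : forall l, log_branch (lam l).
Local Notation L := (castmx (sizeL, erefl) (exponent_matrix alpha mu)).
Hypothesis Dl_gt0 : (0 < Dl)%N.
Hypothesis ML : M *m L = Dl%:R%:M.
Hypothesis LM : L *m M = Dl%:R%:M.
Local Notation blk := (row_block (tau := tau) sizeL).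
Local Notation al := (row_exponent alpha sizeL).
Local Notation ind := (param_row mu sizeL).

Lemma fibre_integralE : fibre_integral alpha mu lam zeta ii ga =
  integral blk al ind lam ga zeta ii.
Proof.
apply/funext => p; rewrite /fibre_integral /integral; congr chain_integral.
apply/funext => x; congr (_ * _).
by apply: eq_bigr => l _; rewrite (fibre_polyE _ mu_inj sizeL).
Qed.

Lemma admissible_good p : admissible_parameters alpha mu ga p -> good blk al ind ga p.
Proof.
case=> _ [gaX _] gaR; split=> [c|c t j tc|c t l tc].
- by have [] := gaX c.
- by have [_ /(_ t tc)[/(_ j)]] := gaX c.
- by rewrite -(fibre_polyE _ mu_inj sizeL); exact: gaR.
Qed.

(** On an initial branch the equation holds at each point by direct computation, so [V] may be
    disconnected; in a continuation the connectedness of [V'] carries it from [W] to all of [V']. *)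
Lemma branch_equation (V : set 'rV[C]_(k + d)) (g : 'rV[C]_(k + d) -> C) :
  analytic_branch (admissible_parameters alpha mu ga)
    (fibre_integral alpha mu lam zeta ii ga) V g ->
  holomorphic_on V g /\ forall p, V p -> forall w,
    apply_op (horn_pos Dl M ii zeta (fun a => M (param_index w) a)) g p -
    p 0 w ^+ Dl * apply_op (horn_neg Dl M ii zeta (fun a => M (param_index w) a)) g p = 0.
Proof.
elim=> {V g} [V oV VU|V g V' g' W _ [_ IH] oV' cV' _ hg' oW W0 WV gg'].
  have Vg p : V p -> good blk al ind ga p by move=> /VU /admissible_good.
  rewrite fibre_integralE; split.
    have S : smooth_on V (integral blk al ind lam ga zeta ii).
      exact: (smooth_integral (@param_row_inj _ _ _ _ _ mu_inj sizeL) lam_log zeta ii oV Vg).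
    exact: S.
  move=> p Vp w; have [_ [_ bga] _] := VU _ Vp.
  have H := (horn_equation (@param_row_inj _ _ _ _ _ mu_inj sizeL) lam_log bga ii zeta Dl_gt0 ML LM
    (exponent_x alpha mu sizeL) (exponent_param alpha mu sizeL) (exponent_y alpha mu sizeL)
    oV Vg w Vp).
  exact: H.
split=> // p Vp w.
apply: (apply_op_equation_eq_on (W := W) (g := g) oV' cV' hg' oW W0 _ gg' _ Vp).
  by move=> q /WV[].
by move=> q /WV[Vq _]; exact: IH.
Qed.

End Admissible.

Theorem theorem2p4 (R : realType) (N k m : nat)
  (N_gt0 : (0 < N)%N) (k_gt0 : (0 < k)%N)
  (tau : 'I_k -> nat) (alpha : forall l : 'I_k, 'I_(tau l) -> 'I_N -> nat)
  (f_nondegenerate : nondegenerate_complete_intersection alpha R)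
  (sizeL : (\sum_(q < k) (tau q).+1 = N + (m + (k + k)))%N)
  (rank_cayley :
     \rank (map_mx intr (cayley_matrix alpha) : 'M[rat]_(_, _)) = (k + N)%N)
  (mu : 'I_m -> {l : 'I_k & 'I_(tau l)}) (mu_inj : injective mu)
  (L_nondegenerate :
     \det (castmx (sizeL, erefl) (exponent_matrix alpha mu)) != 0)
  (Dl : nat) (M : 'M[int]_(N + (m + (k + k))))
  (M_def : reduced_inverse
     (castmx (sizeL, erefl) (exponent_matrix alpha mu)) Dl M)
  (ii : 'I_N -> int) (zeta : 'I_k -> R[i])
  (lam : 'I_k -> R[i] -> R[i]) (lam_log : forall l, log_branch (lam l))
  (gamma : chain R N) :
  (forall (V : set 'rV[R[i]]_(k + m)) (I : 'rV[R[i]]_(k + m) -> R[i]),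
     analytic_branch (admissible_parameters alpha mu gamma)
       (fibre_integral alpha mu lam zeta ii gamma) V I ->
     holomorphic_on V I /\
     forall p, V p ->
       (forall q : 'I_k,
          apply_op (hornP Dl M ii zeta q) I p -
          p 0 (lshift m q) ^+ Dl * apply_op (hornQ Dl M ii zeta q) I p = 0) /\
       (forall r : 'I_m,
          apply_op (hornP' Dl M ii zeta r) I p -
          p 0 (rshift k r) ^+ Dl * apply_op (hornQ' Dl M ii zeta r) I p = 0))
  /\
  (forall q : 'I_k,
     [/\ Posz (op_degree (hornP Dl M ii zeta q)) =
           \sum_(a | 0 < entryB M q a) entryB M q a,
         \sum_(a | 0 < entryB M q a) entryB M q a =
           - \sum_(a | entryB M q a < 0) entryB M q a &
         - \sum_(a | entryB M q a < 0) entryB M q a =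
           Posz (op_degree (hornQ Dl M ii zeta q))])
  /\
  (forall r : 'I_m,
     [/\ Posz (op_degree (hornP' Dl M ii zeta r)) =
           \sum_(a | 0 < entryC M r a) entryC M r a,
         \sum_(a | 0 < entryC M r a) entryC M r a =
           - \sum_(a | entryC M r a < 0) entryC M r a &
         - \sum_(a | entryC M r a < 0) entryC M r a =
           Posz (op_degree (hornQ' Dl M ii zeta r))]).
Proof.
(* The faces of an N-cube have dimension [N.-1]; with [N] a successor this reduces to [N'], as in
   Stokes' theorem above. *)
case: N N_gt0 => [//|N'] _ in alpha f_nondegenerate sizeL rank_cayley L_nondegenerate M M_def ii gamma *.
have [Dl0 ML LM] := reduced_inverse_mul L_nondegenerate M_def.
have EB q : entryB M q = fun a => M (param_index (lshift m q)) a.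
  by apply/funext => a; rewrite param_indexl.
have EC r : entryC M r = fun a => M (param_index (rshift k r)) a.
  by apply/funext => a; rewrite param_indexr.
split; [|split].
- move=> V I /(branch_equation mu_inj lam_log Dl0 ML LM)[hI eqI].
  split=> // p Vp; split=> [q|r].
    by rewrite /hornP /hornQ EB; exact: eqI.
  by rewrite /hornP' /hornQ' EC; exact: eqI.
- move=> q; rewrite /hornP /hornQ EB.
  exact: (horn_degrees ii zeta Dl0 (lshift m q) ML (exponent_y alpha mu sizeL)).
- move=> r; rewrite /hornP' /hornQ' EC.
  exact: (horn_degrees ii zeta Dl0 (rshift k r) ML (exponent_y alpha mu sizeL)).
Qed.
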